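(* Suppose $(w,q)$ is a solution of the Navier-Stokes equations (as in the context) with $w\in L^{\infty}(0,\infty;H^3)$, $w_t,w_{tt}\in L^{\infty}(0,\infty;H^1)$, $q\in L^{\infty}(0,\infty;H^1)$, and denote $$C_w = \| w_{tt} \|^2_{L^{\infty}(0,\infty;H^{-1})}+ \| w_{t} \|_{L^{\infty}(0,\infty;L^2)}^2 \, \| w \|_{L^{\infty}(0,\infty;H^3)}^2 + \| \nabla w \|_{L^{\infty}(0,\infty;L^{\infty})},\qquad C_q = \| q\|_{L^{\infty}(0,\infty;H^1)}^2 .$$ There is a constant $C_0>0$, independent of $\Delta t$ and $\mu$, such that the following holds. Let $\{u^n\}$, $n=1,2,3,\dots$, denote the solution of the CDA-Penalty algorithm (defined in the context), with $\Delta t\le1$, $\mu\ge\Delta t^{-2}$, $\mu> C_0\,\nu^{-1}C_w^2-C_P^{-2}\frac{\nu}{2}$, and $\mu H^2\le\frac{\nu}{2C_I^2}$. Then for every positive integer $n$, $$\|u^n-w^n\|\le C\,\Delta t,$$ where $C$ depends on the problem data and the Navier-Stokes solution but is independent of $\Delta t$ and $\mu$ (and the same $C$ serves for all $n$).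
   Context: $\Omega\subset\mathbb{R}^d$, $d=2,3$, is an open bounded Lipschitz domain. $\|\cdot\|$ and $(\cdot,\cdot)$ are the $L^2(\Omega)$ norm and inner product. $X=H^1_0(\Omega)^d$. $C_P$ is the Poincaré constant: $\|v\|\le C_P\|\nabla v\|$ for $v\in X$. Navier-Stokes equations: with viscosity $\nu>0$ and forcing $f\in L^\infty(0,\infty;H^{-1}(\Omega))$, $(w,q)$ satisfies $w_t+w\cdot\nabla w+\nabla q-\nu\Delta w=f$, $\nabla\cdot w=0$, $w|_{\partial\Omega}=0$, $w(0)=w^0$. Here $\Delta t>0$ is the time step, $t^n=n\Delta t$, $w^n=w(t^n)$, $f^n=f(t^n)$. Skew-symmetrized nonlinear term: $\tilde b(u,v,z)=((u\cdot\nabla)v,z)+\frac12((\nabla\cdot u)v,z)$ for $u,v,z\in X$; equivalently $\tilde b(u,v,z)=\frac12\big(((u\cdot\nabla)v,z)-((u\cdot\nabla)z,v)\big)$. Measurement interpolant: $I_H$ is a (linear) interpolation operator on a regular conforming coarse mesh of maximum spacing $H$, into vector-valued piecewise polynomials of some fixed degree, satisfying for all $\phi\in X$: $\|I_H(\phi)-\phi\|\le C_IH\|\nabla\phi\|$ and $\|I_H(\phi)\|\le C_I\|\phi\|$. CDA-Penalty algorithm (semi-discrete): let $u^0=w^0$, let $\varepsilon>0$ be the penalty parameter and $\mu\ge0$ a nudging parameter. For $n=0,1,2,\dots$ find $u^{n+1}\in X$ such that for all $v\in X$ $$\tfrac1{\Delta t}(u^{n+1}-u^n,v)+\tilde b(u^n,u^{n+1},v)+\nu(\nabla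 u^{n+1},\nabla v)+\varepsilon^{-1}(\nabla\cdot u^{n+1},\nabla\cdot v)+\mu(I_H(u^{n+1}-w^{n+1}),v)=(f^{n+1},v).$$ *)

(* Defs.v *)
From HB Require Import structures.
From mathcomp Require Import all_boot all_order all_algebra.
From mathcomp Require Import all_classical all_reals all_analysis ess_sup_inf.
Set Implicit Arguments.
Unset Strict Implicit.
Unset Printing Implicit Defensive.
Import Order.TTheory GRing.Theory Num.Theory.
Import numFieldNormedType.Exports.
Local Open Scope classical_set_scope.
Local Open Scope ring_scope.

(* R^n is 'rV[R]_n.  It carries the product sigma-algebra of the Borel sets of
   R (which is the Borel sigma-algebra), and Lebesgue measure on R^(n+1) is the
   image of the product of Lebesgue measures on R and R^n under
   (a, x) |-> (a, x_0, ..., x_(n-1)). *)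
Section measurable_row_vectors.
Variables (R : realType) (n : nat).
Let coors : 'I_n -> 'rV[R]_n -> R := fun i x => x ord0 i.

Let rV_set0 : g_sigma_preimage coors set0.
Proof. exact: sigma_algebra0. Qed.

Let rV_setC A : g_sigma_preimage coors A -> g_sigma_preimage coors (~` A).
Proof. exact: sigma_algebraC. Qed.

Let rV_bigcup (F : _^nat) : (forall i, g_sigma_preimage coors (F i)) ->
  g_sigma_preimage coors (\bigcup_i (F i)).
Proof. exact: sigma_algebra_bigcup. Qed.

HB.instance Definition _ := @isMeasurable.Build default_measure_display
  'rV[R]_n (g_sigma_preimage coors) rV_set0 rV_setC rV_bigcup.

Lemma measurable_coord (i : 'I_n) :
  measurable_fun [set: 'rV[R]_n] (fun x : 'rV[R]_n => x ord0 i).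
Proof.
move=> _ Y mY; rewrite setTI; apply: sub_sigma_algebra => /=.
rewrite -bigcup_seq/=; exists i => /=; first by rewrite mem_index_enum.
by exists Y => //; rewrite setTI.
Qed.

Lemma measurable_fun_coordP d (T : measurableType d) (f : T -> 'rV[R]_n) :
  (forall i, measurable_fun [set: T] (fun t => f t ord0 i)) ->
  measurable_fun [set: T] f.
Proof.
move=> mf.
have sub : g_sigma_preimage (fun i => coors i \o f) `<=` measurable.
  apply: smallest_sub; first exact: sigma_algebra_measurable.
  rewrite -bigcup_seq => A [i _ [B mB <-]].
  exact: mf.
rewrite g_sigma_preimage_comp in sub.
by move=> _ A mA; apply: sub; exists A.
Qed.

End measurable_row_vectors.

Section lebesgue_rV_step.
Local Open Scope ereal_scope.
Variables (R : realType) (n : nat).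

Definition rV_cons (p : measurableTypeR R * 'rV[R]_n) : 'rV[R]_n.+1 :=
  row_mx ((p.1 : R)%:M : 'rV[R]_1) p.2.

Definition rV_uncons (x : 'rV[R]_n.+1) : measurableTypeR R * 'rV[R]_n :=
  (x ord0 ord0, \row_i x ord0 (lift ord0 i)).

Lemma rV_consK : cancel rV_cons rV_uncons.
Proof.
move=> [a x]; rewrite /rV_uncons /rV_cons /=; congr pair.
  have -> : ord0 = lshift n (ord0 : 'I_1) :> 'I_(1 + n) by exact/val_inj.
  by rewrite (row_mxEl ((a : R)%:M : 'rV[R]_1) x) mxE eqxx.
apply/rowP => i; rewrite mxE.
have -> : lift ord0 i = rshift 1 i :> 'I_(1 + n) by exact/val_inj.
by rewrite (row_mxEr ((a : R)%:M : 'rV[R]_1) x).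
Qed.

Lemma measurable_rV_cons : measurable_fun [set: measurableTypeR R * 'rV[R]_n] rV_cons.
Proof.
apply: measurable_fun_coordP => i.
have [j ->|j ->] := split_ordP (i : 'I_(1 + n)).
  rewrite (_ : (fun _ => _) = fst) //; apply/funext => -[a x] /=.
  by rewrite /rV_cons (row_mxEl ((a : R)%:M : 'rV[R]_1) x) !ord1 mxE eqxx.
rewrite (_ : (fun _ => _) = (fun y : 'rV[R]_n => y ord0 j) \o snd).
  exact: measurableT_comp (@measurable_coord R n j) measurable_snd.
by apply/funext => -[a x] /=; rewrite /rV_cons (row_mxEr ((a : R)%:M : 'rV[R]_1) x).
Qed.

HB.instance Definition _ := isMeasurableFun.Build _ _ _ _ rV_cons
  measurable_rV_cons.

Lemma measurable_rV_uncons : measurable_fun [set: 'rV[R]_n.+1] rV_uncons.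
Proof.
apply: measurable_fun_pair => /=; first exact: measurable_coord.
apply: measurable_fun_coordP => i.
rewrite (_ : (fun _ => _) = (fun x : 'rV[R]_n.+1 => x ord0 (lift ord0 i))).
  exact: measurable_coord.
by apply/funext => x; rewrite mxE.
Qed.

Variable m : {sigma_finite_measure set 'rV[R]_n -> \bar R}.

Definition lebesgue_rV_step : set 'rV[R]_n.+1 -> \bar R :=
  pushforward (@lebesgue_measure R \x m) rV_cons.

Let step0 : lebesgue_rV_step set0 = 0.
Proof. exact: measure0. Qed.

Let step_ge0 A : 0 <= lebesgue_rV_step A.
Proof. exact: measure_ge0. Qed.

Let step_sigma_additive : semi_sigma_additive lebesgue_rV_step.
Proof. exact: measure_semi_sigma_additive. Qed.

HB.instance Definition _ := isMeasure.Build _ _ _ lebesgue_rV_step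
  step0 step_ge0 step_sigma_additive.

Let step_sigma_finite : sigma_finite setT lebesgue_rV_step.
Proof.
have /sigma_finiteP[F [TF ndF Foo]] := sigma_finiteT (@lebesgue_measure R).
have /sigma_finiteP[G [TG ndG Goo]] := sigma_finiteT m.
exists (fun k => rV_uncons @^-1` (F k `*` G k)).
  rewrite -preimage_bigcup -(preimage_setT rV_uncons); congr (_ @^-1` _).
  rewrite -setXTT TF TG predeqE => -[x y]; split.
    move=> [/= [k _ Fkx] [l _ Gly]]; exists (maxn k l) => //; split.
    - by move: x Fkx; exact/subsetPset/ndF/leq_maxl.
    - by move: y Gly; exact/subsetPset/ndG/leq_maxr.
  by move=> [k _ []/= ? ?]; split; exists k.
move=> k; have [mF Fk] := Foo k; have [mG Gk] := Goo k.
have mFG : measurable (F k `*` G k) by exact: measurableX.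
split; first by rewrite -[X in measurable X]setTI; exact: measurable_rV_uncons.
rewrite /lebesgue_rV_step /pushforward -comp_preimage.
rewrite (_ : rV_uncons \o rV_cons = id); last first.
  by apply/funext => p /=; rewrite rV_consK.
by rewrite preimage_id product_measure1E// lte_mul_pinfty// ge0_fin_numE.
Qed.

HB.instance Definition _ := Measure_isSigmaFinite.Build _ _ _
  lebesgue_rV_step step_sigma_finite.

End lebesgue_rV_step.

Fixpoint lebesgue_rV (R : realType) (n : nat) :
    {sigma_finite_measure set 'rV[R]_n -> \bar R} :=
  match n with
  | 0 => \d_(0 : 'rV[R]_0)
  | n'.+1 => lebesgue_rV_step (lebesgue_rV R n')
  end.

Section euclidean_geometry.
Variables (R : realType) (d : nat).
Implicit Types (x y z : 'rV[R]_d) (A : set 'rV[R]_d).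

(* the norm `|x| of the library on 'rV[R]_d is the maximum norm *)
Definition enorm x : R := Num.sqrt (\sum_i x ord0 i ^+ 2).

(* Near each boundary point, in the orthonormal coordinates given by Q, A is
   the strict epigraph, in the direction of the k-th axis, of a Lipschitz
   function of the other coordinates. *)
Definition lipschitz_boundary A : Prop :=
  forall x, (closure A `\` A) x ->
  exists (Q : 'M[R]_d) (k : 'I_d) (gamma : 'rV[R]_d -> R) (L r : R),
  [/\ Q *m Q^T = 1%:M,
      forall y z, `|gamma y - gamma z| <= L * enorm (y - z),
      forall y z, (forall j, j != k -> y ord0 j = z ord0 j) ->
        gamma y = gamma z,
      0 < r &
      forall y, enorm (y - x) < r ->
        (A y <-> gamma (y *m Q) < (y *m Q) ord0 k)].

Definition lipschitz_domain A : Prop :=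
  [/\ open A, connected A, bounded_set A & lipschitz_boundary A].

(* a d-simplex is given by its d + 1 vertices *)
Definition simplex := 'I_d.+1 -> 'rV[R]_d.

Definition barycentric (l : 'I_d.+1 -> R) : Prop :=
  (forall i, 0 <= l i) /\ \sum_i l i = 1.

Definition hull (K : simplex) : set 'rV[R]_d :=
  [set x | exists2 l, barycentric l & x = \sum_i l i *: K i].

(* the face of K spanned by the vertices that it shares with K' *)
Definition common_face (K K' : simplex) : set 'rV[R]_d :=
  [set x | exists l, [/\ barycentric l,
     forall i, l i != 0 -> exists j, K i = K' j & x = \sum_i l i *: K i]].

Definition diam (K : simplex) : R :=
  \big[Order.max/0]_i \big[Order.max/0]_j enorm (K i - K j).

(* The simplices cover the closure of A; those at the boundary may stick out
   of A, so that curved boundaries are allowed.  sigma is the shape-regularity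
   constant of the mesh. *)
Definition regular_mesh A (sigma H : R) (N : nat) (T : 'I_N -> simplex) :=
  [/\ closure A `<=` \bigcup_j hull (T j),
      forall j, hull (T j) `&` A !=set0,
      forall j j', hull (T j) `&` hull (T j') = common_face (T j) (T j'),
      forall j, exists c rho, [/\ 0 < rho, diam (T j) <= sigma * rho &
        forall y, enorm (y - c) <= rho -> hull (T j) y] &
      H = \big[Order.max/0]_j diam (T j)].

End euclidean_geometry.

Section function_spaces.
Variables (R : realType) (d : nat) (Omega : set 'rV[R]_d).

Local Notation field := ('I_d -> 'rV[R]_d -> R).
Local Notation leb := (lebesgue_rV R d).
Implicit Types (f g p : 'rV[R]_d -> R) (u v z : field) (s : seq 'I_d).

Definition multi_index (k : nat) := {ffun 'I_d -> 'I_k.+1}.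

Definition mabs k (al : multi_index k) : nat := (\sum_i al i)%N.

Definition mseq k (al : multi_index k) : seq 'I_d :=
  flatten [seq nseq (al i) i | i <- enum 'I_d].

Definition pder s f : 'rV[R]_d -> R :=
  foldr (fun i g x => 'D_(delta_mx ord0 i) g x) f s.

Definition smooth f : Prop := forall s, continuous (pder s f) /\
  forall x i, derivable (pder s f) x (delta_mx ord0 i).

Definition test_fun f : Prop := smooth f /\
  exists K, [/\ compact K, K `<=` Omega & forall x, ~ K x -> f x = 0].

Definition L2 f : Prop := measurable_fun Omega f /\
  (\int[leb]_(x in Omega) (f x ^+ 2)%:E < +oo)%E.

Definition ip f g : R := \int[leb]_(x in Omega) (f x * g x).

Definition L2norm f : R := Num.sqrt (ip f f).

(* g is the weak derivative of f along the indices in s, and lies in L^2 *)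
Definition is_weak_der s f g : Prop := L2 g /\
  forall p, test_fun p -> ip f (pder s p) = (-1) ^+ size s * ip g p.

(* weak derivatives are unique up to null sets *)
Definition wD s f : 'rV[R]_d -> R := xget (cst 0) [set g | is_weak_der s f g].

Definition sobolev k f : Prop := L2 f /\
  forall al : multi_index k, (mabs al <= k)%N ->
  exists g, is_weak_der (mseq al) f g.

Definition sobolev_norm k f : R :=
  Num.sqrt (\sum_(al : multi_index k | (mabs al <= k)%N)
              L2norm (wD (mseq al) f) ^+ 2).

Definition H10 f : Prop := sobolev 1 f /\
  exists2 p : nat -> 'rV[R]_d -> R, forall n, test_fun (p n) &
    (fun n => sobolev_norm 1 (p n - f)) @ \oo --> (0 : R).

Definition vL2 u : Prop := forall i, L2 (u i).

Definition vip u v : R := \sum_i ip (u i) (v i).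

Definition vL2norm u : R := Num.sqrt (vip u u).

Definition vsobolev k : set field := [set u | forall i, sobolev k (u i)].

Definition vsobolev_norm k u : R :=
  Num.sqrt (\sum_i sobolev_norm k (u i) ^+ 2).

Definition X : set field := [set u | forall i, H10 (u i)].

Definition gip u v : R := \sum_i \sum_j ip (wD [:: j] (u i)) (wD [:: j] (v i)).

Definition gradnorm u : R := Num.sqrt (gip u u).

Definition div u : 'rV[R]_d -> R := fun x => \sum_i wD [:: i] (u i) x.

(* (u . grad) v *)
Definition adv u v : field := fun i x => \sum_j u j x * wD [:: j] (v i) x.

Definition btilde u v z : R :=
  vip (adv u v) z + 2^-1 * vip (fun i x => div u x * v i x) z.

Definition gradLinf u : \bar R :=
  ess_sup leb ((fun x =>
    (Num.sqrt (\sum_i \sum_j wD [:: j] (u i) x ^+ 2))%:E) \_ Omega).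

(* H^-1, as a space of linear forms on X, with the norm dual to |grad v| *)
Definition Hm1 : set (field -> R) := [set F |
  (forall (a : R) u v, X u -> X v -> F (a *: u + v) = a * F u + F v) /\
  exists M : R, forall v, X v -> `|F v| <= M * gradnorm v].

Definition Hm1norm (F : field -> R) : \bar R :=
  ereal_sup [set (`|F v|)%:E | v in [set v | X v /\ gradnorm v <= 1]].

Definition poincare_constant (CP : R) : Prop :=
  0 < CP /\ forall v, X v -> vL2norm v <= CP * gradnorm v.

Definition polynomial_on (A : set 'rV[R]_d) (k : nat) f : Prop :=
  exists c : multi_index k -> R, {ae leb, forall x, A x ->
    f x = \sum_(al : multi_index k | (mabs al <= k)%N)
            c al * \prod_i x ord0 i ^+ al i}.

Definition interpolant (k : nat) (sigma H CI : R) (IH : field -> field) :=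
  exists (N : nat) (T : 'I_N -> simplex R d),
  [/\ regular_mesh Omega sigma H T,
      forall v, X v -> vL2 (IH v) /\
        forall j i, polynomial_on (Omega `&` hull (T j)) k (IH v i),
      forall (a : R) u v, X u -> X v -> {ae leb, forall x, Omega x ->
        forall i, IH (a *: u + v) i x = a * IH u i x + IH v i x},
      forall v, X v -> vL2norm (IH v - v) <= CI * H * gradnorm v &
      forall v, X v -> vL2norm (IH v) <= CI * vL2norm v].

End function_spaces.

(* Functions of time are defined everywhere on [0, +oo[ and L^oo(0, oo; Y) is
   understood for the Lebesgue measure on ]0, +oo[; Y is given by its carrier
   D and its norm N. *)
Section time_dependence.
Variable R : realType.
Local Notation mu := (@lebesgue_measure R).

Section Bochner.
Variables (Y : zmodType) (D : set Y) (N : Y -> \bar R).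

Definition strongly_measurable (h : R -> Y) : Prop :=
  exists s : nat -> R -> Y,
  [/\ forall k, finite_set (range (s k)) /\ range (s k) `<=` D,
      forall k y, measurable (s k @^-1` [set y]) &
      {ae mu, forall t, 0 < t ->
        (fun k => N (s k t - h t)) @ \oo --> (0 : \bar R)%E}].

Definition Linf_norm (h : R -> Y) : \bar R :=
  ess_sup mu ((fun t => N (h t)) \_ `]0, +oo[).

Definition Linf (h : R -> Y) : Prop :=
  [/\ {ae mu, forall t, 0 < t -> D (h t)},
      strongly_measurable h & (Linf_norm h < +oo)%E].

End Bochner.

Definition time_test_fun (psi : R -> R) : Prop :=
  (forall n t, derivable (derive1n n psi) t 1) /\
  exists a b, 0 < a /\ forall t, ~ (a <= t <= b) -> psi t = 0.

Variables (d : nat) (Omega : set 'rV[R]_d).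
Local Notation field := ('I_d -> 'rV[R]_d -> R).

Definition L2_continuous (h : R -> field) : Prop :=
  forall t, 0 <= t -> vL2 Omega (h t) /\
    (fun s => vL2norm Omega (h s - h t)) @ within [set s | 0 <= s] (nbhs t)
      --> (0 : R).

(* g is the weak time derivative of h, and h is the continuous representative
   of its class *)
Definition has_time_derivative (h g : R -> field) : Prop :=
  L2_continuous h /\
  forall (psi : R -> R) (phi : field), time_test_fun psi ->
    (forall i, test_fun Omega (phi i)) ->
  \int[mu]_(t in `]0, +oo[) (derive1 psi t * vip Omega (h t) phi) =
  - \int[mu]_(t in `]0, +oo[) (psi t * vip Omega (g t) phi).

(* f lies in L^oo(0, oo; H^-1).  Since f is evaluated at the discrete times, it
   is given by a representative bounded at every time. *)
Definition forcing (f : R -> field -> R) : Prop :=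
  Linf (Hm1 Omega) (Hm1norm Omega) f /\
  forall t, 0 < t -> Hm1 Omega (f t) /\
    (Hm1norm Omega (f t) <= Linf_norm (Hm1norm Omega) f)%E.

(* the momentum equation holds in H^-1 at every positive time *)
Record nse_solution (nu : R) (f : R -> field -> R) (w0 : field)
    (w wt : R -> field) (q : R -> 'rV[R]_d -> R) : Prop := {
  nse_X : forall t, 0 <= t -> X Omega (w t);
  nse_q : forall t, 0 < t -> L2 Omega (q t);
  nse_time_derivative : has_time_derivative w wt;
  nse_momentum : forall t v, 0 < t -> X Omega v ->
    vip Omega (wt t) v + vip Omega (adv Omega (w t) (w t)) v
    - ip Omega (q t) (div Omega v) + nu * gip Omega (w t) v = f t v;
  nse_div : forall t, 0 <= t ->
    {ae lebesgue_rV R d, forall x, Omega x -> div Omega (w t) x = 0};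
  nse_init : w 0 = w0 }.

Record cda_penalty (nu dt eps mu : R) (IH : field -> field)
    (f : R -> field -> R) (w0 : field) (w : R -> field) (u : nat -> field) :
    Prop := {
  cda_init : u 0%N = w0;
  cda_X : forall n, X Omega (u n.+1);
  cda_step : forall n v, X Omega v ->
    dt^-1 * vip Omega (u n.+1 - u n) v
    + btilde Omega (u n) (u n.+1) v
    + nu * gip Omega (u n.+1) v
    + eps^-1 * ip Omega (div Omega (u n.+1)) (div Omega v)
    + mu * vip Omega (IH (u n.+1 - w (n.+1%:R * dt))) v
    = f (n.+1%:R * dt) v }.

Definition C_w (w wt wtt : R -> field) : \bar R :=
  (Linf_norm (fun u => Hm1norm Omega (vip Omega u)) wtt ^+ 2
   + Linf_norm (fun u => (vL2norm Omega u)%:E) wt ^+ 2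
     * Linf_norm (fun u => (vsobolev_norm Omega 3 u)%:E) w ^+ 2
   + Linf_norm (gradLinf Omega) w)%E.

Definition C_q (q : R -> 'rV[R]_d -> R) : \bar R :=
  (Linf_norm (fun p => (sobolev_norm Omega 1 p)%:E) q ^+ 2)%E.

End time_dependence.

(* Main.v *)
(* Because mu >= dt^-2, the nudging term absorbs an O(1) residual at the price of
   an O(1/mu) = O(dt^2) squared error, so the consistency error of the scheme need
   not be small.  Testing the scheme with u^(n+1) bounds |u^n| uniformly in n.  Let
   e^n = u^n - w^n and test with e^(n+1).  The difference quotient of w contributes
   (2 sup |w| / dt) |e^(n+1)| <= mu/4 |e^(n+1)|^2 + O(1); the penalty term is
   nonnegative since div w = 0, so that the pressure never enters; the convective
   term reduces to btilde(u^n, w^(n+1), e^(n+1)), which Ladyzhenskaya's inequality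
   bounds by nu/16 (|grad u^n|^2 + |grad e^(n+1)|^2) + O(1).  With
   E_n = |e^n|^2 / (2 dt) + nu/8 |grad e^n|^2 this gives
   5/4 E_(n+1) + mu/8 |e^(n+1)|^2 <= E_n + K, hence E_n <= 4 K for all n since
   E_0 = 0, and |e^(n+1)|^2 <= 40 K / mu <= 40 K dt^2.
   The bound on |grad w(t)| at every time follows from the almost everywhere bound
   and the L^2 continuity of w, by testing grad w against test functions. *)

(* The L^4 theory has to be extracted from the definition of H^1_0 as a closure of test functions.
   For test functions, Ladyzhenskaya's inequality and the skew-symmetry of the convective form both
   come from the fundamental theorem of calculus on coordinate lines combined with Fubini. Passing
   to the limit in a product of two fields and a derivative that is bounded only in L^2 requires L^4
   convergence of the two fields, so the embedding must precede the trilinear form. The embedding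
   takes the form |f|_4^2 <= de |grad f|^2 + C |f|^2 with [de] free: this covers both dimensions at
   once and lets convection be charged to any chosen share of the viscosity, with C independent of
   dt and mu. That C multiplies |u^n|^2 + |e^(n+1)|^2, which cannot be absorbed on the left when mu
   is of order 1; the uniform bound on |u^n| moves it into the constant K. Viscosity also pays for
   the interpolation error, mu |IH e - e|^2 <= nu/2 |grad e|^2. Since the convecting field is u^n,
   the gradient of the previous step appears on the right, and this forces a gradient term into
   E_n. *)
Require Import Defs.
From HB Require Import structures.
From mathcomp Require Import all_boot all_order all_algebra.
From mathcomp Require Import all_classical all_reals all_analysis ess_sup_inf.
From mathcomp Require Import measurable_realfun ring lra.
Import Order.TTheory GRing.Theory Num.Theory.
Import numFieldNormedType.Exports.
Local Open Scope classical_set_scope.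
Local Open Scope ring_scope.
Set Implicit Arguments.
Unset Strict Implicit.
Unset Printing Implicit Defensive.

(** * Square integrable functions *)

Section semidefinite_forms.
Variables (R : realType) (V : lmodType R) (S : set V) (B : V -> V -> R).
Hypothesis SL : forall a u v, S u -> S v -> S (a *: u + v).
Hypothesis BL : forall a u v w, S u -> S v -> S w ->
  B (a *: u + v) w = a * B u w + B v w.
Hypothesis BC : forall u v, S u -> S v -> B u v = B v u.
Hypothesis B0 : forall u, S u -> 0 <= B u u.

(** The discriminant argument for t |-> B (u + t v) (u + t v). The form is only semidefinite because
    [L2] consists of functions and not of classes, so B v v = 0 has to be treated separately. *)
Lemma semidefinite_sqr_le u v : S u -> S v -> B u v ^+ 2 <= B u u * B v v.
Proof.
move=> Su Sv.
have quad t : 0 <= B u u + 2 * t * B u v + t ^+ 2 * B v v.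
  have Stu := SL t Sv Su.
  have := B0 Stu; rewrite BL// (BC Sv)// (BC Su Stu) !BL// (BC Sv Su); nra.
have [v0|v0] := eqVneq (B v v) 0.
  rewrite v0 mulr0; have [->|uv0] := eqVneq (B u v) 0; first by rewrite expr0n.
  (* With B v v = 0 the quadratic is affine in t, and this t gives it the value -1. *)
  have := quad (- (B u u + 1) / (2 * B u v)).
  rewrite v0 mulr0 addr0.
  have -> : 2 * (- (B u u + 1) / (2 * B u v)) * B u v = - (B u u + 1) by field.
  lra.
have vp : 0 < B v v by rewrite lt_neqAle eq_sym v0 B0.
have := quad (- B u v / B v v).
have -> : B u u + 2 * (- B u v / B v v) * B u v + (- B u v / B v v) ^+ 2 * B v v =
  (B u u * B v v - B u v ^+ 2) / B v v by field.
by rewrite pmulr_lge0 ?invr_gt0// subr_ge0.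
Qed.

Lemma semidefinite_le u v : S u -> S v ->
  `|B u v| <= Num.sqrt (B u u) * Num.sqrt (B v v).
Proof.
move=> Su Sv; rewrite -sqrtrM ?B0// -sqrtr_sqr.
by rewrite ler_wsqrtr// semidefinite_sqr_le.
Qed.

End semidefinite_forms.

Section L2_theory.
Variables (R : realType) (d : nat) (Omega : set 'rV[R]_d).
Hypothesis mOmega : measurable Omega.
Local Notation leb := (lebesgue_rV R d).
Local Notation L2 := (L2 Omega).
Local Notation ip := (ip Omega).
Local Notation L2norm := (L2norm Omega).
Implicit Types f g h : 'rV[R]_d -> R.

Lemma L2_measurable f : L2 f -> measurable_fun Omega f.
Proof. by case. Qed.

Lemma L2_integrable_sqr f : L2 f -> leb.-integrable Omega (EFin \o (fun x => f x ^+ 2)).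
Proof.
move=> [mf fi]; apply/integrableP; split.
  by apply/measurable_EFinP; exact: measurable_funX.
rewrite (eq_integral (fun x => (f x ^+ 2)%:E)) // => x _ /=.
by rewrite ger0_norm// sqr_ge0.
Qed.

Lemma integrable_sqr_L2 f : measurable_fun Omega f ->
  leb.-integrable Omega (EFin \o (fun x => f x ^+ 2)) -> L2 f.
Proof.
move=> mf /integrableP[_ fi]; split=> //; apply: le_lt_trans fi.
rewrite le_eqVlt; apply/orP; left; apply/eqP; apply: eq_integral => x _ /=.
by rewrite ger0_norm// sqr_ge0.
Qed.

Lemma dominated_L2 f g : measurable_fun Omega f ->
  leb.-integrable Omega (EFin \o g) -> (forall x, Omega x -> f x ^+ 2 <= g x) ->
  L2 f.
Proof.
move=> mf ig fg; apply: integrable_sqr_L2 => //.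
apply: le_integrable ig => //.
  by apply/measurable_EFinP; exact: measurable_funX.
move=> x Dx /=; rewrite lee_fin ger0_norm ?sqr_ge0//.
by rewrite (le_trans (fg x Dx))// ler_norm.
Qed.

Lemma L2_integrableM f g : L2 f -> L2 g -> leb.-integrable Omega (EFin \o (fun x => f x * g x)).
Proof.
move=> Lf Lg.
have i2 : leb.-integrable Omega (EFin \o (fun x => f x ^+ 2 + g x ^+ 2)).
  exact: (integrableD mOmega (L2_integrable_sqr Lf) (L2_integrable_sqr Lg)).
apply: le_integrable i2 => //.
  by apply/measurable_EFinP; apply: measurable_funM; apply: L2_measurable.
move=> x _ /=; rewrite lee_fin [leRHS]ger0_norm ?addr_ge0 ?sqr_ge0//.
by rewrite ler_norml; apply/andP; split; nra.
Qed.

Lemma L2D f g : L2 f -> L2 g -> L2 (f + g).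
Proof.
move=> Lf Lg.
have i2 := integrableD mOmega (L2_integrable_sqr Lf) (L2_integrable_sqr Lg).
have i4 := integrableD mOmega i2 i2.
apply: (dominated_L2 (g := fun x => (f x ^+ 2 + g x ^+ 2) + (f x ^+ 2 + g x ^+ 2))) => //.
  by apply: measurable_funD; exact: L2_measurable.
move=> x _; have -> : (f + g) x = f x + g x by [].
  by have := sqr_ge0 (f x - g x); nra.
Qed.

Lemma L2Z a f : L2 f -> L2 (a *: f).
Proof.
move=> Lf; have := integrableZl mOmega (a ^+ 2) (L2_integrable_sqr Lf).
move=> i2; apply: (dominated_L2 (g := fun x => a ^+ 2 * f x ^+ 2)) => //.
  rewrite (_ : a *: f = (fun x => a * f x)) //.
  by apply: measurable_funM => //; exact: L2_measurable.
by move=> x _; rewrite /GRing.scale /= exprMn.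
Qed.

Lemma L2_0 : L2 0.
Proof.
split; first exact: measurable_cst.
rewrite (_ : (\int[leb]_(x in Omega) _)%E = 0%E) ?ltry//.
by rewrite integral0_eq// => x _; rewrite expr0n.
Qed.

Lemma L2N f : L2 f -> L2 (- f).
Proof. by rewrite -scaleN1r; exact: L2Z. Qed.

Lemma L2B f g : L2 f -> L2 g -> L2 (f - g).
Proof. by move=> ? ?; apply: L2D => //; exact: L2N. Qed.

Lemma ipC f g : ip f g = ip g f.
Proof. by rewrite /Defs.ip; under eq_Rintegral do rewrite mulrC. Qed.

Lemma ipDl f g h : L2 f -> L2 g -> L2 h -> ip (f + g) h = ip f h + ip g h.
Proof.
move=> Lf Lg Lh; rewrite /Defs.ip -RintegralD//; last 2 first.
- exact: L2_integrableM.
- exact: L2_integrableM.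
by under eq_Rintegral do rewrite mulrDl.
Qed.

Lemma ipZl a f g : L2 f -> L2 g -> ip (a *: f) g = a * ip f g.
Proof.
move=> Lf Lg; rewrite /Defs.ip -RintegralZl//; last exact: L2_integrableM.
by under eq_Rintegral do rewrite -mulrA.
Qed.

Lemma ipDr f g h : L2 f -> L2 g -> L2 h -> ip h (f + g) = ip h f + ip h g.
Proof. by move=> *; rewrite ipC ipDl// !(ipC h). Qed.

Lemma ipZr a f g : L2 f -> L2 g -> ip f (a *: g) = a * ip f g.
Proof. by move=> *; rewrite ipC ipZl// ipC. Qed.

Lemma ipNl f g : L2 f -> L2 g -> ip (- f) g = - ip f g.
Proof. by move=> *; rewrite -scaleN1r ipZl// mulN1r. Qed.

Lemma ipNr f g : L2 f -> L2 g -> ip f (- g) = - ip f g.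
Proof. by move=> *; rewrite ipC ipNl// ipC. Qed.

Lemma ipBl f g h : L2 f -> L2 g -> L2 h -> ip (f - g) h = ip f h - ip g h.
Proof. by move=> *; rewrite ipDl ?ipNl//; exact: L2N. Qed.

Lemma ipBr f g h : L2 f -> L2 g -> L2 h -> ip h (f - g) = ip h f - ip h g.
Proof. by move=> *; rewrite ipDr ?ipNr//; exact: L2N. Qed.

Lemma ip_ge0 f : 0 <= ip f f.
Proof. by apply: Rintegral_ge0 => x _; rewrite -expr2 sqr_ge0. Qed.

Lemma ip_sqr_le f g : L2 f -> L2 g -> ip f g ^+ 2 <= ip f f * ip g g.
Proof.
apply: (semidefinite_sqr_le (S := L2)).
- by move=> a u v Lu Lv; apply: L2D => //; exact: L2Z.
- by move=> a u v w Lu Lv Lw; rewrite ipDl ?ipZl//; exact: L2Z.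
- by move=> u v _ _; exact: ipC.
- by move=> u _; exact: ip_ge0.
Qed.

Lemma L2norm_ge0 f : 0 <= L2norm f.
Proof. exact: sqrtr_ge0. Qed.

Lemma L2norm_sqr f : L2norm f ^+ 2 = ip f f.
Proof. by rewrite sqr_sqrtr ?ip_ge0. Qed.

Lemma ip_le_norm f g : L2 f -> L2 g -> `|ip f g| <= L2norm f * L2norm g.
Proof.
move=> Lf Lg; rewrite -sqrtrM ?ip_ge0// -sqrtr_sqr.
by rewrite ler_wsqrtr// ip_sqr_le.
Qed.

Lemma L2normD f g : L2 f -> L2 g -> L2norm (f + g) <= L2norm f + L2norm g.
Proof.
move=> Lf Lg; rewrite -(@ler_pXn2r _ 2) ?nnegrE ?addr_ge0 ?L2norm_ge0//.
have := ip_le_norm Lf Lg; rewrite ler_norml => /andP[_ fg].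
rewrite sqrrD !L2norm_sqr ipDl ?ipDr//; last exact: L2D.
by rewrite (ipC g f); lra.
Qed.

Lemma L2normZ a f : L2 f -> L2norm (a *: f) = `|a| * L2norm f.
Proof.
move=> Lf; rewrite /Defs.L2norm ipZl ?ipZr//; last exact: L2Z.
by rewrite mulrA -expr2 sqrtrM ?sqr_ge0// sqrtr_sqr.
Qed.

Lemma L2normN f : L2 f -> L2norm (- f) = L2norm f.
Proof. by move=> Lf; rewrite -scaleN1r L2normZ// normrN1 mul1r. Qed.

Lemma L2normB f g : L2 f -> L2 g -> L2norm (f - g) <= L2norm f + L2norm g.
Proof. by move=> Lf Lg; rewrite -(L2normN Lg) L2normD//; exact: L2N. Qed.

End L2_theory.

(** * Lebesgue measure on row vectors *)

Definition box (R : realType) n (r : R) : set 'rV[R]_n :=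
  [set x | forall i, `|x ord0 i| <= r].
Arguments box {R} n r.

Section measurability_rV.
Variable R : realType.

Lemma continuous_rV (T : topologicalType) n (f : T -> 'rV[R]_n) :
  (forall i, continuous (fun t => f t ord0 i)) -> continuous f.
Proof.
move=> cf t; apply/cvgrPdist_lt => e e0.
have : \forall s \near t, forall i, `|f t ord0 i - f s ord0 i| < e.
  apply: filter_forall => i; have /cvgrPdist_lt := cf i t.
  by move/(_ _ e0).
apply: filterS => s fs.
rewrite [ltLHS]/Num.norm/= mx_normrE; apply/bigmax_ltP; split => //= -[i j] _ /=.
by rewrite !mxE ord1; exact: fs.
Qed.

Definition obox n (a b : 'rV[R]_n) : set 'rV[R]_n :=
  [set x | forall i, a ord0 i < x ord0 i < b ord0 i].
Definition cbox n (a b : 'rV[R]_n) : set 'rV[R]_n :=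
  [set x | forall i, a ord0 i <= x ord0 i <= b ord0 i].

Lemma obox_sub_cbox n (a b : 'rV[R]_n) : obox a b `<=` cbox a b.
Proof. by move=> x xab i; have /andP[/ltW -> /ltW ->] := xab i. Qed.

Lemma measurable_obox n (a b : 'rV[R]_n) : measurable (obox a b).
Proof.
rewrite (_ : obox a b = \bigcap_(i in [set: 'I_n])
    (fun x : 'rV[R]_n => x ord0 i) @^-1` `]a ord0 i, b ord0 i[).
  apply: fin_bigcap_measurable => //= i _; rewrite -[X in measurable X]setTI.
  by apply: (@measurable_coord R n i).
apply/seteqP; split => x /= xab i; first by move=> _; rewrite /= in_itv; exact: xab.
by have := xab i I; rewrite /= in_itv.
Qed.

(** Rational corners keep the family of boxes countable. The open box serves for covering; the
    closed one, inside [U], will be the compact support of a cutoff. *)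
Lemma open_rat_obox n (U : set 'rV[R]_n) (x : 'rV[R]_n) : open U -> U x ->
  exists pq : 'rV[rat]_n * 'rV[rat]_n,
    obox (map_mx ratr pq.1) (map_mx ratr pq.2) x /\
    cbox (map_mx ratr pq.1) (map_mx ratr pq.2) `<=` U.
Proof.
move=> oU Ux; have /nbhs_ballP[r /= r0 xrU] : nbhs x U by exact: open_nbhs_nbhs.
have xp i : exists p : rat, (ratr p : R) \in `]x ord0 i - r, x ord0 i[.
  by have [p] := @rat_in_itvoo R (x ord0 i - r) (x ord0 i) ltac:(lra); exists p.
have xq i : exists q : rat, (ratr q : R) \in `]x ord0 i, x ord0 i + r[.
  by have [q] := @rat_in_itvoo R (x ord0 i) (x ord0 i + r) ltac:(lra); exists q.
have [p px] := choice xp; have [q qx] := choice xq.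
exists (\row_i p i, \row_i q i); split => [i|y yB].
  rewrite !mxE; have := px i; have := qx i; rewrite !in_itv /=.
  by move=> /andP[-> _] /andP[_ ->].
apply: xrU; split => // i j; rewrite ord1.
have := yB j; rewrite /= !mxE; have := px j; have := qx j; rewrite !in_itv /=.
by move=> /andP[? ?] /andP[? ?] /andP[? ?]; rewrite /ball /= ltr_norml; apply/andP; split; lra.
Qed.

(** The sigma-algebra is generated by the coordinates, so second countability is what makes open
    sets measurable: each is the union of the countably many rational boxes that it contains. *)
Lemma open_measurable_rV n (U : set 'rV[R]_n) : open U -> measurable U.
Proof.
move=> oU; pose B (pq : 'rV[rat]_n * 'rV[rat]_n) :=
  obox (map_mx (ratr : rat -> R) pq.1) (map_mx ratr pq.2).
have -> : U = \bigcup_pq (if `[< B pq `<=` U >] then B pq else set0).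
  apply/seteqP; split => [x Ux|x [qe _]]; last by case: asboolP => // /[apply].
  have [pq [xB BU]] := open_rat_obox oU Ux; exists pq => //; case: asboolP => // -[].
  by move=> y /obox_sub_cbox; exact: BU.
apply: countable_bigcupT_measurable => [|pq]; first exact: countableP.
by case: asboolP => // _; exact: measurable_obox.
Qed.

Lemma continuous_measurable_rV n (f : 'rV[R]_n -> R) :
  continuous f -> measurable_fun setT f.
Proof.
move=> /continuousP cf; apply: (measurability _ (RGenOpens.measurableE R)).
move=> _ [_ [a [b ->] <-]]; rewrite setTI; apply: open_measurable_rV.
exact/cf/interval_open.
Qed.

Lemma compact_box n (r : R) : compact (box n r).
Proof.
rewrite (_ : box n r = [set x | forall i, x ord0 i \in `[- r, r]]).
  by apply: (@rV_compact _ _ (fun=> `[- r, r]%classic)) => _; exact: segment_compact.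
by apply/seteqP; split => x /= xr i; have := xr i; rewrite in_itv /= ler_norml.
Qed.

Lemma measurable_box n (r : R) : measurable (box n r).
Proof.
rewrite -(setCK (box n r)); apply: measurableC; apply: open_measurable_rV.
by apply: closed_openC; apply: compact_closed; [exact: norm_hausdorff|exact: compact_box].
Qed.

Lemma rV_cons_ord0 n (a : R) (x : 'rV[R]_n) (i : 'I_1) : rV_cons (a, x) i ord0 = a.
Proof. by rewrite ord1; have /(congr1 fst) := rV_consK (a, x). Qed.

Lemma rV_cons_lift n (a : R) (x : 'rV[R]_n) (j : 'I_1) i :
  rV_cons (a, x) j (lift ord0 i) = x ord0 i.
Proof. by rewrite ord1; have /(congr1 snd)/rowP/(_ i) := rV_consK (a, x); rewrite mxE. Qed.

Lemma forall_ordS n (P : 'I_n.+1 -> Prop) :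
  P ord0 -> (forall i, P (lift ord0 i)) -> forall i, P i.
Proof. by move=> P0 PS i; have [j ->|->] := unliftP ord0 i. Qed.

Lemma rV_uncons_cons n (x : 'rV[R]_n.+1) : rV_cons (rV_uncons x) = x.
Proof.
apply/rowP; apply: forall_ordS => [|i]; first by rewrite rV_cons_ord0.
by rewrite rV_cons_lift mxE.
Qed.

Lemma lebesgue_rV_box n (r : R) : (lebesgue_rV R n (box n r) < +oo)%E.
Proof.
elim: n => [|n IHn]; first by rewrite /= diracE ltry.
rewrite /= /lebesgue_rV_step /pushforward.
rewrite (_ : @rV_cons R n @^-1` box n.+1 r = `[- r, r]%classic `*` box n r).
  rewrite product_measure1E//; last exact: measurable_box.
  have r_fin : (@lebesgue_measure R `[(- r)%R, r] < +oo)%E.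
    by rewrite lebesgue_measure_itv /=; case: ifP => // _; rewrite ltry.
  by apply: lte_mul_pinfty => //; rewrite ge0_fin_numE.
apply/seteqP; split => -[a x] /=.
  move=> ax; split=> [|i]; first by have := ax ord0; rewrite rV_cons_ord0 in_itv /= ler_norml.
  by have := ax (lift ord0 i); rewrite rV_cons_lift.
move=> [+ xr]; rewrite in_itv /= -ler_norml => ar.
by apply: forall_ordS => [|i]; rewrite ?rV_cons_ord0 ?rV_cons_lift.
Qed.

Lemma continuous_rV_cons_l n (x : 'rV[R]_n) : continuous (fun a : R => rV_cons (a, x)).
Proof.
apply: continuous_rV; apply: forall_ordS => [|i].
  by under eq_fun do rewrite rV_cons_ord0; by move=> t; exact: cvg_id.
by under eq_fun do rewrite rV_cons_lift; by move=> t; apply: cvg_cst.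
Qed.

Lemma continuous_rV_cons_r n (a : R) : continuous (fun x : 'rV[R]_n => rV_cons (a, x)).
Proof.
apply: continuous_rV; apply: forall_ordS => [|i].
  rewrite (_ : (fun x => _) = cst a); first exact: cst_continuous.
  by apply/funext => x; rewrite rV_cons_ord0.
by under eq_fun do rewrite rV_cons_lift; exact: coord_continuous.
Qed.

End measurability_rV.

(** * Tonelli and Fubini, splitting off the first coordinate *)

Section tonelli_rV.
Local Open Scope ereal_scope.
Variables (R : realType) (n : nat).
Implicit Types F : 'rV[R]_n.+1 -> \bar R.
Local Notation leb := (lebesgue_rV R).

Lemma measurable_comp_rV_cons F : measurable_fun setT F ->
  measurable_fun setT (F \o @rV_cons R n).
Proof. by move=> mF; apply: measurableT_comp => //; exact: measurable_rV_cons. Qed.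

Lemma measurable_rV_cons_r F (a : R) : measurable_fun setT F ->
  measurable_fun setT (fun x : 'rV[R]_n => F (rV_cons (a, x))).
Proof.
move=> mF; apply: (measurableT_comp (measurable_comp_rV_cons mF) (f := F \o _)
  (g := fun x => (a : measurableTypeR R, x))).
exact: measurable_pair1.
Qed.

Lemma tonelli_rV F : measurable_fun setT F -> (forall x, 0 <= F x) ->
  \int[leb n.+1]_x F x =
  \int[@lebesgue_measure R]_a \int[leb n]_x F (rV_cons (a, x)).
Proof.
move=> mF F0; rewrite [LHS](@ge0_integral_pushforward _ _ _ _ _ _ (@measurable_rV_cons R n))//.
rewrite preimage_setT (fubini_tonelli1 _ (measurable_comp_rV_cons mF))// => x.
exact: F0.
Qed.

Lemma tonelli_rV_sym F : measurable_fun setT F -> (forall x, 0 <= F x) ->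
  \int[leb n.+1]_x F x =
  \int[leb n]_x \int[@lebesgue_measure R]_a F (rV_cons (a, x)).
Proof.
move=> mF F0; rewrite [LHS](@ge0_integral_pushforward _ _ _ _ _ _ (@measurable_rV_cons R n))//.
rewrite preimage_setT (fubini_tonelli2 _ (measurable_comp_rV_cons mF))// => x.
exact: F0.
Qed.

Lemma measurable_tonelli_l F : measurable_fun setT F -> (forall x, 0 <= F x) ->
  measurable_fun [set: R] (fun a : R => \int[leb n]_x F (rV_cons (a, x))).
Proof.
move=> mF F0.
have h := measurable_fun_fubini_tonelli_F (m2 := leb n) (F \o @rV_cons R n)
  (measurable_comp_rV_cons mF) (fun x => F0 _).
exact: h.
Qed.

Lemma measurable_tonelli_r F : measurable_fun setT F -> (forall x, 0 <= F x) ->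
  measurable_fun setT (fun x : 'rV[R]_n => \int[@lebesgue_measure R]_a F (rV_cons (a, x))).
Proof.
move=> mF F0.
have h := measurable_fun_fubini_tonelli_G (m1 := @lebesgue_measure R) (F \o @rV_cons R n)
  (measurable_comp_rV_cons mF) (fun x => F0 _).

exact: h.
Qed.

Lemma integrable_rV_cons F : (leb n.+1).-integrable setT F ->
  (@lebesgue_measure R \x leb n).-integrable setT (F \o @rV_cons R n).
Proof.
move=> /integrableP[mF iF]; apply/integrableP; split; first exact: measurable_comp_rV_cons.
rewrite (ge0_integral_pushforward (@measurable_rV_cons R n)) in iF => //.
exact: measurableT_comp.
Qed.

Lemma fubini_rV F : (leb n.+1).-integrable setT F ->
  \int[leb n.+1]_x F x =
  \int[@lebesgue_measure R]_a \int[leb n]_x F (rV_cons (a, x)).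
Proof.
move=> iF; have [mF _] := integrableP _ _ _ iF.
rewrite [LHS](integral_pushforward (@measurable_rV_cons R n) mF (integrable_rV_cons iF))//.
by rewrite -(integral12_prod_meas1 (integrable_rV_cons iF)).
Qed.

Lemma fubini_rV_sym F : (leb n.+1).-integrable setT F ->
  \int[leb n.+1]_x F x =
  \int[leb n]_x \int[@lebesgue_measure R]_a F (rV_cons (a, x)).
Proof.
move=> iF; have [mF _] := integrableP _ _ _ iF.
rewrite [LHS](integral_pushforward (@measurable_rV_cons R n) mF (integrable_rV_cons iF))//.
by rewrite -(integral21_prod_meas1 (integrable_rV_cons iF)).
Qed.

End tonelli_rV.

(** * Compactly supported C1 functions and the Ladyzhenskaya inequality *)

Section C1c.
Variable R : realType.
Local Notation leb := (lebesgue_rV R).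
Local Notation e_ i := (delta_mx ord0 i).

(** Weaker than being a test function, but stable under products and under freezing the first
    coordinate, as the inductions on the dimension require. *)
Definition C1c n (p : 'rV[R]_n -> R) : Prop :=
  [/\ continuous p, forall i x, derivable p x (e_ i),
      forall i, continuous ('D_((e_ i)) p) &
      exists r, 0 < r /\ forall x, ~ box n r x -> p x = 0].

Lemma derive_outside (V W : normedModType R) (K : set V) (f : V -> W) v x :
  closed K -> (forall y, ~ K y -> f y = 0) -> ~ K x -> 'D_v f x = 0.
Proof.
move=> cK f0 Kx; rewrite -[RHS](derive_cst (0 : W) x v); apply: near_eq_derive.
have : nbhs x (~` K) by apply: open_nbhs_nbhs; split => //; exact: closed_openC.
by apply: filterS => y; exact: f0.
Qed.

Lemma closed_box n (r : R) : closed (box n r).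
Proof. by apply: compact_closed; [exact: norm_hausdorff|exact: compact_box]. Qed.

Lemma integrable_box n (g : 'rV[R]_n -> R) r : continuous g ->
  (forall x, ~ box n r x -> g x = 0) -> (leb n).-integrable setT (EFin \o g).
Proof.
move=> cg g0.
have -> : EFin \o g = (EFin \o g) \_ (box n r).
  apply/funext => x; rewrite patchE; case: ifPn => //.
  by rewrite notin_setE => /g0 /= ->.
rewrite -integrable_mkcond; last exact: measurable_box.
apply: measurable_bounded_integrable => //.
- exact: measurable_box.
- exact: lebesgue_rV_box.
- by apply: measurable_funTS; exact: continuous_measurable_rV.
have /compact_bounded[M [Mr gM]] : compact (g @` box n r).
  apply: continuous_compact; last exact: compact_box.
  exact: continuous_subspaceT.
by exists M; split => // y My x /= bx; apply: (gM y My); exists x.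
Qed.

Lemma C1c_integrable_derive n (p : 'rV[R]_n -> R) i : C1c p ->
  (leb n).-integrable setT (EFin \o 'D_((e_ i)) p).
Proof.
move=> [_ _ /(_ i) cDp [r [_ p0]]]; apply: (integrable_box (r := r)) => //.
by move=> x bx; apply: (derive_outside (K := box n r)) => //; exact: closed_box.
Qed.

Lemma rV_cons_shift_r n (a h : R) (x : 'rV[R]_n) i :
  h *: (e_ (lift ord0 i)) + rV_cons (a, x) = rV_cons (a, h *: (e_ i) + x).
Proof.
apply/rowP; apply: forall_ordS => [|j].
  by rewrite mxE !rV_cons_ord0 !mxE /= mulr0 add0r.
by rewrite mxE !rV_cons_lift !mxE (inj_eq (@lift_inj _ _)).
Qed.

Lemma rV_cons_shift_l n (a h : R) (x : 'rV[R]_n) :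
  h *: (e_ ord0) + rV_cons (a, x) = rV_cons (h + a, x).
Proof.
apply/rowP; apply: forall_ordS => [|j].
  by rewrite mxE !rV_cons_ord0 !mxE /= mulr1.
by rewrite mxE !rV_cons_lift !mxE /= mulr0 add0r.
Qed.

Section slices.
Variables (n : nat) (p : 'rV[R]_n.+1 -> R).

Lemma derivable_slice_r a x i : derivable p (rV_cons (a, x)) (e_ (lift ord0 i)) ->
  derivable (fun y : 'rV[R]_n => p (rV_cons (a, y))) x (e_ i).
Proof.
rewrite /derivable /shift /comp /=.
by under eq_fun do rewrite rV_cons_shift_r.
Qed.

Lemma derive_slice_r a x i : 'D_((e_ i)) (fun y : 'rV[R]_n => p (rV_cons (a, y))) x =
  'D_((e_ (lift ord0 i))) p (rV_cons (a, x)).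
Proof.
rewrite /derive /shift /comp /=.
by under [in RHS]eq_fun do rewrite rV_cons_shift_r.
Qed.

Lemma derivable_slice_l a x : derivable p (rV_cons (a, x)) (e_ ord0) ->
  derivable (fun s : R => p (rV_cons (s, x))) a 1.
Proof.
rewrite /derivable /shift /comp /=.
under eq_fun do rewrite rV_cons_shift_l.
by under [in X in _ -> X]eq_fun do rewrite /GRing.scale /= mulr1.
Qed.

Lemma derive_slice_l a x : 'D_1 (fun s : R => p (rV_cons (s, x))) a =
  'D_((e_ ord0)) p (rV_cons (a, x)).
Proof.
rewrite /derive /shift /comp /=.
under [in RHS]eq_fun do rewrite rV_cons_shift_l.
by under [in LHS]eq_fun do rewrite [X in p (rV_cons (X + _, _))]/GRing.scale /= mulr1.
Qed.

Hypothesis Cp : C1c p.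

Lemma C1c_slice a : C1c (fun x : 'rV[R]_n => p (rV_cons (a, x))).
Proof.
have [cp dp cdp [r [r0 p0]]] := Cp; split.
- move=> x; apply: (continuous_comp (f := fun y => rV_cons (a, y)) (g := p)).
    exact: continuous_rV_cons_r.
  exact: cp.
- by move=> i x; apply: derivable_slice_r; exact: dp.
- move=> i; under eq_fun do rewrite derive_slice_r.
  move=> x; apply: (continuous_comp (f := fun y => rV_cons (a, y)) (g := 'D_((e_ (lift ord0 i))) p)).
    exact: continuous_rV_cons_r.
  exact: cdp.
- exists r; split => // x bx; apply: p0; apply: contra_not bx => bx i.
  by have := bx (lift ord0 i); rewrite rV_cons_lift.
Qed.

Lemma slice_l_outside : exists r, 0 < r /\ forall x a, r < `|a| -> p (rV_cons (a, x)) = 0.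
Proof.
have [_ _ _ [r [r0 p0]]] := Cp; exists r; split => // x a ra; apply: p0.
by move/(_ ord0); rewrite rV_cons_ord0 leNgt ra.
Qed.

Lemma continuous_derive_slice_l (x : 'rV[R]_n) :
  continuous ('D_1 (fun a : R => p (rV_cons (a, x)))).
Proof.
have [_ _ /(_ ord0) cp _] := Cp; under eq_fun do rewrite derive_slice_l.
move=> a; apply: (continuous_comp (f := fun y => rV_cons (y, x)) (g := 'D_((e_ ord0)) p)).
  exact: continuous_rV_cons_l.
exact: cp.
Qed.

End slices.

Section one_dimension.
Variables (g : R -> R) (r : R).
Hypotheses (dg : forall x, derivable g x 1) (cg : continuous ('D_1 g))
  (g0 : forall x, r < `|x| -> g x = 0).

Lemma FTC2_derive a b : a < b ->
  (\int[@lebesgue_measure R]_(x in `[a, b]) ('D_1 g x)%:E = (g b - g a)%:E)%E.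
Proof.
move=> ab; rewrite (continuous_FTC2 (f := 'D_1 g) (F := g)) //.
- exact: continuous_subspaceT.
- have cgx x : {for x, continuous g}.
    by apply: differentiable_continuous; apply/derivable1_diffP; exact: dg.
  split; first by move=> x _; exact: dg.
    exact: cvg_at_right_filter (cgx a).
  exact: cvg_at_left_filter (cgx b).
- by move=> x _; rewrite derive1E.
Qed.

End one_dimension.

End C1c.

Section one_dimension.
Variables (R : realType) (g : R -> R) (r : R).
Hypotheses (dg : forall x, derivable g x 1) (cg : continuous ('D_1 g))
  (r0 : 0 < r) (g0 : forall x, r < `|x| -> g x = 0).
Local Notation mu := (@lebesgue_measure R).
Local Open Scope ereal_scope.

Lemma derive_outside_segment x : (r < `|x|)%R -> 'D_1 g x = 0%R.
Proof.
move=> rx; apply: (derive_outside (K := [set y : R | `|y| <= r]%R)).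
- have := @closed_comp _ _ (fun y : R => `|y|%R) [set y : R | (y <= r)%R].
  by apply; [move=> y _; exact: norm_continuous|exact: closed_le].
- by move=> y /negP; rewrite -ltNge; exact: g0.
- by move=> /= xr; rewrite ltNge xr in rx.
Qed.

Lemma integral_derive_line : \int[mu]_x ('D_1 g x)%:E = 0.
Proof.
(* The margin 1 makes [g] vanish at both end points, because [g0] speaks only of r < |x|. *)
have -> : \int[mu]_x ('D_1 g x)%:E =
    \int[mu]_(x in `[(- (r + 1))%R, (r + 1)%R]) ('D_1 g x)%:E.
  rewrite [RHS]integral_mkcond; apply: eq_integral => x _.
  rewrite patchE; case: ifPn => //; rewrite notin_setE /= in_itv /= => /negP.
  rewrite -ler_norml -ltNge => rx.
  by rewrite derive_outside_segment// (lt_trans _ rx)// ltrDl.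
rewrite FTC2_derive//; last by rewrite gtrN// addr_gt0.
by rewrite !g0 ?subr0 ?normrN ?ger0_norm ?addr_ge0 ?ltrDl// ltW.
Qed.

(** g(a)^2 is the integral of (g^2)' = 2 g g' from the left of the support up to [a]; enlarging the
    domain of the absolute value to the whole line removes the dependence on [a]. *)
Lemma sqr_le_integral_line a :
  (g a ^+ 2)%:E <= \int[mu]_x (2 * (`|g x| * `|'D_1 g x|))%:E.
Proof.
have cgx : continuous g.
  by move=> x; apply: differentiable_continuous; apply/derivable1_diffP; exact: dg.
have i0 : 0 <= \int[mu]_x (2 * (`|g x| * `|'D_1 g x|))%:E.
  by apply: integral_ge0 => x _; rewrite lee_fin !mulr_ge0.
have [ar|ra] := leP a (- (r + 1))%R.
  by rewrite g0 ?expr0n// ltr_normr; apply/orP; right; lra.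
pose h := (g * g)%R.
have dh x : derivable h x 1 by exact: derivableM.
have Dh x : 'D_1 h x = (2 * (g x * 'D_1 g x))%R.
  by rewrite deriveM// /GRing.scale /=; lra.
have ch : continuous ('D_1%R h).
  under eq_fun do rewrite Dh.
  by move=> x; apply: cvgM; [exact: cvg_cst|apply: cvgM; [exact: cgx|exact: cg]].
have ga : (g a ^+ 2)%:E = \int[mu]_(x in `[(- (r + 1))%R, a]) ('D_1%R h x)%:E.
  rewrite FTC2_derive//; congr EFin.
  have g1 : g (- (r + 1))%R = 0%R by apply: g0; rewrite normrN gtr0_norm ?ltrDl ?addr_gt0.
  have hE y : h y = (g y * g y)%R by [].
  by rewrite !hE g1 mulr0 subr0 expr2.
rewrite ga; apply: le_trans (lee_abs _) _.
have mDh : measurable_fun setT (fun x => ('D_1 h x)%:E).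
  by apply/measurable_EFinP; exact: continuous_measurable_fun.
apply: le_trans (le_abse_integral _ _ _) _ => //.
  exact: measurable_funTS.
rewrite (_ : \int[mu]_x _ = \int[mu]_x `|('D_1 h x)%:E|); last first.
  by apply: eq_integral => x _; rewrite Dh /= !normrM ger0_norm.
apply: ge0_subset_integral => //.
exact: measurableT_comp.
Qed.

End one_dimension.

Section C1c_integrals.
Variable R : realType.
Local Notation leb := (lebesgue_rV R).
Local Notation e_ i := (delta_mx ord0 i).
Local Open Scope ereal_scope.

Lemma C1cM n (p q : 'rV[R]_n -> R) : C1c p -> C1c q -> C1c (p * q)%R.
Proof.
move=> [cp dp cdp [r [r0 p0]]] [cq dq cdq _]; split.
- by move=> x; apply: continuousM; [exact: cp|exact: cq].
- by move=> i x; exact: derivableM.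
- move=> i; rewrite (_ : 'D_(e_ i) (p * q)%R = (fun x => p x * 'D_(e_ i) q x + q x * 'D_(e_ i) p x)%R).
    by move=> x; exact: (cvgD (cvgM (cp x) (cdq i x)) (cvgM (cq x) (cdp i x))).
  by apply/funext => x; rewrite deriveM.
- exists r; split => // x bx.
  by have -> : ((p * q) x = p x * q x)%R by []; rewrite p0// mul0r.
Qed.

(** Fubini with the order dictated by [i]: for the first coordinate the inner integral runs along a
    line and vanishes by the fundamental theorem; any other coordinate belongs to a slice, where
    induction applies. Every integration by parts below rests on this. *)
Lemma integral_derive_eq0 n (p : 'rV[R]_n -> R) i : C1c p ->
  \int[leb n]_x ('D_(e_ i) p x)%:E = 0.
Proof.
elim: n p i => [p []//|n IHn p i Cp].
have iDp := C1c_integrable_derive i Cp; have [_ dp _ _] := Cp.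
have [j|] := unliftP ord0 i => ij; rewrite ij in iDp *.
  rewrite (fubini_rV iDp) /=; apply: integral0_eq => a _.
  under eq_integral do rewrite -derive_slice_r.
  by apply: IHn; exact: C1c_slice.
rewrite (fubini_rV_sym iDp) /=; apply: integral0_eq => x _.
under eq_integral do rewrite -derive_slice_l.
have [r [r0 pr]] := slice_l_outside Cp.
apply: (integral_derive_line (r := r)) => //.
- by move=> a; apply: derivable_slice_l; exact: dp.
- exact: continuous_derive_slice_l.
- by move=> a; exact: pr.
Qed.

Lemma C1c_measurable n (p : 'rV[R]_n -> R) : C1c p -> measurable_fun setT p.
Proof. by case=> cp _ _ _; exact: continuous_measurable_rV. Qed.

Lemma C1c_measurable_derive n (p : 'rV[R]_n -> R) i : C1c p -> measurable_fun setT ('D_(e_ i) p).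
Proof. by case=> _ _ cp _; exact: continuous_measurable_rV. Qed.

Lemma sqr_le_integral_rV n (p : 'rV[R]_n.+1 -> R) a x : C1c p ->
  (p (rV_cons (a, x)) ^+ 2)%:E <=
  \int[@lebesgue_measure R]_s (2 * (`|p (rV_cons (s, x))| * `|'D_(e_ ord0) p (rV_cons (s, x))|))%:E.
Proof.
move=> Cp; have [_ dp _ _] := Cp; have [r [r0 pr]] := slice_l_outside Cp.
under eq_integral do rewrite -derive_slice_l.
apply: (sqr_le_integral_line (r := r) (g := fun a => p (rV_cons (a, x)))) => //.
- by move=> s; apply: derivable_slice_l; exact: dp.
- exact: continuous_derive_slice_l.
- by move=> s; exact: pr.
Qed.

Lemma measurable_flux n (p : 'rV[R]_n -> R) i : C1c p ->
  measurable_fun setT (fun x => (2 * (`|p x| * `|'D_(e_ i) p x|))%:E).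
Proof.
move=> Cp; apply/measurable_EFinP; apply: measurable_funM => //.
apply: measurable_funM; apply: measurableT_comp => //.
  exact: C1c_measurable.
exact: C1c_measurable_derive.
Qed.

(** The right-hand side does not depend on the slice [a]; this uniformity carries the planar
    inequality over to dimension three. *)
Lemma integral_slice_sqr_le n (p : 'rV[R]_n.+1 -> R) a : C1c p ->
  \int[leb n]_x (p (rV_cons (a, x)) ^+ 2)%:E <=
  \int[leb n.+1]_y (2 * (`|p y| * `|'D_(e_ ord0) p y|))%:E.
Proof.
move=> Cp; have mF := measurable_flux ord0 Cp.
have F0 y : 0 <= (2 * (`|p y| * `|'D_(e_ ord0) p y|))%:E by rewrite lee_fin !mulr_ge0.
rewrite (tonelli_rV_sym mF F0); apply: ge0_le_integral => //.
- by move=> x _; rewrite lee_fin sqr_ge0.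
- apply/measurable_EFinP; apply: measurable_funX.
  by apply: C1c_measurable; exact: C1c_slice.
- exact: (measurable_tonelli_r mF F0).
- by move=> x _; exact: sqr_le_integral_rV.
Qed.

Lemma integral_rV1 (F : 'rV[R]_1 -> \bar R) : measurable_fun setT F -> (forall x, 0 <= F x) ->
  \int[leb 1]_x F x = \int[@lebesgue_measure R]_s F (rV_cons (s, 0%R)).
Proof.
move=> mF F0; rewrite tonelli_rV//; apply: eq_integral => s _.
rewrite [LHS]integral_dirac//; last exact: measurable_rV_cons_r.
by rewrite diracT mul1e.
Qed.

(* p^2 at a point is at most the integral of |2 p D_i p| along the line through
   the point in the i-th direction, for i = 0 and for i = 1. *)
Lemma integral_pow4_rV2 (p : 'rV[R]_2 -> R) : C1c p ->
  \int[leb 2]_x (p x ^+ 4)%:E <=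
  \int[leb 2]_y (2 * (`|p y| * `|'D_(e_ ord0) p y|))%:E *
  \int[leb 2]_y (2 * (`|p y| * `|'D_(e_ (lift ord0 ord0)) p y|))%:E.
Proof.
move=> Cp; have mF i := measurable_flux i Cp.
have F0 i y : 0 <= (2 * (`|p y| * `|'D_(e_ i) p y|))%:E by rewrite lee_fin !mulr_ge0.
have mp4 : measurable_fun setT (fun x => (p x ^+ 4)%:E).
  by apply/measurable_EFinP; apply: measurable_funX; exact: C1c_measurable.
have p4 x : 0 <= (p x ^+ 4)%:E by rewrite lee_fin (exprM _ 2 2) sqr_ge0.
rewrite (tonelli_rV mp4 p4).
rewrite [X in _ <= X * _](tonelli_rV_sym (mF _) (F0 _)).
rewrite [X in _ <= _ * X](tonelli_rV (mF _) (F0 _)).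
pose A (x : 'rV[R]_1) := \int[@lebesgue_measure R]_s
  (2 * (`|p (rV_cons (s, x))| * `|'D_(e_ ord0) p (rV_cons (s, x))|))%:E.
pose B (a : R) := \int[leb 1]_x
  (2 * (`|p (rV_cons (a, x))| * `|'D_(e_ (lift ord0 ord0)) p (rV_cons (a, x))|))%:E.
rewrite -[X in _ <= X * _]/(\int[leb 1]_x A x).
rewrite -[X in _ <= _ * X]/(\int[@lebesgue_measure R]_a B a).
have mA : measurable_fun setT A by exact: (measurable_tonelli_r (mF _) (F0 _)).
have mB : measurable_fun [set: R] B by exact: (measurable_tonelli_l (mF _) (F0 _)).
have A0 x : 0 <= A x by apply: integral_ge0.
have B0 a : 0 <= B a by apply: integral_ge0.
have pA a x : (p (rV_cons (a, x)) ^+ 2)%:E <= A x by exact: sqr_le_integral_rV.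
have pB a x : (p (rV_cons (a, x)) ^+ 2)%:E <= B a.
  have Ca := C1c_slice Cp a.
  have := sqr_le_integral_rV (x ord0 ord0) 0%R Ca.
  rewrite (_ : rV_cons (x ord0 ord0, 0%R) = x); last first.
    by rewrite -[RHS]rV_uncons_cons /rV_uncons; congr (rV_cons (_, _)); apply/rowP => -[].
  rewrite -(@integral_rV1 (fun y => (2 * (`|p (rV_cons (a, y))| *
    `|'D_(e_ ord0) (fun y => p (rV_cons (a, y))) y|))%:E)).
  - by under eq_integral do rewrite derive_slice_r.
  - exact: (measurable_flux ord0 Ca).
  - by move=> y; rewrite lee_fin !mulr_ge0.
have IA0 : 0 <= \int[leb 1]_x A x by apply: integral_ge0.
apply: (@le_trans _ _ (\int[@lebesgue_measure R]_a (B a * \int[leb 1]_x A x))).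
  apply: ge0_le_integral => //.
  - by move=> a _; apply: integral_ge0.
  - exact: (measurable_tonelli_l mp4 p4).
  - under eq_fun do rewrite muleC; exact: measurable_funeM.
  move=> a _; rewrite -ge0_integralZl//.
  apply: ge0_le_integral => //.
  - exact: (measurable_rV_cons_r a mp4).
  - exact: measurable_funeM.
  move=> x _; rewrite (exprM _ 2 2) expr2 EFinM.
  by apply: lee_pmul => //; rewrite lee_fin sqr_ge0.
under eq_integral do rewrite muleC.
by rewrite ge0_integralZl//; apply: integral_ge0.
Qed.

End C1c_integrals.

(** * Ladyzhenskaya's inequality in dimensions two and three *)

Section ladyzhenskaya.
Variable R : realType.
Local Notation leb := (lebesgue_rV R).
Local Notation e_ i := (delta_mx ord0 i).

Definition grad2 n (p : 'rV[R]_n -> R) (x : 'rV[R]_n) : R := \sum_i ('D_(e_ i) p x) ^+ 2.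

Section continuous_compact.
Variables (n : nat).
Implicit Types f g p : 'rV[R]_n -> R.

Definition cc f := continuous f /\ exists r, forall x, ~ box n r x -> f x = 0.

Lemma cc_integrable f : cc f -> (leb n).-integrable setT (EFin \o f).
Proof. by move=> [cf [r fr]]; exact: integrable_box fr. Qed.

Lemma cc_integralE f : cc f -> (\int[leb n]_x (f x)%:E = (\int[leb n]_x f x)%:E)%E.
Proof.
by move=> /cc_integrable If; rewrite /Rintegral fineK//; exact: integrable_fin_num.
Qed.

Lemma ccM f g : cc f -> continuous g -> cc (fun x => f x * g x).
Proof.
move=> [cf [r fr]] cg; split; first by move=> x; exact: (cvgM (cf x) (cg x)).
by exists r => x /fr ->; rewrite mul0r.
Qed.

Lemma ccX f k : cc f -> cc (fun x => f x ^+ k.+1).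
Proof.
move=> [cf [r fr]]; split.
  elim: k => [|k IHk]; first by under eq_fun do rewrite expr1.
  by under eq_fun do rewrite exprS; move=> x; exact: (cvgM (cf x) (IHk x)).
by exists r => x /fr ->; rewrite expr0n.
Qed.

Lemma cc_norm f : cc f -> cc (fun x => `|f x|).
Proof.
move=> [cf [r fr]]; split; first by move=> x; exact: (cvg_norm (cf x)).
by exists r => x /fr ->; rewrite normr0.
Qed.

Lemma ccD f g : cc f -> cc g -> cc (fun x => f x + g x).
Proof.
move=> [cf [r fr]] [cg [s gs]]; split; first by move=> x; exact: (cvgD (cf x) (cg x)).
exists (Num.max r s) => x bx; rewrite fr ?gs ?addr0//; apply: contra_not bx => b i.
  by rewrite le_max b orbT.
by rewrite le_max b.
Qed.

Lemma cc_sum (I : eqType) (s : seq I) (F : I -> 'rV[R]_n -> R) :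
  (forall i, cc (F i)) -> cc (fun x => \sum_(i <- s) F i x).
Proof.
move=> cF; elim: s => [|i s IHs].
  under eq_fun do rewrite big_nil.
  by split; [exact: cst_continuous|exists 0].
by under eq_fun do rewrite big_cons; exact: ccD.
Qed.

Lemma cc_L2 f : cc f -> L2 [set: _] f.
Proof.
move=> cf; apply: integrable_sqr_L2; last exact/cc_integrable/ccX.
by case: cf => cf _; exact: continuous_measurable_rV.
Qed.

Lemma cc_sqr_le f g : cc f -> cc g ->
  (\int[leb n]_x (`|f x| * `|g x|)) ^+ 2 <=
  (\int[leb n]_x (f x ^+ 2)) * (\int[leb n]_x (g x ^+ 2)).
Proof.
move=> /cc_norm/cc_L2 Lf /cc_norm/cc_L2 Lg.
have := ip_sqr_le measurableT Lf Lg; rewrite /ip.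
rewrite [X in _ <= X * _ -> _](_ : _ = \int[leb n]_x (f x ^+ 2)); last first.
  by apply: eq_Rintegral => x _; rewrite -normrM -expr2 ger0_norm ?sqr_ge0.
rewrite [X in _ <= _ * X -> _](_ : _ = \int[leb n]_x (g x ^+ 2))//.
by apply: eq_Rintegral => x _; rewrite -normrM -expr2 ger0_norm ?sqr_ge0.
Qed.

Lemma C1c_cc p : C1c p -> cc p.
Proof. by move=> [cp _ _ [r [_ pr]]]; split => //; exists r. Qed.

Lemma C1c_cc_derive p i : C1c p -> cc ('D_(e_ i) p).
Proof.
move=> [_ _ cp [r [_ pr]]]; split => //; exists r => x bx.
by apply: (derive_outside (K := box n r)) => //; exact: closed_box.
Qed.

Lemma C1c_cc_grad2 p : C1c p -> cc (grad2 p).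
Proof. by move=> Cp; apply: cc_sum => i; apply: ccX; exact: C1c_cc_derive. Qed.

Lemma grad2_ge0 p x : 0 <= grad2 p x.
Proof. by apply: sumr_ge0 => i _; exact: sqr_ge0. Qed.

Lemma flux_sqr_le p i : C1c p ->
  (\int[leb n]_x (2 * (`|p x| * `|'D_(e_ i) p x|))) ^+ 2 <=
  4 * (\int[leb n]_x (p x ^+ 2)) * (\int[leb n]_x grad2 p x).
Proof.
move=> Cp; have cp := C1c_cc Cp; have cDp := C1c_cc_derive i Cp.
rewrite RintegralZl//; last first.
  by apply/cc_integrable/ccM; [exact: cc_norm|case: (cc_norm cDp)].
have -> : forall z : R, (2 * z) ^+ 2 = 4 * z ^+ 2 by move=> z; ring.
rewrite -mulrA ler_pM2l//; apply: le_trans (cc_sqr_le cp cDp) _.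
apply: ler_wpM2l; first by apply: Rintegral_ge0 => x _; exact: sqr_ge0.
apply: le_Rintegral => //.
- exact/cc_integrable/ccX.
- exact/cc_integrable/C1c_cc_grad2.
- move=> x _; rewrite /grad2 (bigD1 i)//= lerDl.
  by apply: sumr_ge0 => j _; exact: sqr_ge0.
Qed.

Lemma flux_cc p i : C1c p -> cc (fun x => 2 * (`|p x| * `|'D_(e_ i) p x|)).
Proof.
move=> Cp; have cp := C1c_cc Cp; have cDp := C1c_cc_derive i Cp.
under eq_fun do rewrite mulrC.
apply: ccM; last exact: cst_continuous.
by apply: ccM; [exact: cc_norm|case: (cc_norm cDp)].
Qed.

End continuous_compact.

Lemma mulr_le_of_sqr (x y z : R) : x ^+ 2 <= z -> y ^+ 2 <= z -> x * y <= z.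
Proof. by move=> xz yz; have := sqr_ge0 (x - y); nra. Qed.

(** By Cauchy-Schwarz the square of each of the two flux integrals is at most the right-hand side,
    hence so is their product. *)
Lemma pow4_rV2_le (p : 'rV[R]_2 -> R) : C1c p ->
  \int[leb 2]_x (p x ^+ 4) <=
  4 * (\int[leb 2]_x (p x ^+ 2)) * (\int[leb 2]_x grad2 p x).
Proof.
move=> Cp; have := integral_pow4_rV2 Cp.
have i4 := cc_integralE (ccX 3 (C1c_cc Cp)).
have f0 := cc_integralE (flux_cc ord0 Cp).
have f1 := cc_integralE (flux_cc (lift ord0 ord0) Cp).
rewrite i4 f0 f1 -EFinM lee_fin {i4 f0 f1}.
move=> h; apply: le_trans h _.
by apply: mulr_le_of_sqr; exact: flux_sqr_le.
Qed.

(** The planar inequality is used on each slice x_0 = a. There the integral of p^2 is at most [N]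
    uniformly in [a], so only the gradient factor is left to integrate over [a]. *)
Lemma pow4_rV3_le (p : 'rV[R]_3 -> R) : C1c p ->
  \int[leb 3]_x (p x ^+ 4) <=
  4 * (\int[leb 3]_x (2 * (`|p x| * `|'D_(e_ ord0) p x|))) * (\int[leb 3]_x grad2 p x).
Proof.
move=> Cp; set N := \int[leb 3]_x (2 * _).
have N0 : 0 <= N by apply: Rintegral_ge0 => x _; rewrite !mulr_ge0.
have c4 := ccX 3 (C1c_cc Cp); have cG := C1c_cc_grad2 Cp.
rewrite -lee_fin EFinM -(cc_integralE c4) -(cc_integralE cG).
have m4 : measurable_fun setT (fun x => (p x ^+ 4)%:E).
  by have /integrableP[] := cc_integrable c4.
have mG : measurable_fun setT (fun x => (grad2 p x)%:E).
  by have /integrableP[] := cc_integrable cG.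
have p4 x : (0 <= (p x ^+ 4)%:E)%E by rewrite lee_fin (exprM _ 2 2) sqr_ge0.
have pG x : (0 <= (grad2 p x)%:E)%E by rewrite lee_fin grad2_ge0.
rewrite !tonelli_rV// -ge0_integralZl//; last 3 first.
- exact: (measurable_tonelli_l mG pG).
- by move=> a _; apply: integral_ge0.
- by rewrite lee_fin mulr_ge0.
apply: ge0_le_integral => //.
- by move=> a _; apply: integral_ge0.
- exact: (measurable_tonelli_l m4 p4).
- by apply: measurable_funeM; exact: (measurable_tonelli_l mG pG).
move=> a _; have Ca := C1c_slice Cp a.
have sl : (\int[leb 2]_x (p (rV_cons (a, x)) ^+ 2)%:E <= N%:E)%E.
  by rewrite /N -(cc_integralE (flux_cc _ Cp)); exact: integral_slice_sqr_le.
rewrite (cc_integralE (ccX 1 (C1c_cc Ca))) lee_fin in sl.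
apply: (@le_trans _ _ ((4 * N)%:E * \int[leb 2]_x (grad2 (fun x => p (rV_cons (a, x))) x)%:E)%E).
  rewrite (cc_integralE (ccX 3 (C1c_cc Ca))) (cc_integralE (C1c_cc_grad2 Ca)) -EFinM lee_fin.
  apply: le_trans (pow4_rV2_le Ca) _.
  apply: ler_wpM2r; first by apply: Rintegral_ge0 => x _; exact: grad2_ge0.
  by rewrite ler_pM2l.
apply: lee_pmul => //.
- by rewrite lee_fin mulr_ge0.
- by apply: integral_ge0 => x _; rewrite lee_fin grad2_ge0.
apply: ge0_le_integral => //.
- by move=> x _; rewrite lee_fin grad2_ge0.
- by have /integrableP[] := cc_integrable (C1c_cc_grad2 Ca).
- exact: (measurable_rV_cons_r a mG).
(* The gradient of the slice lacks only the derivative in the first direction. *)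
move=> x _; rewrite lee_fin /grad2 [leRHS]big_ord_recl.
under eq_bigr do rewrite derive_slice_r.
by rewrite lerDr sqr_ge0.
Qed.

(** With P and G the integrals of p^2 and |grad p|^2, Young's inequality brings the planar bound 4 P
    G and the spatial bound 8 P^(1/2) G^(3/2) to one shape, with an arbitrarily small weight on
    G. *)
Lemma pow4_C1c_le n (nE : n = 2%N \/ n = 3%N) (de : R) : 0 < de ->
  exists2 C, 0 <= C & forall p : 'rV[R]_n -> R, C1c p ->
  \int[leb n]_x (p x ^+ 4) <=
  (de * \int[leb n]_x grad2 p x + C * \int[leb n]_x (p x ^+ 2)) ^+ 2.
Proof.
move=> de0; case: nE => ->.
  exists (2 / de) => [|p Cp]; first by rewrite divr_ge0// ltW.
  apply: le_trans (pow4_rV2_le Cp) _.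
  set P := \int[leb 2]_x (p x ^+ 2); set G := \int[leb 2]_x grad2 p x.
  have -> : (de * G + 2 / de * P) ^+ 2 = (de * G) ^+ 2 + (2 / de * P) ^+ 2 + 4 * P * G.
    by field; rewrite gt_eqF.
  by rewrite lerDr addr_ge0 ?sqr_ge0.
exists (8 / de ^+ 3) => [|p Cp]; first by rewrite divr_ge0// exprn_ge0// ltW.
apply: le_trans (pow4_rV3_le Cp) _.
set N := \int[leb 3]_x (2 * _).
have := flux_sqr_le ord0 Cp; rewrite -/N.
set P := \int[leb 3]_x (p x ^+ 2); set G := \int[leb 3]_x grad2 p x => NPG.
have P0 : 0 <= P by apply: Rintegral_ge0 => x _; exact: sqr_ge0.
have G0 : 0 <= G by apply: Rintegral_ge0 => x _; exact: grad2_ge0.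
have N0 : 0 <= N by apply: Rintegral_ge0 => x _; rewrite !mulr_ge0.
(* AM-GM: [4 N <= de^2 G + 16 P / de^2] since [N^2 <= 4 P G] *)
have NAM : 4 * N <= de ^+ 2 * G + 16 / de ^+ 2 * P.
  rewrite -(@ler_pXn2r _ 2) ?nnegrE ?addr_ge0 ?mulr_ge0 ?exprn_ge0 ?invr_ge0 ?(ltW de0)//; last first.
    by rewrite exprn_ge0// ltW.
  have -> : (de ^+ 2 * G + 16 / de ^+ 2 * P) ^+ 2 =
     (de ^+ 2 * G - 16 / de ^+ 2 * P) ^+ 2 + 64 * (P * G) by field; rewrite gt_eqF.
  rewrite exprMn -[leLHS]add0r lerD ?sqr_ge0//.
  by rewrite (_ : 64 * (P * G) = 4 ^+ 2 * (4 * P * G)) ?ler_pM2l//; ring.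
have -> : (de * G + 8 / de ^+ 3 * P) ^+ 2 =
  (de ^+ 2 * G + 16 / de ^+ 2 * P) * G + (8 / de ^+ 3 * P) ^+ 2 by field; rewrite gt_eqF.
apply: (@le_trans _ _ ((de ^+ 2 * G + 16 / de ^+ 2 * P) * G)); last by rewrite lerDl sqr_ge0.
exact: ler_wpM2r.
Qed.

End ladyzhenskaya.

(** * Test functions and the fundamental lemma *)

Section flat_function.
Variable R : realType.
Implicit Types (P : {poly R}) (x y : R).

(** The exponential series gives y^(i+2) <= (i+2)! e^y. The extra factor y^2, taken at y = 1/x,
    makes [flat P] vanish to second order at 0, which settles differentiability there. *)
Lemma horner_le_expR P : exists2 M, 0 <= M &
  forall y, 0 <= y -> `|P.[y]| * y ^+ 2 <= M * expR y.
Proof.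
exists (\sum_(i < size P) `|P`_i| * (i.+2)`!%:R) => [|y y0].
  by apply: sumr_ge0 => i _; rewrite mulr_ge0.
rewrite horner_coef mulr_suml.
apply: (@le_trans _ _ ((\sum_(i < size P) `|P`_i * y ^+ i|) * y ^+ 2)).
  by rewrite ler_wpM2r ?sqr_ge0// ler_norm_sum.
rewrite mulr_suml; apply: ler_sum => i _.
rewrite normrM -!mulrA ler_wpM2l// ger0_norm ?exprn_ge0// -exprD addn2.
have := expR_ge1Dxn i.+1 y0; set F := (_`!)%:R => h.
have F0 : 0 < F by rewrite ltr0n fact_gt0.
by rewrite -ler_pdivrMl// mulrC (le_trans _ h)// lerDr.
Qed.

(* The derivative of P(1/x) exp(-1/x) is again of this form, with P replaced by
   X^2 (P - P'). *)
Definition flat P x : R := if 0 < x then P.[x^-1] * expR (- x^-1) else 0.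

Lemma flat_le P : exists M, forall x, `|flat P x| <= M * x ^+ 2.
Proof.
have [M M0 PM] := horner_le_expR P; exists M => x; rewrite /flat.
case: ifPn => [x0|_]; last by rewrite normr0 mulr_ge0 ?sqr_ge0.
have /PM : 0 <= x^-1 by rewrite invr_ge0 ltW.
rewrite normrM (ger0_norm (expR_ge0 _)) expRN -ler_pdivlMr ?exprn_gt0 ?invr_gt0//.
rewrite exprVn invrK => h; rewrite ler_pdivrMr ?expR_gt0//.
by apply: le_trans h _; rewrite mulrAC.
Qed.

Lemma is_derive_quadratic (f : R -> R) M : (forall x, `|f x| <= M * x ^+ 2) ->
  is_derive (0 : R) (1 : R) f 0.
Proof.
move=> fM; have f0 : f 0 = 0.
  by have := fM 0; rewrite expr0n mulr0 normr_le0 => /eqP.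
have h : (fun h => h^-1 *: ((f \o shift 0) (h *: (1 : R)) - f 0)) @ 0^' --> (0 : R).
  apply/cvgr0Pnorm_le => e e0.
  have M0 : 0 <= M by have := fM 1; rewrite expr1n mulr1; exact: le_trans.
  near=> x; have -> : (f \o shift 0) (x *: (1 : R)) = f x.
    by rewrite /= addr0; congr f; exact: mulr1.
  rewrite f0 subr0.
  have x0 : x != 0 by near: x; exact: nbhs_dnbhs_neq.
  rewrite [_ *: _]/(_ * _) normrM normfV mulrC ler_pdivrMr ?normr_gt0//.
  apply: le_trans (fM x) _; rewrite -real_normK ?num_real// expr2 mulrA.
  apply: ler_wpM2r => //.
  (* M + 1 replaces M as divisor because M may be 0. *)
  apply: (@le_trans _ _ (M * (e / (M + 1)))).
    apply: ler_wpM2l => //; near: x; apply: dnbhs0_le.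
    by rewrite divr_gt0// ltr_wpDl.
  by rewrite mulrCA ger_pMr// ler_pdivrMr ?mul1r ?lerDl// ltr_wpDl.
apply: DeriveDef; last by apply: cvg_lim.
by apply/cvg_ex; exists 0.
Unshelve. all: by end_near. Qed.

Lemma is_derive_flat P x :
  is_derive x 1 (flat P) (flat ('X^2 * (P - P^`())) x).
Proof.
have [x0|x0|->] := ltgtP x 0.
- have near0 : \forall y \near x, cst 0 y = flat P y.
    near=> y; rewrite /flat; case: ifPn => // y0; suff : y < 0 by lra.
    by near: y; exact: lt_nbhsl.
  rewrite [X in is_derive _ _ _ X](_ : _ = 0); last first.
    by rewrite /flat; case: ifPn => //; lra.
  exact: (near_eq_is_derive near0).
- have neary : \forall y \near x, P.[y^-1] * expR (- y^-1) = flat P y.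
    near=> y; rewrite /flat; case: ifPn => // /negP y0; suff : 0 < y by [].
    by near: y; exact: lt_nbhsr.
  apply: (near_eq_is_derive neary).
  have xn : x != 0 by rewrite gt_eqF.
  have dV : is_derive x 1 (fun y : R => y^-1) (- x ^- 2).
    apply: DeriveDef; first exact: (@derivableV _ _ id).
    by rewrite (@deriveV _ _ id)// derive_id; exact: mulr1.
  have dH (y : R) : is_derive y (1 : R) (horner P) (P^`().[y]).
    by split; [exact: derivable_horner|rewrite derivE derive1E].
  have dP : is_derive x 1 (fun y => P.[y^-1]) (P^`().[x^-1] * (- x ^- 2)).
    exact: (@is_derive1_comp _ (horner P) (fun y : R => y^-1) x _ _ (dH _) dV).
  have dE : is_derive x 1 (fun y => expR (- y^-1)) (expR (- x^-1) * x ^- 2).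
    apply: (@is_derive1_comp _ expR (fun y : R => - y^-1)).
    by rewrite -[X in is_derive _ _ _ X]opprK; exact: is_deriveN.
  apply: is_derive_eq.
  rewrite /flat x0 hornerM hornerXn hornerD hornerN exprVn /GRing.scale /=.
  ring.
- rewrite [X in is_derive _ _ _ X](_ : _ = 0); last by rewrite /flat ltxx.
  have [M PM] := flat_le P; exact: (is_derive_quadratic PM).
Unshelve. all: by end_near. Qed.

End flat_function.

(** * Smooth cutoffs on the line *)

Section Ck.
Variable R : realType.
Implicit Types f g : R -> R.

Fixpoint Ck k f : Prop :=
  if k is k'.+1 then (forall x, derivable f x 1) /\ Ck k' (derive1 f) else True.

Lemma CkW k f : Ck k.+1 f -> Ck k f.
Proof. by elim: k f => [|k IHk] f //= [df Cf]; split => //; exact: IHk. Qed.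

Lemma CkD k f g : Ck k f -> Ck k g -> Ck k (fun x => f x + g x).
Proof.
elim: k f g => [|k IHk] f g //= [df Cf] [dg Cg]; split.
  by move=> x; apply: derivableD.
rewrite (_ : derive1 _ = fun x => derive1 f x + derive1 g x); first exact: IHk.
by apply/funext => x; rewrite !derive1E -deriveD.
Qed.

Lemma CkM k f g : Ck k f -> Ck k g -> Ck k (fun x => f x * g x).
Proof.
elim: k f g => [|k IHk] f g // Cf Cg; have [df Df] := Cf; have [dg Dg] := Cg; split.
  by move=> x; apply: derivableM.
rewrite (_ : derive1 _ = fun x => f x * derive1 g x + g x * derive1 f x).
  by apply: CkD; apply: IHk => //; exact: CkW.
by apply/funext => x; rewrite !derive1E -[RHS]deriveM.
Qed.

Lemma Ck_cst k (c : R) : Ck k (fun=> c).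
Proof.
elim: k c => [|k IHk] c //=; split; first by move=> x; exact: derivable_cst.
rewrite (_ : derive1 _ = fun=> 0); first exact: IHk.
by apply/funext => x; rewrite derive1E derive_cst.
Qed.

Lemma Ck_affine k f (c e : R) : Ck k f -> Ck k (fun x => f (c * x + e)).
Proof.
elim: k f => [|k IHk] f //= [df Cf].
have d (x : R) : is_derive x (1 : R) (fun x => f (c * x + e)) (c * derive1 f (c * x + e)).
  rewrite derive1E mulrC; apply: (@is_derive1_comp _ f (fun x => c * x + e)).
    by apply: derivableP; exact: df.
  by apply: is_derive_eq; rewrite /GRing.scale /= mulr1 addr0.
split; first by move=> x; exact: ex_derive.
rewrite (_ : derive1 _ = fun x => c * derive1 f (c * x + e)).
  by apply: CkM; [exact: Ck_cst|exact: IHk].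
by apply/funext => x; rewrite derive1E derive_val.
Qed.

Lemma Ck_flat k (P : {poly R}) : Ck k (flat P).
Proof.
elim: k P => [|k IHk] P //=; split.
  by move=> x; have h := is_derive_flat P x; exact: ex_derive.
rewrite (_ : derive1 _ = flat ('X^2 * (P - P^`()))); first exact: IHk.
by apply/funext => x; have h := is_derive_flat P x; rewrite derive1E derive_val.
Qed.

Lemma Ck_derivable_iter f n x : (forall k, Ck k f) ->
  derivable (derive1n n f) x 1.
Proof.
move=> /(_ n.+1); elim: n f => [|n IHn] f [df Cf]; first exact: df.
by rewrite derive1Sn; exact: IHn.
Qed.

(** A smooth bump vanishing outside ]a, b[. The factor n + 1 stretches the argument of exp(-1/x), so
    that the bumps tend pointwise to the indicator of ]a, b[. *)
Definition cutoff (a b : R) (n : nat) (x : R) : R :=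
  flat 1 (n.+1%:R * (x - a)) * flat 1 (n.+1%:R * (b - x)).

Lemma Ck_cutoff a b n k : Ck k (cutoff a b n).
Proof.
rewrite (_ : cutoff a b n = fun x => flat 1 (n.+1%:R * x + (- (n.+1%:R * a))) *
   flat 1 ((- n.+1%:R) * x + n.+1%:R * b)).
  by apply: CkM; apply: Ck_affine; exact: Ck_flat.
by apply/funext => x; rewrite /cutoff; congr (flat _ _ * flat _ _); ring.
Qed.

Lemma flat1_itv x : 0 <= flat (1 : {poly R}) x <= 1.
Proof.
rewrite /flat; case: ifPn => x0; last by rewrite lexx ler01.
by rewrite hornerE mul1r expR_ge0 expR_le1 oppr_le0 invr_ge0 ltW.
Qed.

Lemma cutoff_itv a b n x : 0 <= cutoff a b n x <= 1.
Proof.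
have /andP[? ?] := flat1_itv (n.+1%:R * (x - a)).
have /andP[? ?] := flat1_itv (n.+1%:R * (b - x)).
by rewrite /cutoff mulr_ge0//= mulr_ile1.
Qed.

Lemma cutoff_outside a b n x : ~ (a < x < b) -> cutoff a b n x = 0.
Proof.
move=> xab; rewrite /cutoff /flat !pmulr_rgt0// !subr_gt0.
by case: ifPn => ax; case: ifPn => xb; rewrite ?mul0r ?mulr0//; case: xab; apply/andP.
Qed.

Lemma cvg_flat1 y : 0 < y -> (fun n => flat (1 : {poly R}) (n.+1%:R * y)) @ \oo --> (1 : R).
Proof.
move=> y0; rewrite (_ : (fun n => _) = (fun n => expR (- (n.+1%:R^-1 * y^-1)))); last first.
  by apply/funext => n; rewrite /flat pmulr_rgt0// y0 hornerE mul1r invfM.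
rewrite -[X in _ --> X](@expR0 R); apply: continuous_cvg; first exact: continuous_expR.
rewrite -oppr0; apply: cvgN; rewrite -(mul0r y^-1); apply: cvgMl.
exact: cvg_harmonic.
Qed.

Lemma cvg_cutoff a b x : (fun n => cutoff a b n x) @ \oo --> (if a < x < b then 1 else 0 : R).
Proof.
case: (boolP (a < x < b)) => [/andP[ax xb]|/negP xab].
  rewrite -[X in _ --> X]mulr1; apply: cvgM; apply: cvg_flat1; rewrite subr_gt0//.
by rewrite (_ : (fun n => _) = cst 0); [exact: cvg_cst|apply/funext => n; rewrite cutoff_outside].
Qed.

End Ck.

(** * Tensor products and smooth cutoffs of boxes *)

Section tensor.
Variables (R : realType) (d : nat).
Local Notation e_ i := (delta_mx ord0 i).
Implicit Types g : 'I_d -> R -> R.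

(** A partial derivative of such a product only replaces one factor, so smoothness in several
    variables reduces to the one-variable predicate [Ck]. *)
Definition tensor g (x : 'rV[R]_d) : R := \prod_i g i (x ord0 i).

Lemma tensor_shift g (x : 'rV[R]_d) i (h : R) : tensor g (h *: e_ i + x) =
  g i (h + x ord0 i) * \prod_(j | j != i) g j (x ord0 j).
Proof.
rewrite /tensor (bigD1 i)//= !mxE !eqxx mulr1; congr (_ * _).
by apply: eq_bigr => j ji; rewrite !mxE eqxx (negbTE ji) mulr0 add0r.
Qed.

Lemma tensor_at g (x : 'rV[R]_d) i : tensor g x =
  g i (x ord0 i) * \prod_(j | j != i) g j (x ord0 j).
Proof. by rewrite /tensor (bigD1 i). Qed.

Let slice g (x : 'rV[R]_d) i (t : R) : R := g i t * \prod_(j | j != i) g j (x ord0 j).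

Lemma derivable_tensor g (x : 'rV[R]_d) i : derivable (g i) (x ord0 i) 1 -> derivable (tensor g) x (e_ i).
Proof.
move=> dg; have : derivable (slice g x i) (x ord0 i) 1.
  exact: (derivableM dg (derivable_cst _ _ _)).
rewrite /derivable /shift /comp /=.
under eq_fun do rewrite [X in slice _ _ _ (X + _)]/GRing.scale /= mulr1.
by under [in X in _ -> X]eq_fun do rewrite tensor_shift (tensor_at g x i).
Qed.

Lemma derive_tensor g (x : 'rV[R]_d) i : derivable (g i) (x ord0 i) 1 -> 'D_(e_ i) (tensor g) x =
  tensor (fun j => if j == i then derive1 (g i) else g j) x.
Proof.
move=> dg; transitivity ('D_1 (slice g x i) (x ord0 i)).
  rewrite /derive /shift /comp /=.
  under [in RHS]eq_fun do rewrite [X in slice _ _ _ (X + _)]/GRing.scale /= mulr1.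
  by under [in LHS]eq_fun do rewrite tensor_shift (tensor_at g x i).
have -> : 'D_1 (slice g x i) (x ord0 i) =
    'D_1 (g i) (x ord0 i) * \prod_(j | j != i) g j (x ord0 j).
  by rewrite (deriveM dg (derivable_cst _ _ _)) derive_cst scaler0 add0r mulrC.
rewrite (tensor_at _ x i) eqxx derive1E; congr (_ * _).
by apply: eq_bigr => j /negbTE ->.
Qed.

Lemma continuous_tensor g : (forall i, continuous (g i)) -> continuous (tensor g).
Proof.
move=> cg; suff h s : continuous (fun y : 'rV[R]_d => \prod_(i <- s) g i (y ord0 i)) by exact: h.
elim: s => [|i s IHs].
  rewrite (_ : (fun y => _) = cst 1); first exact: cst_continuous.
  by apply/funext => y; rewrite big_nil.
under eq_fun do rewrite big_cons.
have cgi : continuous (fun y : 'rV[R]_d => g i (y ord0 i)).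
  move=> x; apply: (continuous_comp (f := fun y : 'rV[R]_d => y ord0 i) (g := g i)).
    exact: coord_continuous.
  exact: cg.
by move=> x; exact: (cvgM (cgi x) (IHs x)).
Qed.

Variable g : 'I_d -> R -> R.
Hypothesis Cg : forall i k, Ck k (g i).

Lemma pder_tensor s : pder s (tensor g) =
  tensor (fun i => derive1n (count_mem i s) (g i)).
Proof.
elim: s => [|j s IHs] //=.
rewrite IHs; apply/funext => x; rewrite derive_tensor; last exact: Ck_derivable_iter.
congr (tensor _ x); apply/funext => i; rewrite /= [in RHS]eq_sym.
by case: eqP => [->|_]; rewrite ?add1n ?derive1nS ?add0n.
Qed.

Lemma smooth_tensor : smooth (tensor g).
Proof.
move=> s; rewrite pder_tensor; split.
  apply: continuous_tensor => i x.
  by apply: differentiable_continuous; apply/derivable1_diffP; exact: Ck_derivable_iter.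
by move=> x i; apply: derivable_tensor; exact: Ck_derivable_iter.
Qed.

End tensor.

Section boxes.
Variables (R : realType) (d : nat).
Implicit Types a b : 'rV[R]_d.

Lemma compact_cbox a b : compact (cbox a b).
Proof.
rewrite (_ : cbox a b = [set x | forall i, x ord0 i \in `[a ord0 i, b ord0 i]]).
  by apply: (@rV_compact _ _ (fun i => `[a ord0 i, b ord0 i]%classic)) => i; exact: segment_compact.
by apply/seteqP; split => x /= xr i; have := xr i; rewrite in_itv.
Qed.

Definition cutoff_rV a b n := tensor (fun i => cutoff (a ord0 i) (b ord0 i) n).

Lemma cutoff_rV_itv a b n x : 0 <= cutoff_rV a b n x <= 1.
Proof.
rewrite /cutoff_rV /tensor; apply/andP; split.
  by apply: prodr_ge0 => i _; have /andP[] := cutoff_itv (a ord0 i) (b ord0 i) n (x ord0 i).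
by apply: prodr_ile1 => i _; exact: cutoff_itv.
Qed.

Lemma cutoff_rV_outside a b n x : ~ obox a b x -> cutoff_rV a b n x = 0.
Proof.
move=> /existsNP[i xi]; rewrite /cutoff_rV (tensor_at _ _ i).
by rewrite cutoff_outside ?mul0r.
Qed.

Lemma cvg_cutoff_rV a b x : (fun n => cutoff_rV a b n x) @ \oo --> (\1_(obox a b) x : R).
Proof.
have [xab|xab] := pselect (obox a b x); last first.
  rewrite indicE memNset// (_ : (fun n => _) = cst 0); first exact: cvg_cst.
  by apply/funext => n; rewrite cutoff_rV_outside.
rewrite indicE mem_set// /cutoff_rV /tensor.
rewrite [X in _ --> X](_ : _ = \prod_(i < d) (1 : R)); last by rewrite big1.
elim: (index_enum _) => [|i s IHs].
  by under eq_fun do rewrite big_nil; rewrite big_nil; exact: cvg_cst.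
under eq_fun do rewrite big_cons; rewrite big_cons.
apply: cvgM; last exact: IHs.
by have := @cvg_cutoff R (a ord0 i) (b ord0 i) (x ord0 i); rewrite (xab i).
Qed.

Lemma test_fun_cutoff_rV (Omega : set 'rV[R]_d) a b n :
  cbox a b `<=` Omega -> test_fun Omega (cutoff_rV a b n).
Proof.
move=> abO; split.
  by apply: smooth_tensor => i k; exact: Ck_cutoff.
exists (cbox a b); split => //; first exact: compact_cbox.
move=> x xab; apply: cutoff_rV_outside; apply: contra_not xab.
exact: obox_sub_cbox.
Qed.

End boxes.

Section test_functions.
Variables (R : realType) (d : nat) (Omega : set 'rV[R]_d).
Implicit Types p f g : 'rV[R]_d -> R.

Lemma coord_le_norm (x : 'rV[R]_d) i : `|x ord0 i| <= `|x|.
Proof.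
rewrite [leRHS]/Num.norm/= mx_normrE; apply/bigmax_geP; right => /=.
by exists (ord0, i).
Qed.

Lemma test_fun_continuous p : test_fun Omega p -> continuous p.
Proof. by move=> [/(_ [::])[]]. Qed.

Lemma test_fun_outside p x : test_fun Omega p -> ~ Omega x -> p x = 0.
Proof. by move=> [_ [K [_ KO pK]]] Ox; apply: pK => /KO. Qed.

Lemma test_fun_C1c p : test_fun Omega p -> C1c p.
Proof.
move=> [sp [K [cK _ pK]]]; split.
- by have [] := sp [::].
- by move=> i x; have [_] := sp [::]; exact.
- by move=> i; have [] := sp [:: i].
have /compact_bounded[M [_ KM]] := cK.
exists (`|M| + 1); split => [|x bx]; first by rewrite ltr_wpDl.
apply: pK; apply: contra_not bx => Kx i.
apply: le_trans (coord_le_norm x i) _; apply: KM => //.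
by rewrite (le_lt_trans (ler_norm M))// ltrDl.
Qed.

Lemma test_fun_pder p s : test_fun Omega p -> test_fun Omega (pder s p).
Proof.
move=> [sp [K [cK KO pK]]]; split.
  by move=> t; have := sp (t ++ s); rewrite /pder foldr_cat.
exists K; split => // {sp}; elim: s => [//|i s IHs] x Kx.
apply: (derive_outside (K := K)) => //.
by apply: compact_closed => //; exact: norm_hausdorff.
Qed.

Lemma L2_subset f : measurable Omega -> L2 [set: _] f -> L2 Omega f.
Proof.
move=> mO [mf fi]; split; first exact: measurable_funTS.
apply: le_lt_trans fi; apply: ge0_subset_integral => //.
  by apply/measurable_EFinP; exact: measurable_funX.
by move=> x _; rewrite lee_fin sqr_ge0.
Qed.

Lemma test_fun_L2 p : measurable Omega -> test_fun Omega p -> L2 Omega p.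
Proof. by move=> mO tp; apply: L2_subset => //; apply/cc_L2/C1c_cc; exact: test_fun_C1c. Qed.

End test_functions.

(** * The fundamental lemma of the calculus of variations *)

Section fundamental_lemma.
Variables (R : realType) (d : nat) (Omega : set 'rV[R]_d).
Hypothesis oOmega : open Omega.
Local Notation leb := (lebesgue_rV R d).

Lemma rV_lt_bound (x : 'rV[R]_d) : exists n : nat, forall i, - n%:R < x ord0 i < n%:R.
Proof.
have s0 : 0 <= \sum_i `|x ord0 i| by exact: sumr_ge0.
exists (Num.bound (\sum_i `|x ord0 i|)) => i; rewrite -ltr_norml.
apply: le_lt_trans (archi_boundP s0).
by rewrite (bigD1 i)//= lerDl; exact: sumr_ge0.
Qed.

Lemma obox_setI (a1 b1 a2 b2 : 'rV[R]_d) : obox a1 b1 `&` obox a2 b2 =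
  obox (\row_i Num.max (a1 ord0 i) (a2 ord0 i)) (\row_i Num.min (b1 ord0 i) (b2 ord0 i)).
Proof.
apply/seteqP; split => x /=.
  move=> [x1 x2] i; rewrite !mxE gt_max lt_min.
  by have /andP[-> ->] := x1 i; have /andP[-> ->] := x2 i.
move=> x12; split => i; have := x12 i; rewrite !mxE gt_max lt_min;
  by move=> /andP[/andP[? ?] /andP[? ?]]; apply/andP.
Qed.

(** Open boxes are stable under intersection, which suits a Dynkin argument. A slab constrained in
    one coordinate is the union over n of boxes of half-width n in the other coordinates. *)
Lemma measurable_rV_generated :
  @measurable _ 'rV[R]_d = <<s [set A | exists a b : 'rV[R]_d, A = obox a b] >>.
Proof.
apply/seteqP; split; last first.
  apply: smallest_sub; first exact: sigma_algebra_measurable.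
  by move=> _ [a [b ->]]; exact: measurable_obox.
set G := [set A | _]; have sG := smallest_sigma_algebra setT G.
have [sG0 sGC sGU] := sG.
apply: smallest_sub => //; rewrite -bigcup_seq => A [i _ [B mB <-]]; rewrite setTI.
have : (@RGenOpens.G R).-sigma.-measurable B by rewrite -RGenOpens.measurableE.
suff : <<s @RGenOpens.G R >> `<=` [set B | <<s G >> ((fun x : 'rV[R]_d => x ord0 i) @^-1` B)].
  exact.
apply: smallest_sub.
  split => /=; first by rewrite preimage_set0.
    by move=> C GC; rewrite setTD preimage_setC -setTD; exact: sGC.
  by move=> F GF; rewrite preimage_bigcup; exact: sGU.
move=> _ [x [y ->]] /=.
rewrite (_ : _ @^-1` _ = \bigcup_n (obox (\row_j (if j == i then x else - n%:R) : 'rV[R]_d)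
    (\row_j (if j == i then y else n%:R)))).
  by apply: sGU => n; apply: sub_sigma_algebra; do 2 eexists.
apply/seteqP; split => z /=.
  rewrite in_itv /= => zxy; have [n zn] := rV_lt_bound z; exists n => // j.
  by rewrite !mxE; case: eqP => [->|_].
by move=> [n _ /(_ i)]; rewrite !mxE eqxx in_itv.
Qed.

Variable h : 'rV[R]_d -> R.
Hypothesis Lh : L2 Omega h.
Hypothesis h_orth : forall p, test_fun Omega p -> ip Omega h p = 0.
Let mOmega : measurable Omega := open_measurable_rV oOmega.
Local Open Scope ereal_scope.

Lemma obox_fin a b : (leb (obox a b) < +oo)%E.
Proof.
have [n an] := rV_lt_bound a; have [m bm] := rV_lt_bound b.
apply: le_lt_trans (lebesgue_rV_box d (n%:R + m%:R : R)).
apply: le_measure; rewrite ?inE; [exact: measurable_obox|exact: measurable_box|].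
move=> x xab i; have /andP[ax xb] := xab i; have /andP[na _] := an i; have /andP[_ mb] := bm i.
have : (0 <= n%:R :> R)%R by []. have : (0 <= m%:R :> R)%R by [].
rewrite ler_norml; move=> ? ?; apply/andP; split; lra.
Qed.

Lemma L2_indic_obox a b : L2 Omega \1_(obox a b).
Proof.
split; first by apply: measurable_funTS; apply: measurable_indic; exact: measurable_obox.
apply: le_lt_trans (obox_fin a b); have mab := measurable_obox a b.
rewrite (eq_integral (fun x => (\1_(obox a b) x)%:E)); last first.
  by move=> x _; rewrite indicE; case: (x \in _); rewrite ?expr1n ?expr0n.
rewrite integral_indic//; apply: le_measure; rewrite ?inE//; exact: measurableI.
Qed.

(** The cutoffs of the box are orthogonal to [h] and tend to its indicator; dominated convergence
    applies with |h| on the box as bound. The closed box lies in Omega so that the cutoffs are test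
    functions. *)
Lemma integral_obox_eq0 a b : cbox a b `<=` Omega ->
  \int[leb]_(x in obox a b) (h x)%:E = 0.
Proof.
move=> abO; have mh := L2_measurable Lh.
have mab := measurable_obox a b; have L1 := L2_indic_obox a b.
have Lc n := test_fun_L2 mOmega (test_fun_cutoff_rV n abO).
have ig : leb.-integrable Omega (EFin \o (fun x => `|h x| * \1_(obox a b) x)%R).
  apply: L2_integrableM => //; apply: (@dominated_L2 _ _ _ mOmega _ (fun x => h x ^+ 2)%R).
  - exact: measurableT_comp.
  - exact: L2_integrable_sqr.
  - by move=> x _; rewrite real_normK// num_real.
have cvg_h : {ae leb, forall x, Omega x ->
    (fun n => (h x * cutoff_rV a b n x)%:E) @ \oo --> (h x * \1_(obox a b) x)%:E}.
  apply: aeW => x _; apply: cvg_EFin; first exact: nearW.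
  by apply: cvgM; [exact: cvg_cst|exact: cvg_cutoff_rV].
have dom_h : {ae leb, forall x n, Omega x -> `|(h x * cutoff_rV a b n x)%:E| <=
    (EFin \o (fun x => `|h x| * \1_(obox a b) x)%R) x}.
  apply: aeW => x n _ /=; rewrite lee_fin normrM ler_wpM2l// indicE.
  have /andP[c0 c1] := cutoff_rV_itv a b n x.
  case: (boolP (x \in _)) => [_|/negP xab]; first by rewrite ger0_norm.
  by rewrite cutoff_rV_outside ?normr0// => /mem_set.
have [_ _] := dominated_convergence mOmega
  (fun n => measurable_int leb (L2_integrableM mOmega Lh (Lc n)))
  (measurable_int leb (L2_integrableM mOmega Lh L1)) cvg_h ig dom_h.
rewrite (_ : [sequence _]_n = cst 0); last first.
  apply/funext => n /=; have := h_orth (test_fun_cutoff_rV n abO).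
  have := integrable_fin_num mOmega (L2_integrableM mOmega Lh (Lc n)).
  by move=> /fineK <- hn; congr EFin.
move=> cvg0; have := cvg_unique _ cvg0 (cvg_cst 0) => <-//.
have abO' : obox a b `<=` Omega by move=> x /obox_sub_cbox; exact: abO.
rewrite -[X in \int[leb]_(x in X) _ = _](setIidr abO') integral_mkcondr.
apply: eq_integral => x _; rewrite patchE /= indicE.
by case: ifP => _; rewrite ?mulr1 ?mulr0.
Qed.

(** The sets A such that [h] has zero integral over the part of the box in A form a Dynkin system
    containing the open boxes, hence include every measurable set; a function with zero integral
    over all measurable subsets vanishes almost everywhere. *)
Lemma obox_ae_eq0 a b : cbox a b `<=` Omega ->
  ae_eq leb (obox a b) (EFin \o h) (cst 0).
Proof.
move=> abO; have mab := measurable_obox a b; have mh := L2_measurable Lh.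
have abO' : obox a b `<=` Omega by move=> x /obox_sub_cbox; exact: abO.
have ih : leb.-integrable (obox a b) (EFin \o h).
  have L1 := L2_indic_obox a b.
  have : leb.-integrable Omega (EFin \o (fun x => h x * \1_(obox a b) x)%R).
    exact: L2_integrableM.
  move/(integrableS mOmega mab abO'); apply: eq_integrable => //.
  by move=> x xab /=; rewrite indicE xab mulr1.
pose P (A : set 'rV[R]_d) := \int[leb]_(x in obox a b `&` A) (h x)%:E = 0.
have intP A : measurable A -> leb.-integrable (obox a b `&` A) (EFin \o h).
  move=> mA; apply: integrableS ih => //; exact: measurableI.
have PA A : measurable A -> P A.
  move=> mA; apply: (dynkin_induction measurable_rV_generated).
  - move=> _ _ [a1 [b1 ->]] [a2 [b2 ->]].
    by rewrite obox_setI; do 2 eexists.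
  - by rewrite /P setIT integral_obox_eq0.
  (* The intersection is again an open box, and its closed version still lies in [cbox a b]. *)
  - move=> _ [a1 [b1 ->]]; rewrite /P.
    rewrite obox_setI; apply: integral_obox_eq0 => x xab; apply: abO => i.
    have := xab i; rewrite !mxE ge_max le_min.
    by move=> /andP[/andP[-> _] /andP[-> _]].
  - move=> S mS; rewrite /P => PS.
    have := integral_obox_eq0 abO; rewrite -{1}(setIT (obox a b)) -(setUv S) setIUr.
    rewrite integral_setU//; last 4 first.
    + exact: measurableI.
    + by apply: measurableI => //; exact: measurableC.
    + by rewrite -setIUr setUv setIT; exact: (measurable_int leb ih).
    + by apply/disj_setPS => x [[_ Sx] [_]].
    by rewrite PS add0e.
  - move=> F mF tF PF; rewrite /P setI_bigcupr integral_bigcup.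
    + by rewrite eseries0// => n _ _; exact: PF.
    + exact: trivIset_setIl.
    + by move=> k; exact: measurableI.
    + by rewrite -setI_bigcupr; apply: intP; exact: bigcupT_measurable.
  - by rewrite -measurable_rV_generated.
apply: integral_ae_eq => // E Eab mE.
by rewrite integral0 -(setIidr Eab); exact: PA.
Qed.

(** Countably many rational boxes whose closed versions lie in Omega cover it, so the exceptional
    sets add up to a null set. They are indexed by the codes of the corners, with the empty set for
    codes that name no such box. *)
Lemma weak_eq0_ae : {ae leb, forall x, Omega x -> h x = 0%R}.
Proof.
pose B (pq : 'rV[rat]_d * 'rV[rat]_d) :=
  obox (map_mx (ratr : rat -> R) pq.1) (map_mx ratr pq.2).
pose N n := if unpickle n is Some pq then
  if `[< cbox (map_mx (ratr : rat -> R) pq.1) (map_mx ratr pq.2) `<=` Omega >]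
  then [set x | ~ (B pq x -> h x = 0%R)] else set0 else set0.
have N0 n : leb.-negligible (N n).
  rewrite /N; case: (unpickle n) => [pq|]; last exact: negligible_set0.
  case: asboolP => [/obox_ae_eq0|_]; last exact: negligible_set0.
  by apply: negligibleS => x /= hx hx'; apply: hx => Bx; have [] := hx' Bx.
apply: (negligibleS _ (negligible_bigcup N0)) => x /= /not_implyP[Ox hx].
have [pq [xB BO]] := open_rat_obox oOmega Ox.
exists (pickle pq) => //; rewrite /N pickleK; case: asboolP => // _ /=.
by move=> /(_ xB).
Qed.

End fundamental_lemma.

(** * Weak derivatives and H^1_0 *)

Section weak_derivatives.
Variables (R : realType) (d : nat) (Omega : set 'rV[R]_d).
Hypothesis oOmega : open Omega.
Local Notation leb := (lebesgue_rV R d).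
Local Notation L2 := (L2 Omega).
Local Notation ip := (ip Omega).
Local Notation L2norm := (L2norm Omega).
Local Notation is_weak_der := (is_weak_der Omega).
Local Notation wD := (wD Omega).
Local Notation test_fun := (test_fun Omega).
Implicit Types (f g h p : 'rV[R]_d -> R) (s : seq 'I_d).
Let mOmega : measurable Omega := open_measurable_rV oOmega.

(** [wD] picks a representative by [xget], so identities between weak derivatives hold only in this
    sense. *)
Definition eqae f g := {ae leb, forall x, Omega x -> f x = g x}.

Lemma eqae_refl f : eqae f f.
Proof. exact: aeW. Qed.

Lemma eqae_trans f g h : eqae f g -> eqae g h -> eqae f h.
Proof. by apply: filterS2 => x fg gh Ox; rewrite fg// gh. Qed.

Lemma eqae_Rintegral f g : measurable_fun Omega f -> measurable_fun Omega g ->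
  eqae f g -> \int[leb]_(x in Omega) f x = \int[leb]_(x in Omega) g x.
Proof.
move=> mf mg fg; rewrite /Rintegral; congr fine; apply: ae_eq_integral => //.
- exact/measurable_EFinP.
- exact/measurable_EFinP.
- by apply: filterS fg => x fg Ox; rewrite fg.
Qed.

Lemma eqae_ip f f' g g' : L2 f -> L2 f' -> L2 g -> L2 g' -> eqae f f' -> eqae g g' ->
  ip f g = ip f' g'.
Proof.
move=> [mf _] [mf' _] [mg _] [mg' _] ff' gg'; apply: eqae_Rintegral.
- exact: measurable_funM.
- exact: measurable_funM.
- by apply: filterS2 ff' gg' => x ff' gg' Ox; rewrite ff'// gg'.
Qed.

Lemma eqae_L2norm f g : L2 f -> L2 g -> eqae f g -> L2norm f = L2norm g.
Proof. by move=> Lf Lg fg; rewrite /Defs.L2norm (eqae_ip Lf Lg Lf Lg). Qed.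

Lemma ip_test_setT p g : test_fun p -> ip p g = Defs.ip setT p g.
Proof.
move=> tp; rewrite /Defs.ip Rintegral_mkcond; apply: eq_Rintegral => x _.
rewrite patchE; case: ifPn => //; rewrite notin_setE => Ox.
by rewrite (test_fun_outside tp Ox) mul0r.
Qed.

Lemma ip_test_derive p g i : test_fun p -> test_fun g ->
  ip p (pder [:: i] g) = - ip (pder [:: i] p) g.
Proof.
move=> tp tg; have Cp := test_fun_C1c tp; have Cg := test_fun_C1c tg.
have tDp := test_fun_pder [:: i] tp; have tDg := test_fun_pder [:: i] tg.
rewrite !ip_test_setT//; apply/eqP; rewrite -addr_eq0.
have L2T f : test_fun f -> Defs.L2 setT f by move=> tf; exact: cc_L2 (C1c_cc (test_fun_C1c tf)).
rewrite /Defs.ip -RintegralD//; last 2 first.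
- by apply: (@L2_integrableM _ _ setT) => //; exact: L2T.
- by apply: (@L2_integrableM _ _ setT) => //; exact: L2T.
have := integral_derive_eq0 i (C1cM Cp Cg); rewrite /Rintegral => I0.
rewrite [X in fine X](_ : _ = 0%E) //; rewrite -[RHS]I0; apply: eq_integral => x _.
have [_ dp _ _] := Cp; have [_ dg _ _] := Cg.
by rewrite deriveM// /GRing.scale /= /pder /=; congr EFin; ring.
Qed.

(** Moving the outermost derivative of the test function across first produces the classical
    derivatives of [p] in reverse order, which avoids commuting partial derivatives. *)
Lemma is_weak_der_test p s : test_fun p -> exists g, is_weak_der s p g.
Proof.
elim: s p => [|i s IHs] p tp.
  exists p; split; first exact: test_fun_L2.
  by move=> phi _; rewrite expr0 mul1r.
have [g [Lg pg]] := IHs _ (test_fun_pder [:: i] tp).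
exists g; split => // phi tphi; rewrite exprS mulN1r mulNr -pg//.
by rewrite -ip_test_derive//; exact: test_fun_pder.
Qed.

Lemma is_weak_der_test1 p i : test_fun p -> is_weak_der [:: i] p (pder [:: i] p).
Proof.
move=> tp; split; first by apply: test_fun_L2 => //; exact: test_fun_pder.
by move=> phi tphi; rewrite expr1 mulN1r ip_test_derive.
Qed.

Lemma is_weak_der_nil f : L2 f -> is_weak_der [::] f f.
Proof. by move=> Lf; split => // phi _; rewrite expr0 mul1r. Qed.

Lemma is_weak_der_unique s f g h : is_weak_der s f g -> is_weak_der s f h -> eqae g h.
Proof.
move=> [Lg fg] [Lh fh].
have : {ae leb, forall x, Omega x -> (g - h) x = 0}.
  apply: weak_eq0_ae => //; first exact: L2B.
  move=> p tp; have Lp := test_fun_L2 mOmega tp.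
  rewrite ipBl//; apply/eqP; rewrite subr_eq0; apply/eqP.
  by apply: (@mulrI _ ((-1) ^+ size s)); rewrite ?unitrX ?unitrN1// -fg// -fh.
apply: filterS => x gh Ox; apply/eqP; rewrite -subr_eq0; apply/eqP.
exact: gh.
Qed.

Lemma is_weak_der_linear a s f f' g g' : L2 f -> L2 f' ->
  is_weak_der s f g -> is_weak_der s f' g' -> is_weak_der s (a *: f + f') (a *: g + g').
Proof.
move=> Lf Lf' [Lg fg] [Lg' fg']; split; first by apply: L2D => //; exact: L2Z.
move=> p tp; have Lp := test_fun_L2 mOmega tp.
have LDp := test_fun_L2 mOmega (test_fun_pder s tp).
rewrite !ipDl ?ipZl//; try exact: L2Z.
by rewrite fg// fg'//; ring.
Qed.

Lemma wDP s f : (exists g, is_weak_der s f g) -> is_weak_der s f (wD s f).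
Proof. by move=> [g fg]; apply: xgetPex; exists g. Qed.

Lemma wD_eqae s f g : is_weak_der s f g -> eqae (wD s f) g.
Proof. by move=> fg; apply: (is_weak_der_unique (s := s) (f := f)) => //; apply: wDP; exists g. Qed.

Lemma wD_linear a s f g : L2 f -> L2 g ->
  (exists h, is_weak_der s f h) -> (exists h, is_weak_der s g h) ->
  eqae (wD s (a *: f + g)) (a *: wD s f + wD s g).
Proof. by move=> Lf Lg /wDP Df /wDP Dg; apply: wD_eqae; exact: is_weak_der_linear. Qed.

Lemma pder_linear a f g s : smooth f -> smooth g ->
  pder s (a *: f + g) = a *: pder s f + pder s g.
Proof.
move=> sf sg; elim: s => [//|i s IHs]; apply/funext => x.
have [_ df] := sf s; have [_ dg] := sg s.
transitivity ('D_(delta_mx ord0 i) (pder s (a *: f + g)) x) => //; rewrite IHs.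
by rewrite deriveD ?deriveZ//; exact: derivableZ.
Qed.

Lemma test_fun_linear a f g : test_fun f -> test_fun g -> test_fun (a *: f + g).
Proof.
move=> [sf [K [cK KO fK]]] [sg [K' [cK' KO' gK']]]; split.
  move=> s; rewrite pder_linear//; have [cf df] := sf s; have [cg dg] := sg s; split.
    by move=> x; exact: (cvgD (cvgM (cvg_cst a) (cf x)) (cg x)).
  by move=> x i; apply: derivableD => //; exact: derivableZ.
exists (K `|` K'); split; first exact: compactU.
  by rewrite subUset.
move=> x /not_orP[Kx Kx']; have -> : (a *: f + g) x = a * f x + g x by [].
by rewrite fK// gK'// mulr0 addr0.
Qed.

End weak_derivatives.

(** * Sobolev norms and the linear structure of H^1_0 *)

Section sobolev.
Variables (R : realType) (d : nat) (Omega : set 'rV[R]_d).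
Hypothesis oOmega : open Omega.
Local Notation L2 := (L2 Omega).
Local Notation L2norm := (L2norm Omega).
Local Notation is_weak_der := (is_weak_der Omega).
Local Notation wD := (wD Omega).
Local Notation test_fun := (test_fun Omega).
Local Notation sobolev := (sobolev Omega).
Local Notation H10 := (H10 Omega).
Implicit Types (f g h p : 'rV[R]_d -> R) (s : seq 'I_d).
Let mOmega : measurable Omega := open_measurable_rV oOmega.

Lemma mseq0 k : mseq ([ffun=> ord0] : multi_index d k) = [::].
Proof.
by rewrite /mseq; elim: (enum _) => //= i s ->; rewrite ffunE.
Qed.

(** The multi-index of a single derivative, through which [sobolev] and its norm give access to [wD
    [:: i]]; the order must be at least one, hence [k.+1]. *)
Definition mdelta k (i : 'I_d) : multi_index d k.+1 := [ffun j => inord (j == i)].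

Lemma mdeltaE k i j : mdelta k i j = (j == i) :> nat.
Proof. by rewrite ffunE inordK//; case: (j == i). Qed.

Lemma mseq_mdelta k i : mseq (mdelta k i) = [:: i].
Proof.
have nil_notin t : i \notin t -> flatten [seq nseq (mdelta k i j) j | j <- t] = [::].
  elim: t => //= j t IHt; rewrite inE negb_or => /andP[ij it].
  by rewrite mdeltaE eq_sym (negbTE ij) IHt.
rewrite /mseq; have := enum_uniq 'I_d; have : i \in enum 'I_d by rewrite mem_enum.
elim: (enum _) => //= j t IHt; rewrite inE mdeltaE.
have [<- _|ji /= it] := eqVneq i j; first by move=> /andP[jt _]; rewrite nil_notin.
by move=> /andP[_ ut]; rewrite IHt.
Qed.

Lemma mabs_mdelta k i : mabs (mdelta k i) = 1%N.
Proof.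
rewrite /mabs (eq_bigr (fun j => (j == i) : nat)); last by move=> j _; rewrite mdeltaE.
by rewrite (bigD1 i)//= eqxx big1// => j /negbTE ->.
Qed.

Lemma mabs0 k : mabs ([ffun=> ord0] : multi_index d k) = 0%N.
Proof. by rewrite /mabs big1// => i _; rewrite ffunE. Qed.

Lemma sobolev_wD k f i : sobolev k.+1 f -> is_weak_der [:: i] f (wD [:: i] f).
Proof.
move=> [_ /(_ (mdelta k i))]; rewrite mabs_mdelta mseq_mdelta => h.
by apply: wDP; exact: h.
Qed.

Lemma sobolev_linear k a f g : sobolev k f -> sobolev k g -> sobolev k (a *: f + g).
Proof.
move=> [Lf Df] [Lg Dg]; split; first by apply: L2D => //; exact: L2Z.
move=> al kal; have [f' ff'] := Df al kal; have [g' gg'] := Dg al kal.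
by exists (a *: f' + g'); exact: is_weak_der_linear.
Qed.

Lemma sobolev_test k p : test_fun p -> sobolev k p.
Proof.
by move=> tp; split; [exact: test_fun_L2|move=> al _; exact: is_weak_der_test].
Qed.

Lemma sobolev_norm_ge k f (al : multi_index d k) : (mabs al <= k)%N ->
  L2norm (wD (mseq al) f) <= sobolev_norm Omega k f.
Proof.
move=> kal; rewrite -(ger0_norm (L2norm_ge0 _ _)) -sqrtr_sqr ler_wsqrtr//.
by rewrite (bigD1 al)//= lerDl; apply: sumr_ge0 => j _; exact: sqr_ge0.
Qed.

Lemma sobolev_norm_ge_L2 k f : L2 f -> L2norm f <= sobolev_norm Omega k f.
Proof.
move=> Lf; have := @sobolev_norm_ge k f ([ffun=> ord0] : multi_index d k); rewrite mabs0 mseq0 => /(_ isT).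
apply: le_trans; rewrite (@eqae_L2norm _ _ _ oOmega (wD [::] f) f)//.
  by have [] := @wDP _ _ Omega [::] f (ex_intro _ f (is_weak_der_nil Lf)).
exact/wD_eqae/is_weak_der_nil.
Qed.

Lemma sobolev_norm_ge_wD k f i : L2norm (wD [:: i] f) <= sobolev_norm Omega k.+1 f.
Proof. by have := @sobolev_norm_ge k.+1 f (mdelta k i); rewrite mabs_mdelta mseq_mdelta => /(_ isT). Qed.

Lemma sobolev_norm_cvg0 k (F : nat -> 'rV[R]_d -> R) :
  (forall al : multi_index d k, (mabs al <= k)%N ->
    (fun n => L2norm (wD (mseq al) (F n))) @ \oo --> (0 : R)) ->
  (fun n => sobolev_norm Omega k (F n)) @ \oo --> (0 : R).
Proof.
move=> F0; rewrite -[X in _ --> X](@sqrtr0 R); apply: continuous_cvg; first exact: sqrt_continuous.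
elim: (index_enum _) => [|al s IHs].
  by under eq_fun do rewrite big_nil; exact: cvg_cst.
have [kal|kal] := boolP (mabs al <= k)%N; last first.
  by under eq_fun do rewrite big_cons (negbTE kal).
rewrite (_ : (fun n => _) = (fun n => L2norm (wD (mseq al) (F n)) * L2norm (wD (mseq al) (F n)) +
    \sum_(al <- s | (mabs al <= k)%N) L2norm (wD (mseq al) (F n)) ^+ 2)); last first.
  by apply/funext => n; rewrite big_cons kal expr2.
have h := F0 al kal; rewrite -[X in _ --> X]addr0; apply: cvgD; last exact: IHs.
by rewrite -[X in _ --> X](mulr0 0); exact: (cvgM h h).
Qed.

Lemma sobolev_norm_linear_cvg0 k a (F G : nat -> 'rV[R]_d -> R) :
  (forall n, sobolev k (F n)) -> (forall n, sobolev k (G n)) ->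
  (fun n => sobolev_norm Omega k (F n)) @ \oo --> (0 : R) ->
  (fun n => sobolev_norm Omega k (G n)) @ \oo --> (0 : R) ->
  (fun n => sobolev_norm Omega k (a *: F n + G n)) @ \oo --> (0 : R).
Proof.
move=> sF sG F0 G0; apply: sobolev_norm_cvg0 => al kal.
have : (fun n => `|a| * sobolev_norm Omega k (F n) + sobolev_norm Omega k (G n)) @ \oo --> (0 : R).
  rewrite -[X in _ --> X]addr0; apply: (cvgD _ G0).
  by rewrite -(mulr0 `|a|); exact: (cvgM (cvg_cst _) F0).
apply: squeeze_cvgr; last exact: cvg_cst.
apply: nearW => n; rewrite L2norm_ge0/=.
have [LF DF] := sF n; have [LG DG] := sG n.
have [LDF _] := wDP (DF al kal); have [LDG _] := wDP (DG al kal).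
have [_ /(_ al kal)/wDP[LDFG _]] := sobolev_linear a (sF n) (sG n).
have L2a := L2Z mOmega a LDF.
rewrite (eqae_L2norm oOmega LDFG (L2D mOmega L2a LDG)); last exact: wD_linear (DF al kal) (DG al kal).
apply: le_trans (L2normD mOmega L2a LDG) _; rewrite (L2normZ mOmega _ LDF).
by rewrite lerD ?ler_wpM2l// sobolev_norm_ge.
Qed.

Lemma H10_linear a f g : H10 f -> H10 g -> H10 (a *: f + g).
Proof.
move=> [sf [p tp pf]] [sg [r tr rg]]; split; first exact: sobolev_linear.
exists (fun n => a *: p n + r n).
  by move=> n; exact: test_fun_linear.
rewrite (_ : (fun n => _) = (fun n => sobolev_norm Omega 1 (a *: (p n - f) + (r n - g)))).
  apply: sobolev_norm_linear_cvg0 => // n.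
    by rewrite -[_ - _]addrC -scaleN1r; apply: sobolev_linear => //; exact: sobolev_test.
  by rewrite -[_ - _]addrC -scaleN1r; apply: sobolev_linear => //; exact: sobolev_test.
by apply/funext => n; congr sobolev_norm; rewrite scalerBr opprD addrACA.
Qed.

End sobolev.

(** * The L^4 bound on H^1_0, by truncation and density *)

Section truncation.
Variable R : realType.
Implicit Types a b N : R.

(* For f in H^1_0, the products f min(|f|, N) are L^2 limits of those of test
   functions, because trunc N is Lipschitz; letting N grow then gives f in L^4. *)
Definition trunc N a : R := a * Num.min `|a| N.

(** With |b| <= |a|, each part of the decomposition costs N |a - b|: the second vanishes if |b| > N,
    since then both minima equal N, and otherwise carries the factor |b| <= N. *)
Lemma trunc_lipschitz N a b : 0 <= N -> `|trunc N a - trunc N b| <= 2 * N * `|a - b|.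
Proof.
move=> N0; wlog ba : a b / `|b| <= `|a|.
  move=> h; case: (leP `|b| `|a|) => [|/ltW] /h //.
  by rewrite distrC (distrC b).
rewrite /trunc; have ab := lerB_dist a b.
have m0 : 0 <= Num.min `|a| N <= N by rewrite le_min normr_ge0 N0 ge_min lexx orbT.
have -> : a * Num.min `|a| N - b * Num.min `|b| N =
  (a - b) * Num.min `|a| N + b * (Num.min `|a| N - Num.min `|b| N) by ring.
apply: le_trans (ler_normD _ _) _; rewrite !normrM.
have h1 : `|a - b| * `|Num.min `|a| N| <= N * `|a - b|.
  by rewrite mulrC; apply: ler_wpM2r => //; rewrite ger0_norm; case/andP: m0.
suff h2 : `|b| * `|Num.min `|a| N - Num.min `|b| N| <= N * `|a - b| by lra.
have [bN|/ltW Nb] := leP `|b| N; last first.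
  rewrite (min_r (le_trans Nb ba)) subrr normr0 mulr0; exact: mulr_ge0.
apply: ler_pM => //; apply: le_trans ab.
rewrite ger0_norm; last by rewrite subr_ge0 le_min ba bN.
by rewrite lerD2r ge_min lexx.
Qed.

Lemma trunc_sqr_le N a : 0 <= N -> trunc N a ^+ 2 <= a ^+ 2 * a ^+ 2.
Proof.
move=> N0; rewrite /trunc exprMn; apply: ler_wpM2l; first exact: sqr_ge0.
rewrite -(real_normK (num_real a)) ler_pXn2r ?nnegrE ?le_min ?normr_ge0 ?N0//.
by rewrite ge_min lexx.
Qed.

Lemma trunc_sqr_le_N N a : 0 <= N -> trunc N a ^+ 2 <= N ^+ 2 * a ^+ 2.
Proof.
move=> N0; rewrite /trunc exprMn mulrC; apply: ler_wpM2r; first exact: sqr_ge0.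
by rewrite ler_pXn2r ?nnegrE ?le_min ?normr_ge0 ?N0// ge_min lexx orbT.
Qed.

Lemma trunc_sqr_nondecreasing N M a : 0 <= N -> N <= M -> trunc N a ^+ 2 <= trunc M a ^+ 2.
Proof.
move=> N0 NM; have M0 := le_trans N0 NM; rewrite /trunc !exprMn; apply: ler_wpM2l; first exact: sqr_ge0.
rewrite ler_pXn2r ?nnegrE ?le_min ?normr_ge0 ?N0 ?M0//.
by rewrite !ge_min lexx/= NM orbT.
Qed.

Lemma trunc_sqrE N a : `|a| <= N -> trunc N a ^+ 2 = a ^+ 2 * a ^+ 2.
Proof. by move=> aN; rewrite /trunc min_l// exprMn real_normK// num_real. Qed.

Lemma measurable_trunc N : measurable_fun [set: R] (trunc N).
Proof.
apply: measurable_funM => //; apply: measurable_minr => //.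
Qed.

End truncation.

Section L2_limits.
Variables (R : realType) (d : nat) (Omega : set 'rV[R]_d).
Hypothesis mOmega : measurable Omega.
Local Notation leb := (lebesgue_rV R d).
Local Notation L2 := (L2 Omega).
Local Notation ip := (ip Omega).
Local Notation L2norm := (L2norm Omega).
Implicit Types (f g : 'rV[R]_d -> R).

Lemma cvg_dist_le (u b : nat -> R) l : (forall n, `|u n - l| <= b n) ->
  b @ \oo --> (0 : R) -> u @ \oo --> l.
Proof.
move=> ub b0; apply/cvgrPdist_le => e e0; have /cvgrPdist_le/(_ e e0) := b0.
apply: filterS => n; rewrite sub0r normrN => bn.
by rewrite distrC (le_trans (ub n))// (le_trans (ler_norm _)).
Qed.

Lemma cvg_ip (F G : nat -> 'rV[R]_d -> R) f g :
  (forall n, L2 (F n)) -> (forall n, L2 (G n)) -> L2 f -> L2 g ->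
  (fun n => L2norm (F n - f)) @ \oo --> (0 : R) ->
  (fun n => L2norm (G n - g)) @ \oo --> (0 : R) ->
  (fun n => ip (F n) (G n)) @ \oo --> ip f g.
Proof.
move=> LF LG Lf Lg Ff Gg.
apply: (@cvg_dist_le _ (fun n => L2norm (F n - f) * (L2norm (G n - g) + L2norm g) +
    L2norm f * L2norm (G n - g))); last first.
  rewrite -[X in _ --> X]addr0; apply: cvgD.
    rewrite -(mul0r (0 + L2norm g)); apply: cvgM => //.
    by apply: cvgD => //; exact: cvg_cst.
  by rewrite -(mulr0 (L2norm f)); apply: cvgM => //; exact: cvg_cst.
move=> n; have LFf := L2B mOmega (LF n) Lf; have LGg := L2B mOmega (LG n) Lg.
have -> : ip (F n) (G n) - ip f g = ip (F n - f) (G n) + ip f (G n - g).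
  by rewrite ipBl// ipBr//; ring.
apply: le_trans (ler_normD _ _) _; apply: lerD; last exact: ip_le_norm.
apply: le_trans (ip_le_norm mOmega LFf (LG n)) _; apply: ler_wpM2l; first exact: L2norm_ge0.
by rewrite -{1}(subrK g (G n)); exact: L2normD.
Qed.

Lemma integral_sqrE f : L2 f ->
  (\int[leb]_(x in Omega) (f x ^+ 2)%:E = (L2norm f ^+ 2)%:E)%E.
Proof.
move=> Lf; rewrite -(fineK (integrable_fin_num mOmega (L2_integrable_sqr Lf))).
rewrite L2norm_sqr /Defs.ip /Rintegral; congr (fine _)%:E; by apply: eq_integral.
Qed.

Lemma L2norm_le f g : L2 f -> L2 g -> (forall x, Omega x -> f x ^+ 2 <= g x ^+ 2) ->
  L2norm f <= L2norm g.
Proof.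
move=> Lf Lg fg; rewrite ler_wsqrtr// /Defs.ip.
apply: le_Rintegral; [exact: mOmega|exact: L2_integrableM|exact: L2_integrableM|].
by move=> x Ox; rewrite -!expr2; exact: fg.
Qed.

Definition sqf f : 'rV[R]_d -> R := fun x => f x ^+ 2.
(* the square of the L^4 norm of f *)
Definition q4 f : R := L2norm (sqf f).

Lemma q4_ge0 f : 0 <= q4 f.
Proof. exact: L2norm_ge0. Qed.

Lemma L2M f g : L2 f -> L2 g -> L2 (sqf f) -> L2 (sqf g) -> L2 (f * g).
Proof.
move=> [mf _] [mg _] Lf Lg.
apply: (dominated_L2 mOmega (g := fun x => sqf f x * sqf g x)).
- exact: measurable_funM.
- exact: L2_integrableM.
- by move=> x _; rewrite exprMn.
Qed.

Lemma L2normM f g : L2 (sqf f) -> L2 (sqf g) ->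
  L2norm (f * g) <= Num.sqrt (q4 f) * Num.sqrt (q4 g).
Proof.
move=> Lf Lg; rewrite -sqrtrM ?q4_ge0// ler_wsqrtr//.
have -> : ip (f * g) (f * g) = ip (sqf f) (sqf g).
  apply: eq_Rintegral => x _; rewrite /sqf.
  by have -> : (f * g) x = f x * g x by []; ring.
by apply: le_trans (ler_norm _) _; exact: ip_le_norm.
Qed.

(** Convergence of the factors in L^4 gives convergence of the products in L^2. Expanding around f
    and g leaves only the differences and the fixed limits, so no uniform bound on the sequences is
    required. *)
Lemma cvg_L2M (F G : nat -> 'rV[R]_d -> R) f g :
  (forall n, L2 (F n - f)) -> (forall n, L2 (G n - g)) -> L2 f -> L2 g ->
  (forall n, L2 (sqf (F n - f))) -> (forall n, L2 (sqf (G n - g))) ->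
  L2 (sqf f) -> L2 (sqf g) ->
  (fun n => q4 (F n - f)) @ \oo --> (0 : R) ->
  (fun n => q4 (G n - g)) @ \oo --> (0 : R) ->
  (fun n => L2norm (F n * G n - f * g)) @ \oo --> (0 : R).
Proof.
move=> LF LG Lf Lg LF2 LG2 Lf2 Lg2 Ff Gg.
pose a n := Num.sqrt (q4 (F n - f)); pose b n := Num.sqrt (q4 (G n - g)).
have a0 : a @ \oo --> (0 : R).
  by rewrite -[X in _ --> X](@sqrtr0 R); apply: continuous_cvg => //; exact: sqrt_continuous.
have b0 : b @ \oo --> (0 : R).
  by rewrite -[X in _ --> X](@sqrtr0 R); apply: continuous_cvg => //; exact: sqrt_continuous.
apply: (@cvg_dist_le _ (fun n => a n * b n + a n * Num.sqrt (q4 g) + Num.sqrt (q4 f) * b n)); last first.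
  have -> : (0 : R) = 0 * 0 + 0 * Num.sqrt (q4 g) + Num.sqrt (q4 f) * 0 by ring.
  exact: (cvgD (cvgD (cvgM a0 b0) (cvgM a0 (cvg_cst _))) (cvgM (cvg_cst _) b0)).
move=> n; rewrite subr0 ger0_norm ?L2norm_ge0//.
have -> : F n * G n - f * g = (F n - f) * (G n - g) + (F n - f) * g + f * (G n - g) by ring.
have L1 := L2M (LF n) (LG n) (LF2 n) (LG2 n).
have L3 := L2M (LF n) Lg (LF2 n) Lg2; have L4 := L2M Lf (LG n) Lf2 (LG2 n).
have L13 := L2D mOmega L1 L3.
apply: le_trans (L2normD mOmega L13 L4) _; apply: lerD; last exact: L2normM.
by apply: le_trans (L2normD mOmega L1 L3) _; apply: lerD; exact: L2normM.
Qed.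

End L2_limits.

Section sobolev_embedding.
Variables (R : realType) (d : nat) (Omega : set 'rV[R]_d).
Hypotheses (hd : d = 2%N \/ d = 3%N) (oOmega : open Omega).
Local Notation leb := (lebesgue_rV R d).
Local Notation L2 := (L2 Omega).
Local Notation ip := (ip Omega).
Local Notation L2norm := (L2norm Omega).
Local Notation wD := (wD Omega).
Local Notation test_fun := (test_fun Omega).
Local Notation H10 := (H10 Omega).
Local Notation q4 := (q4 Omega).
Implicit Types (f g h p : 'rV[R]_d -> R) (s : seq 'I_d).
Let mOmega : measurable Omega := open_measurable_rV oOmega.

Definition gradsq f : R := \sum_i ip (wD [:: i] f) (wD [:: i] f).

Lemma gradsq_ge0 f : 0 <= gradsq f.
Proof. by apply: sumr_ge0 => i _; exact: ip_ge0. Qed.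

Lemma ip_wD_le_gradsq f i : ip (wD [:: i] f) (wD [:: i] f) <= gradsq f.
Proof. by rewrite /gradsq (bigD1 i)//= lerDl; apply: sumr_ge0 => k _; exact: ip_ge0. Qed.

Lemma H10_L2 f : H10 f -> L2 f.
Proof. by case=> -[]. Qed.

Lemma H10_weak_der f i : H10 f -> is_weak_der Omega [:: i] f (wD [:: i] f).
Proof. by case=> + _; exact: sobolev_wD. Qed.

Lemma H10_L2_wD f i : H10 f -> L2 (wD [:: i] f).
Proof. by move=> /(H10_weak_der i)[]. Qed.

Lemma H10_test p : test_fun p -> H10 p.
Proof.
move=> tp; split; first exact: sobolev_test.
exists (fun=> p) => //; apply: sobolev_norm_cvg0 => al _.
rewrite subrr (_ : (fun n => _) = cst 0); first exact: cvg_cst.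
apply/funext => n; have L0 : L2 0 by exact: L2_0.
(* [wD] of 0 is a chosen representative, known to vanish only almost everywhere. *)
have d0 : is_weak_der Omega (mseq al) 0 0.
  split => // phi tphi; have Lp := test_fun_L2 mOmega (test_fun_pder (mseq al) tphi).
  have Lphi := test_fun_L2 mOmega tphi.
  by rewrite -[X in ip X _](scale0r (0 : 'rV[R]_d -> R)) -[X in _ * ip X _](scale0r (0 : 'rV[R]_d -> R)) !ipZl// !mul0r mulr0.
have [LD _] := wDP (ex_intro _ _ d0).
rewrite (eqae_L2norm oOmega LD L0 (wD_eqae oOmega d0)).
by rewrite -(scale0r (0 : 'rV[R]_d -> R)) L2normZ// normr0 mul0r.
Qed.

Lemma H10B f g : H10 f -> H10 g -> H10 (f - g).
Proof. by move=> Hf Hg; rewrite addrC -scaleN1r; exact: H10_linear. Qed.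

Lemma wD_linear_H10 a i f g : H10 f -> H10 g ->
  eqae Omega (wD [:: i] (a *: f + g)) (a *: wD [:: i] f + wD [:: i] g).
Proof.
move=> Hf Hg; apply: wD_linear => //; [exact: H10_L2|exact: H10_L2| |].
  by exists (wD [:: i] f); exact: H10_weak_der.
by exists (wD [:: i] g); exact: H10_weak_der.
Qed.

(** Convergence of derivatives is given in two forms: classical derivatives against [wD f], for
    limits of integrals, and [gradsq] of the difference, because the L^4 bound will be applied to p
    n - f as an element of H^1_0. *)
Lemma H10_approx f : H10 f -> exists p : nat -> 'rV[R]_d -> R,
  [/\ forall n, test_fun (p n),
      (fun n => L2norm (p n - f)) @ \oo --> (0 : R),
      forall i, (fun n => L2norm (pder [:: i] (p n) - wD [:: i] f)) @ \oo --> (0 : R) &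
      (fun n => gradsq (p n - f)) @ \oo --> (0 : R)].
Proof.
move=> Hf; have [_ [p tp pf]] := Hf; exists p.
have Hpf n : H10 (p n - f) := H10B (H10_test (tp n)) Hf.
have Lpf n := H10_L2 (Hpf n).
have Df i : (fun n => L2norm (wD [:: i] (p n - f))) @ \oo --> (0 : R).
  apply: squeeze_cvgr (cvg_cst _) pf; apply: nearW => n.
  by rewrite L2norm_ge0 sobolev_norm_ge_wD.
split => //.
- apply: squeeze_cvgr (cvg_cst _) pf; apply: nearW => n.
  by rewrite L2norm_ge0; exact: (sobolev_norm_ge_L2 oOmega 1 (Lpf n)).
- move=> i; rewrite (_ : (fun n => _) = (fun n => L2norm (wD [:: i] (p n - f)))) //.
  apply/funext => n; have LD := L2B mOmega
    (test_fun_L2 mOmega (test_fun_pder [:: i] (tp n))) (H10_L2_wD i Hf).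
  have E : eqae Omega (wD [:: i] (p n - f)) (pder [:: i] (p n) - wD [:: i] f).
    have -> : p n - f = -1 *: f + p n by rewrite scaleN1r addrC.
    have -> : pder [:: i] (p n) - wD [:: i] f = -1 *: wD [:: i] f + pder [:: i] (p n).
      by rewrite scaleN1r addrC.
    apply: wD_eqae => //; apply: is_weak_der_linear => //.
    - exact: H10_L2.
    - exact: test_fun_L2.
    - exact: H10_weak_der.
    - exact: is_weak_der_test1.
  exact/esym/(eqae_L2norm oOmega (H10_L2_wD i (Hpf n)) LD E).
- rewrite /gradsq; elim: (index_enum _) => [|i s IHs].
    by under eq_fun do rewrite big_nil; exact: cvg_cst.
  rewrite -[X in _ --> X]addr0; under eq_fun do rewrite big_cons.
  apply: cvgD; last exact: IHs.
  rewrite -[X in _ --> X](mulr0 0); under eq_fun do rewrite -(L2norm_sqr Omega (wD _ _)) expr2.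
  exact: (cvgM (Df i) (Df i)).
Qed.

Lemma Rintegral_cc_sum (I : eqType) (s : seq I) (F : I -> 'rV[R]_d -> R) :
  (forall i, cc (F i)) ->
  \int[leb]_x (\sum_(i <- s) F i x) = \sum_(i <- s) \int[leb]_x F i x.
Proof.
move=> cF; elim: s => [|i s IHs].
  rewrite big_nil; under eq_Rintegral do rewrite big_nil.
  by rewrite Rintegral_cst// mul0r.
rewrite big_cons; under eq_Rintegral do rewrite big_cons.
rewrite RintegralD//; [by rewrite IHs|exact: cc_integrable|].
by apply: cc_integrable; exact: cc_sum.
Qed.

Lemma pow4_test (de : R) : 0 < de -> exists2 C, 0 <= C & forall p, test_fun p ->
  q4 p <= de * (\sum_i ip (pder [:: i] p) (pder [:: i] p)) + C * ip p p.
Proof.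
move=> de0; have [C C0 pC] := pow4_C1c_le hd de0; exists C => // p tp.
have Cp := test_fun_C1c tp; have := pC p Cp.
have -> : \int[leb]_x grad2 p x = \sum_i ip (pder [:: i] p) (pder [:: i] p).
  rewrite /grad2 Rintegral_cc_sum; last by move=> i; apply: ccX; exact: C1c_cc_derive.
  apply: eq_bigr => i _; rewrite ip_test_setT; last exact: test_fun_pder.
  by apply: eq_Rintegral => x _; rewrite -expr2.
have -> : \int[leb]_x p x ^+ 2 = ip p p.
  by rewrite ip_test_setT//; apply: eq_Rintegral => x _; rewrite -expr2.
have -> : \int[leb]_x p x ^+ 4 = q4 p ^+ 2.
  rewrite L2norm_sqr [RHS]/Defs.ip [RHS]Rintegral_mkcond; apply: eq_Rintegral => x _.
  rewrite patchE; case: ifPn => [_|]; first by rewrite /sqf -exprD.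
  by rewrite notin_setE => Ox; rewrite (test_fun_outside tp Ox) expr0n.
rewrite ler_pXn2r ?nnegrE ?q4_ge0//.
by rewrite addr_ge0 ?mulr_ge0 ?ip_ge0 ?(ltW de0)//; apply: sumr_ge0 => i _; exact: ip_ge0.
Qed.

Lemma cvg_gradsq_test (p : nat -> 'rV[R]_d -> R) f : H10 f -> (forall n, test_fun (p n)) ->
  (forall i, (fun n => L2norm (pder [:: i] (p n) - wD [:: i] f)) @ \oo --> (0 : R)) ->
  (fun n => \sum_i ip (pder [:: i] (p n)) (pder [:: i] (p n))) @ \oo --> gradsq f.
Proof.
move=> Hf tp Dpf; rewrite /gradsq; elim: (index_enum _) => [|i s IHs].
  by rewrite big_nil; under eq_fun do rewrite big_nil; exact: cvg_cst.
rewrite big_cons; under eq_fun do rewrite big_cons.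
apply: cvgD; last exact: IHs.
have LD n := test_fun_L2 mOmega (test_fun_pder [:: i] (tp n)).
exact: (cvg_ip mOmega LD LD (H10_L2_wD i Hf) (H10_L2_wD i Hf) (Dpf i) (Dpf i)).
Qed.

Lemma measurable_trunc_comp N f : measurable_fun Omega f ->
  measurable_fun Omega (fun x => trunc N (f x)).
Proof. by move=> mf; apply: measurableT_comp mf; exact: measurable_trunc. Qed.

Lemma trunc_L2 N f : 0 <= N -> L2 f -> L2 (fun x => trunc N (f x)).
Proof.
move=> N0 Lf; have LN := L2Z mOmega N Lf.
apply: (dominated_L2 mOmega (g := fun x => (N *: f) x * (N *: f) x)).
- by apply: measurable_trunc_comp; exact: L2_measurable.
- exact: L2_integrableM.
- by move=> x _; have -> : (N *: f) x = N * f x by []; rewrite -expr2 [leRHS]exprMn; exact: trunc_sqr_le_N.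
Qed.

Lemma sqf_test p : test_fun p -> L2 (sqf p).
Proof.
move=> tp; apply: L2_subset => //; apply: cc_L2.
exact: (ccX 1 (C1c_cc (test_fun_C1c tp))).
Qed.

(** At fixed [N] the bound for test functions passes to the limit, with an error of at most 2 N
    times the L^2 distance to the approximant; the resulting bound no longer involves [N]. *)
Lemma L2norm_trunc_le (de C : R) f N : 0 < de -> 0 <= C -> 0 <= N ->
  (forall p, test_fun p ->
    q4 p <= de * (\sum_i ip (pder [:: i] p) (pder [:: i] p)) + C * ip p p) ->
  H10 f -> L2norm (fun x => trunc N (f x)) <= de * gradsq f + C * ip f f.
Proof.
move=> de0 C0 N0 pC Hf; have [p [tp pf Dpf _]] := H10_approx Hf.
have Lf := H10_L2 Hf; have Lp n := test_fun_L2 mOmega (tp n).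
have Gp := cvg_gradsq_test Hf tp Dpf.
have pp := cvg_ip mOmega Lp Lp Lf Lf pf pf.
have LTf := trunc_L2 N0 Lf.
have rhs_cvg : (fun n => de * (\sum_i ip (pder [:: i] (p n)) (pder [:: i] (p n))) + C * ip (p n) (p n)
    + 2 * N * L2norm (p n - f)) @ \oo --> de * gradsq f + C * ip f f + 2 * N * 0.
  by apply: cvgD; [apply: cvgD|]; (apply: cvgM; [exact: cvg_cst|]).
rewrite mulr0 addr0 in rhs_cvg.
apply: (cvgr_to_ge rhs_cvg); apply: nearW => n.
have LTp := trunc_L2 N0 (Lp n).
pose Tf : 'rV[R]_d -> R := fun x => trunc N (f x).
pose Tp : 'rV[R]_d -> R := fun x => trunc N (p n x).
rewrite -/Tf -(subrK Tp Tf) addrC; apply: le_trans (L2normD mOmega LTp (L2B mOmega LTf LTp)) _.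
apply: lerD.
  apply: le_trans (pC _ (tp n)); apply: L2norm_le => //; first exact: sqf_test.
  by move=> x _; rewrite [leRHS]expr2; exact: trunc_sqr_le.
have L2N : L2 ((2 * N) *: (p n - f)) by apply: L2Z => //; exact: L2B.
have -> : 2 * N * L2norm (p n - f) = L2norm ((2 * N) *: (p n - f)).
  by rewrite L2normZ ?ger0_norm ?mulr_ge0//; exact: L2B.
apply: L2norm_le => //; first exact: L2B.
move=> x _; rewrite -(real_normK (num_real ((Tf - Tp) x))) -[in leRHS]real_normK ?num_real//.
rewrite ler_pXn2r ?nnegrE//.
have -> : (Tf - Tp) x = trunc N (f x) - trunc N (p n x) by [].
have -> : ((2 * N) *: (p n - f)) x = 2 * N * (p n x - f x) by [].
rewrite [leRHS]normrM [X in _ <= X * _]ger0_norm ?mulr_ge0// [X in _ <= _ * X]distrC.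
exact: trunc_lipschitz.
Qed.

(** Monotone convergence in the truncation level. C is chosen before f and [de] is arbitrary, so the
    L^4 norm can be absorbed by a gradient term. *)
Lemma H10_q4_le (de : R) : 0 < de -> exists2 C, 0 <= C & forall f, H10 f ->
  L2 (sqf f) /\ q4 f <= de * gradsq f + C * ip f f.
Proof.
move=> de0; have [C C0 pC] := pow4_test de0; exists C => // f Hf.
have Lf := H10_L2 Hf; have [mf _] := Lf.
pose B := de * gradsq f + C * ip f f.
have B0 : 0 <= B by rewrite addr_ge0 ?mulr_ge0 ?gradsq_ge0 ?ip_ge0 ?(ltW de0).
have TN (n : nat) := L2norm_trunc_le de0 C0 (ler0n R n) pC Hf.
have int_le : (\int[leb]_(x in Omega) (sqf f x ^+ 2)%:E <= (B ^+ 2)%:E)%E.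
  have mono := cvg_monotone_convergence (mu := leb) mOmega
    (g' := fun n x => (trunc n%:R (f x) ^+ 2)%:E).
  have {mono} := mono _ _ _.
  have -> : (\int[leb]_(x in Omega) (sqf f x ^+ 2)%:E =
    \int[leb]_(x in Omega) (limn (fun n => (trunc n%:R (f x) ^+ 2)%:E)))%E.
    apply: eq_integral => x _; apply/esym/cvg_lim => //.
    (* At each x the truncations are stationary once n >= |f x|. *)
    apply: cvg_near_cst; near=> n; rewrite trunc_sqrE -?expr2//.
    near: n; exact: nbhs_infty_ger.
  move=> h; apply: (cvge_to_le (h _ _ _)).
  - by move=> n; apply/measurable_EFinP/measurable_funX; exact: measurable_trunc_comp.
  - by move=> n x _; rewrite lee_fin sqr_ge0.
  - by move=> x _ m n mn; rewrite lee_fin trunc_sqr_nondecreasing// ler_nat.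
  apply: nearW => n.
  have Ln := trunc_L2 (ler0n R n) Lf.
  rewrite (integral_sqrE mOmega Ln) lee_fin.
  by rewrite ler_pXn2r ?nnegrE ?L2norm_ge0// TN.
have L2s : L2 (sqf f).
  by split; [exact: measurable_funX|exact: le_lt_trans int_le (ltry _)].
split => //; rewrite -(@ler_pXn2r _ 2) ?nnegrE ?q4_ge0//.
by rewrite (integral_sqrE mOmega L2s) lee_fin in int_le.
Unshelve. all: by end_near. Qed.

End sobolev_embedding.

(** * The trilinear form *)

Section real_inequalities.
Variable R : realType.
Implicit Types (t n x y s L : R).

Lemma prod3_le t n x y s : t <= n * (x * y) -> n <= s -> 0 <= s -> 0 <= x -> 0 <= y ->
  t <= s / 2 * (x ^+ 2 + y ^+ 2).
Proof.
move=> tn ns s0 x0 y0; apply: le_trans tn _.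
apply: (@le_trans _ _ (s * (x * y))); first by rewrite ler_wpM2r// mulr_ge0.
rewrite -mulrA; apply: ler_wpM2l => //.
by have := sqr_ge0 (x - y); rewrite sqrrB; lra.
Qed.

Lemma prod3_young (eta Q G : R) t n x y : 0 < eta -> t <= n * (x * y) ->
  n ^+ 2 <= G -> x ^+ 2 <= Q -> 2^-1 * t <= eta / 2 * G + Q / (8 * eta) * y ^+ 2.
Proof.
move=> eta0 tn nG xQ.
(* Twice the right-hand side is n x y plus the three nonnegative terms e1, e2 and e3. *)
have e1 : 0 <= eta * (G - n ^+ 2) by rewrite mulr_ge0 ?subr_ge0// ltW.
have i0 : 0 <= (4 * eta)^-1 by rewrite invr_ge0 mulr_ge0// ltW.
have e2 : 0 <= (4 * eta)^-1 * ((Q - x ^+ 2) * y ^+ 2).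
  by apply: (mulr_ge0 i0); apply: mulr_ge0; [rewrite subr_ge0|exact: sqr_ge0].
have e3 : 0 <= (4 * eta)^-1 * (2 * eta * n - x * y) ^+ 2 := mulr_ge0 i0 (sqr_ge0 _).
have -> : eta / 2 * G + Q / (8 * eta) * y ^+ 2 = 2^-1 * (n * (x * y) + eta * (G - n ^+ 2) +
   (4 * eta)^-1 * ((Q - x ^+ 2) * y ^+ 2) + (4 * eta)^-1 * (2 * eta * n - x * y) ^+ 2).
  by field; rewrite gt_eqF.
by rewrite ler_pM2l//; lra.
Qed.

(** Gathers the L^4 quantities [qa] and [qc] under the common weight [L] before splitting them. [Ga]
    and [Va] stand for the squared gradient and L^2 norms of the convecting field, [Gc] and [Vc] for
    those of the test field. *)
Lemma trilinear_sum_le (s Q L dl C eta qa qc Ga Gc Va Vc : R) :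
  L = s + Q + 1 -> 0 <= s -> 0 <= Q -> 0 <= qa -> 0 <= qc ->
  qa <= dl * Ga + C * Va -> qc <= dl * Gc + C * Vc ->
  s * (qa + qc) + (eta / 2 * Ga + Q * qc) <=
  (eta / 2 + L * dl) * Ga + L * dl * Gc + L * C * (Va + Vc).
Proof.
move=> LE s0 Q0 qa0 qc0 qaE qcE.
have L0 : 0 <= L by rewrite LE !addr_ge0.
have h1 := ler_wpM2l L0 qaE; have h2 := ler_wpM2l L0 qcE.
have h3 : 0 <= Q * qa by exact: mulr_ge0.
by rewrite LE in h1 h2 *; nra.
Qed.

Lemma trilinear_total_le (de D L C A B V : R) : 0 < D -> 0 < L -> 0 <= de * B ->
  ((de / D / 2 + L * (de / (2 * D * L))) * A + L * (de / (2 * D * L)) * B + L * C * V) * D <=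
  de * (A + B) + D * (L * C) * V.
Proof.
move=> D0 L0 deB.
have -> : ((de / D / 2 + L * (de / (2 * D * L))) * A + L * (de / (2 * D * L)) * B + L * C * V) * D =
  de * A + 2^-1 * (de * B) + D * (L * C) * V by field; rewrite !gt_eqF.
by rewrite lerD2r mulrDr lerD2l; lra.
Qed.

Lemma split_sum_half (a b c e : R) : a + b + 2^-1 * (c + e) = a + 2^-1 * c + (b + 2^-1 * e).
Proof. by ring. Qed.

End real_inequalities.

Section trilinear.
Variables (R : realType) (d : nat) (Omega : set 'rV[R]_d).
Hypotheses (hd : d = 2%N \/ d = 3%N) (oOmega : open Omega).
Local Notation leb := (lebesgue_rV R d).
Local Notation L2 := (L2 Omega).
Local Notation ip := (ip Omega).
Local Notation L2norm := (L2norm Omega).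
Local Notation wD := (wD Omega).
Local Notation test_fun := (test_fun Omega).
Local Notation H10 := (H10 Omega).
Local Notation q4 := (q4 Omega).
Local Notation gradsq := (gradsq Omega).
Implicit Types (a b c f g h p : 'rV[R]_d -> R) (s : seq 'I_d).
Let mOmega : measurable Omega := open_measurable_rV oOmega.

Lemma H10_sqf f : H10 f -> L2 (sqf f).
Proof. by have [C _ h] := H10_q4_le hd oOmega ltr01 => /h[]. Qed.

Lemma H10M a c : H10 a -> H10 c -> L2 (a * c).
Proof.
by move=> Ha Hc; apply: L2M => //; [exact: H10_L2|exact: H10_L2|exact: H10_sqf|exact: H10_sqf].
Qed.

(** The derivative goes in the middle slot, where L^2 suffices; the outer slots are controlled in
    L^4. *)
Definition tri a b c : R := ip b (a * c).

Lemma tri_le a b c : H10 a -> L2 b -> H10 c ->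
  `|tri a b c| <= L2norm b * (Num.sqrt (q4 a) * Num.sqrt (q4 c)).
Proof.
move=> Ha Lb Hc; apply: le_trans (ip_le_norm mOmega Lb (H10M Ha Hc)) _.
apply: ler_wpM2l; first exact: L2norm_ge0.
by apply: L2normM => //; exact: H10_sqf.
Qed.

Lemma cvg_q4 (p : nat -> 'rV[R]_d -> R) f : (forall n, H10 (p n - f)) ->
  (fun n => L2norm (p n - f)) @ \oo --> (0 : R) ->
  (fun n => gradsq (p n - f)) @ \oo --> (0 : R) ->
  (fun n => q4 (p n - f)) @ \oo --> (0 : R).
Proof.
move=> Hpf pf Gpf; have [C _ h] := H10_q4_le hd oOmega ltr01.
apply: (@cvg_dist_le _ _ (fun n => 1 * gradsq (p n - f) + C * (L2norm (p n - f) * L2norm (p n - f)))).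
  move=> n; rewrite subr0 ger0_norm ?q4_ge0// -expr2 L2norm_sqr.
  by have [] := h _ (Hpf n).
have -> : (0 : R) = 1 * 0 + C * (0 * 0) by ring.
exact: (cvgD (cvgM (cvg_cst _) Gpf) (cvgM (cvg_cst _) (cvgM pf pf))).
Qed.

(** This is half the integral of D_i (p r^2) = 2 p r D_i r + r^2 D_i p, which is zero. The
    half-divergence correction in [btilde] is exactly what supplies the second term. *)
Lemma tri_skew_test p r i : test_fun p -> test_fun r ->
  tri p (pder [:: i] r) r + 2^-1 * tri r (pder [:: i] p) r = 0.
Proof.
move=> tp tr; have Cp := test_fun_C1c tp; have Cr := test_fun_C1c tr.
have tDp := test_fun_pder [:: i] tp; have tDr := test_fun_pder [:: i] tr.
rewrite /tri !ip_test_setT//.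
have cD f g k : test_fun f -> test_fun g -> test_fun k ->
    (leb).-integrable setT (EFin \o (fun x => f x * (g * k) x)).
  move=> /test_fun_C1c/C1c_cc cf /test_fun_continuous cg /test_fun_continuous ck.
  by apply: cc_integrable; apply: ccM => // x; exact: (cvgM (cg x) (ck x)).
have i1 := cD _ _ _ tDr tp tr; have i2 := cD _ _ _ tDp tr tr.
have i3 : (leb).-integrable setT (EFin \o (fun x => 2^-1 * (pder [:: i] p x * (r * r) x))).
  exact: (integrableZl measurableT (2^-1) i2).
rewrite /Defs.ip -RintegralZl// -RintegralD//.
have := integral_derive_eq0 i (C1cM (C1cM Cp Cr) Cr); rewrite /Rintegral => I0.
have [_ dp _ _] := Cp; have [_ dr _ _] := Cr.
rewrite -[RHS](mulr0 (2^-1 : R)) -[X in _ = _ * X]/(fine 0%E) -I0 -/(Rintegral _ _ _).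
rewrite -[X in _ = _ * X]/(\int[leb]_x ('D_(delta_mx ord0 i) (p * r * r) x)) -RintegralZl//; last first.
  exact: (C1c_integrable_derive i (C1cM (C1cM Cp Cr) Cr)).
apply: eq_Rintegral => x _; rewrite deriveM//; last exact: derivableM.
rewrite deriveM// /GRing.scale /= /pder /=.
have -> : (p * r) x = p x * r x by [].
have -> : (r * r) x = r x * r x by [].
by field.
Qed.

(** Density: the derivatives converge in L^2, and the products p r and r r converge in L^2 because
    their factors converge in L^4. *)
Lemma tri_skew a c i : H10 a -> H10 c ->
  tri a (wD [:: i] c) c + 2^-1 * tri c (wD [:: i] a) c = 0.
Proof.
move=> Ha Hc; have [p [tp pa Dpa Gpa]] := H10_approx oOmega Ha.
have [r [tr rc Drc Grc]] := H10_approx oOmega Hc.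
have Hp n := H10_test oOmega (tp n); have Hr n := H10_test oOmega (tr n).
have Hpa n := H10B oOmega (Hp n) Ha; have Hrc n := H10B oOmega (Hr n) Hc.
have qpa := cvg_q4 Hpa pa Gpa; have qrc := cvg_q4 Hrc rc Grc.
have La := H10_L2 Ha; have Lc := H10_L2 Hc.
have L2a := H10_sqf Ha; have L2c := H10_sqf Hc.
have prac := cvg_L2M mOmega (fun n => H10_L2 (Hpa n)) (fun n => H10_L2 (Hrc n)) La Lc
  (fun n => H10_sqf (Hpa n)) (fun n => H10_sqf (Hrc n)) L2a L2c qpa qrc.
have rrcc := cvg_L2M mOmega (fun n => H10_L2 (Hrc n)) (fun n => H10_L2 (Hrc n)) Lc Lc
  (fun n => H10_sqf (Hrc n)) (fun n => H10_sqf (Hrc n)) L2c L2c qrc qrc.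
have LDp n := test_fun_L2 mOmega (test_fun_pder [:: i] (tp n)).
have LDr n := test_fun_L2 mOmega (test_fun_pder [:: i] (tr n)).
have c1 := cvg_ip mOmega LDr (fun n => H10M (Hp n) (Hr n)) (H10_L2_wD i Hc) (H10M Ha Hc) (Drc i) prac.
have c2 := cvg_ip mOmega LDp (fun n => H10M (Hr n) (Hr n)) (H10_L2_wD i Ha) (H10M Hc Hc) (Dpa i) rrcc.
have cs : (fun n => tri (p n) (pder [:: i] (r n)) (r n) + 2^-1 * tri (r n) (pder [:: i] (p n)) (r n)) @ \oo
    --> tri a (wD [:: i] c) c + 2^-1 * tri c (wD [:: i] a) c.
  exact: (cvgD c1 (cvgM (cvg_cst _) c2)).
apply: (cvg_unique _ cs) => //.
rewrite (_ : (fun n => _) = cst 0); first exact: cvg_cst.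
by apply/funext => n; exact: tri_skew_test.
Qed.

Lemma Rintegral_sum (I : eqType) (s : seq I) (F : I -> 'rV[R]_d -> R) :
  (forall i, leb.-integrable Omega (EFin \o F i)) ->
  leb.-integrable Omega (EFin \o (fun x => \sum_(i <- s) F i x)) /\
  \int[leb]_(x in Omega) (\sum_(i <- s) F i x) = \sum_(i <- s) \int[leb]_(x in Omega) F i x.
Proof.
move=> iF; elim: s => [|i s [IHi IHs]].
  rewrite big_nil (_ : (fun x => _) = cst 0); last by apply/funext => x; rewrite big_nil.
  split; last by rewrite Rintegral_cst// mul0r.
  exact: integrable0.
rewrite big_cons (_ : (fun x => _) = (fun x => F i x + \sum_(i <- s) F i x)); last first.
  by apply/funext => x; rewrite big_cons.
split; first exact: (integrableD mOmega (iF i) IHi).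
by rewrite RintegralD// IHs.
Qed.

Local Notation field := ('I_d -> 'rV[R]_d -> R).
Local Notation X := (X Omega).
Implicit Types (u v z w : field).

Lemma btildeE u v z : X u -> X v -> X z -> btilde Omega u v z =
  \sum_i \sum_j (tri (u j) (wD [:: j] (v i)) (z i) + 2^-1 * tri (v i) (wD [:: j] (u j)) (z i)).
Proof.
move=> Xu Xv Xz; rewrite /btilde /vip mulr_sumr -big_split/=; apply: eq_bigr => i _.
rewrite big_split/= -mulr_sumr; congr (_ + _ * _).
  have [_ <-] := @Rintegral_sum _ (index_enum 'I_d)
    (fun j x => wD [:: j] (v i) x * (u j * z i) x)
    (fun j => L2_integrableM mOmega (H10_L2_wD j (Xv i)) (H10M (Xu j) (Xz i))).
  apply: eq_Rintegral => x _; rewrite /adv mulr_suml; apply: eq_bigr => j _.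
  by have -> : (u j * z i) x = u j x * z i x by []; ring.
have [_ <-] := @Rintegral_sum _ (index_enum 'I_d)
    (fun j x => wD [:: j] (u j) x * (v i * z i) x)
    (fun j => L2_integrableM mOmega (H10_L2_wD j (Xu j)) (H10M (Xv i) (Xz i))).
apply: eq_Rintegral => x _; rewrite /div -mulrA mulr_suml; apply: eq_bigr => j _.
by have -> : (v i * z i) x = v i x * z i x by [].
Qed.

Lemma btilde_skew u v : X u -> X v -> btilde Omega u v v = 0.
Proof.
move=> Xu Xv; rewrite btildeE// big1// => i _; rewrite big1// => j _.
exact: tri_skew (Xu j) (Xv i).
Qed.

Lemma X_linear (k : R) u v : X u -> X v -> X (k *: u + v).
Proof. by move=> Xu Xv i; exact: (H10_linear oOmega k (Xu i) (Xv i)). Qed.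

Lemma XD u v : X u -> X v -> X (u + v).
Proof. by move=> Xu Xv; rewrite -[u]scale1r; exact: X_linear. Qed.

Lemma XB u v : X u -> X v -> X (u - v).
Proof. by move=> Xu Xv; rewrite addrC -scaleN1r; exact: X_linear. Qed.

Lemma wD_XD u v i j : X u -> X v ->
  eqae Omega (wD [:: j] ((u + v) i)) (wD [:: j] (u i) + wD [:: j] (v i)).
Proof.
move=> Xu Xv; have := wD_linear_H10 oOmega 1 j (Xu i) (Xv i).
by rewrite !scale1r.
Qed.

Lemma btildeDm u v v' z : X u -> X v -> X v' -> X z ->
  btilde Omega u (v + v') z = btilde Omega u v z + btilde Omega u v' z.
Proof.
move=> Xu Xv Xv' Xz.
rewrite (btildeE Xu (XD Xv Xv') Xz) (btildeE Xu Xv Xz) (btildeE Xu Xv' Xz).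
rewrite -big_split/=; apply: eq_bigr => i _; rewrite -big_split/=; apply: eq_bigr => j _.
have Lv := H10_L2_wD j (Xv i); have Lv' := H10_L2_wD j (Xv' i).
have Lu := H10_L2_wD j (Xu j); have LD := L2D mOmega Lv Lv'.
have Lvv := H10_L2_wD j (XD Xv Xv' i).
have Lp := H10M (Xu j) (Xz i).
have -> : tri (u j) (wD [:: j] ((v + v') i)) (z i) =
    tri (u j) (wD [:: j] (v i)) (z i) + tri (u j) (wD [:: j] (v' i)) (z i).
  rewrite /tri -ipDl//; apply: (eqae_ip oOmega Lvv LD Lp Lp); first exact: wD_XD.
  exact: eqae_refl.
have -> : tri ((v + v') i) (wD [:: j] (u j)) (z i) =
    tri (v i) (wD [:: j] (u j)) (z i) + tri (v' i) (wD [:: j] (u j)) (z i).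
  rewrite /tri -ipDr//; [|exact: (H10M (Xv i) (Xz i))|exact: (H10M (Xv' i) (Xz i))].
  by have -> : (v + v') i * z i = v i * z i + v' i * z i by rewrite -mulrDl.
exact: split_sum_half.
Qed.

Lemma gip_gradsq u : gip Omega u u = \sum_i gradsq (u i).
Proof. by []. Qed.

Lemma gradsq_le_gip u i : gradsq (u i) <= gip Omega u u.
Proof.
rewrite gip_gradsq (bigD1 i)//= lerDl.
by apply: sumr_ge0 => j _; exact: gradsq_ge0.
Qed.

Lemma ip_le_vip u i : ip (u i) (u i) <= vip Omega u u.
Proof. by rewrite /vip (bigD1 i)//= lerDl; apply: sumr_ge0 => j _; exact: ip_ge0. Qed.

Lemma ip_wD_le_gip u i j : ip (wD [:: j] (u i)) (wD [:: j] (u i)) <= gip Omega u u.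
Proof. exact: le_trans (ip_wD_le_gradsq _ _ _) (gradsq_le_gip u i). Qed.

(** When w is differentiated, its derivative is bounded in L^2 and a, c are taken in L^4; when a is
    differentiated, w is bounded in L^4 and Young's inequality separates D_j a from c. The L^4 norms
    of a and c are then split with a small gradient weight, so C depends on [de] and [M] but not on
    the fields. *)
Lemma btilde_le (de M : R) : 0 < de -> 0 <= M -> exists2 C, 0 <= C &
  forall a w c : field, X a -> X w -> X c -> vip Omega w w <= M -> gip Omega w w <= M ->
  `|btilde Omega a w c| <= de * (gip Omega a a + gip Omega c c) +
    C * (vip Omega a a + vip Omega c c).
Proof.
move=> de0 M0; have [C1 C10 h1] := H10_q4_le hd oOmega ltr01.
(* D counts the pairs (i, j), and each pair gets the share de / D: below, eta / 2 and L * dl both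
   equal de / (2 D). The summand 1 in [L] keeps it positive. *)
pose D : R := d%:R * d%:R.
have D0 : 0 < D by rewrite mulr_gt0// ltr0n; case: hd => ->.
pose Q : R := (1 + C1) * M; have Q0 : 0 <= Q by rewrite mulr_ge0// addr_ge0.
pose eta : R := de / D; have eta0 : 0 < eta by rewrite divr_gt0.
pose s : R := Num.sqrt M / 2; have s0 : 0 <= s by rewrite divr_ge0// sqrtr_ge0.
have Qeta : 0 <= Q / (8 * eta) by rewrite divr_ge0// mulr_ge0// ltW.
pose L : R := s + Q / (8 * eta) + 1; have L0 : 0 < L by rewrite ltr_wpDl// addr_ge0.
pose dl : R := de / (2 * D * L).
have dl0 : 0 < dl.
  by apply: divr_gt0 => //; apply: mulr_gt0 => //; exact: mulr_gt0.
have [C2 C20 h2] := H10_q4_le hd oOmega dl0.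
exists (D * (L * C2)); first by rewrite !mulr_ge0// ltW.
move=> a w c Xa Xw Xc wM gM.
pose T : R := (eta / 2 + L * dl) * gip Omega a a + L * dl * gip Omega c c +
   L * C2 * (vip Omega a a + vip Omega c c).
have bound i j : `|tri (a j) (wD [:: j] (w i)) (c i) + 2^-1 * tri (w i) (wD [:: j] (a j)) (c i)| <= T.
  have LDw := H10_L2_wD j (Xw i); have LDa := H10_L2_wD j (Xa j).
  have [_ qa] := h2 _ (Xa j); have [_ qc] := h2 _ (Xc i); have [_ qw] := h1 _ (Xw i).
  have qa0 := q4_ge0 Omega (a j); have qc0 := q4_ge0 Omega (c i); have qw0 := q4_ge0 Omega (w i).
  have gw := gradsq_le_gip w i; have vw := ip_le_vip w i.
  have ga := gradsq_le_gip a j; have va := ip_le_vip a j.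
  have gc := gradsq_le_gip c i; have vc := ip_le_vip c i.
  have t1 : `|tri (a j) (wD [:: j] (w i)) (c i)| <= s * (q4 (a j) + q4 (c i)).
    rewrite -(sqr_sqrtr qa0) -(sqr_sqrtr qc0).
    apply: (prod3_le (tri_le (Xa j) LDw (Xc i))); rewrite ?sqrtr_ge0//.
    by rewrite ler_wsqrtr// (le_trans (ip_wD_le_gip w i j)).
  have t2 : `|2^-1 * tri (w i) (wD [:: j] (a j)) (c i)| <=
      eta / 2 * gip Omega a a + Q / (8 * eta) * q4 (c i).
    rewrite normrM ger0_norm// -(sqr_sqrtr qc0).
    apply: (prod3_young eta0 (tri_le (Xw i) LDa (Xc i))).
      by rewrite L2norm_sqr ip_wD_le_gip.
    rewrite sqr_sqrtr// /Q mulrDl; apply: le_trans qw _; rewrite !mul1r.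
    exact: lerD (le_trans gw gM) (ler_wpM2l C10 (le_trans vw wM)).
  apply: le_trans (ler_normD _ _) _; apply: le_trans (lerD t1 t2) _.
  apply: trilinear_sum_le => //.
    exact: le_trans qa (lerD (ler_wpM2l (ltW dl0) ga) (ler_wpM2l C20 va)).
  exact: le_trans qc (lerD (ler_wpM2l (ltW dl0) gc) (ler_wpM2l C20 vc)).
rewrite btildeE//; apply: le_trans (ler_norm_sum _ _ _) _.
apply: (@le_trans _ _ (\sum_(i < d) \sum_(j < d) T)).
  apply: ler_sum => i _; apply: le_trans (ler_norm_sum _ _ _) _.
  by apply: ler_sum => j _; exact: bound.
rewrite !sumr_const !card_ord -mulrnA -mulr_natr natrM -/D /T.
apply: trilinear_total_le => //.
by rewrite mulr_ge0 ?(ltW de0)// gip_gradsq; apply: sumr_ge0 => i _; exact: gradsq_ge0.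
Qed.

End trilinear.

(** * Vector fields *)

Section bilinear_forms.
Variables (R : realType) (V : lmodType R) (S : set V) (B : V -> V -> R).
Hypothesis SL : forall a u v, S u -> S v -> S (a *: u + v).
Hypothesis BL : forall a u v w, S u -> S v -> S w ->
  B (a *: u + v) w = a * B u w + B v w.
Hypothesis BC : forall u v, S u -> S v -> B u v = B v u.
Hypothesis B0 : forall u, S u -> 0 <= B u u.

Lemma formB u v w : S u -> S v -> S w -> B (u - v) w = B u w - B v w.
Proof. by move=> Su Sv Sw; rewrite addrC -scaleN1r BL// mulN1r addrC. Qed.

(** [S] is only known to be closed under a u + v and may not contain 0 a priori, so a u is written
    as (a - 1) u + u. *)
Lemma formZ a u w : S u -> S w -> B (a *: u) w = a * B u w.
Proof.
move=> Su Sw; rewrite -[a *: u](subrK u) -scaleN1r addrC.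
have -> : u + (a *: u + -1 *: u) = (a - 1) *: u + u by rewrite addrC scalerBl scaleN1r scale1r.
by rewrite BL// mulrBl mul1r subrK.
Qed.

Lemma form_young t u v : 0 < t -> S u -> S v -> `|B u v| <= t * B u u + (4 * t)^-1 * B v v.
Proof.
move=> t0 Su Sv; apply: le_trans (semidefinite_le SL BL BC B0 Su Sv) _.
rewrite -[in leRHS](sqr_sqrtr (B0 Su)) -[in leRHS](sqr_sqrtr (B0 Sv)).
move: (Num.sqrt (B u u)) (Num.sqrt (B v v)) => x y.
have i0 : 0 <= (4 * t)^-1 by rewrite invr_ge0 mulr_ge0// ltW.
rewrite -subr_ge0.
have -> : t * x ^+ 2 + (4 * t)^-1 * y ^+ 2 - x * y = (4 * t)^-1 * (2 * t * x - y) ^+ 2.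
  by field; rewrite gt_eqF.
exact: mulr_ge0 i0 (sqr_ge0 _).
Qed.

Lemma formB_sqr u v : S u -> S v -> B (u - v) (u - v) = B u u - 2 * B u v + B v v.
Proof.
move=> Su Sv; have Suv : S (u - v) by rewrite addrC -scaleN1r; exact: SL.
rewrite formB// BC// [B v _]BC// !formB// (BC Sv Su).
by ring.
Qed.

End bilinear_forms.

Section vector_fields.
Variables (R : realType) (d : nat) (Omega : set 'rV[R]_d).
Hypothesis oOmega : open Omega.
Local Notation L2 := (L2 Omega).
Local Notation ip := (ip Omega).
Local Notation wD := (wD Omega).
Local Notation field := ('I_d -> 'rV[R]_d -> R).
Local Notation X := (X Omega).
Local Notation vL2 := (vL2 Omega).
Local Notation vip := (vip Omega).
Local Notation gip := (gip Omega).
Local Notation vL2norm := (vL2norm Omega).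
Local Notation gradnorm := (gradnorm Omega).
Local Notation div := (div Omega).
Implicit Types (u v z w : field).
Let mOmega : measurable Omega := open_measurable_rV oOmega.

Lemma X_vL2 : X `<=` vL2.
Proof. by move=> u Xu i; exact: (H10_L2 (Xu i)). Qed.

Lemma vL2_linear (a : R) u v : vL2 u -> vL2 v -> vL2 (a *: u + v).
Proof. by move=> Lu Lv i; apply: (L2D mOmega) => //; exact: L2Z. Qed.

Lemma vL2B u v : vL2 u -> vL2 v -> vL2 (u - v).
Proof. by move=> Lu Lv; rewrite addrC -scaleN1r; exact: vL2_linear. Qed.

Lemma vip_linear (a : R) u v z : vL2 u -> vL2 v -> vL2 z ->
  vip (a *: u + v) z = a * vip u z + vip v z.
Proof.
move=> Lu Lv Lz; rewrite /Defs.vip mulr_sumr -big_split/=; apply: eq_bigr => i _.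
rewrite -(ipZl mOmega a (Lu i) (Lz i)).
exact: (ipDl mOmega (L2Z mOmega a (Lu i)) (Lv i) (Lz i)).
Qed.

Lemma vipC u v : vip u v = vip v u.
Proof. by apply: eq_bigr => i _; exact: ipC. Qed.

Lemma vip_ge0 u : 0 <= vip u u.
Proof. by apply: sumr_ge0 => i _; exact: ip_ge0. Qed.

Lemma vL2norm_ge0 u : 0 <= vL2norm u.
Proof. exact: sqrtr_ge0. Qed.

Lemma vL2norm_sqr u : vL2norm u ^+ 2 = vip u u.
Proof. exact: sqr_sqrtr (vip_ge0 u). Qed.

Lemma vipB u v z : vL2 u -> vL2 v -> vL2 z -> vip (u - v) z = vip u z - vip v z.
Proof. exact: (formB (S := vL2) vip_linear). Qed.

Lemma vip_young t u v : 0 < t -> vL2 u -> vL2 v -> `|vip u v| <= t * vip u u + (4 * t)^-1 * vip v v.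
Proof.
by apply: (form_young (S := vL2) vL2_linear vip_linear) => *; [exact: vipC|exact: vip_ge0].
Qed.

Lemma vipB_sqr u v : vL2 u -> vL2 v -> vip (u - v) (u - v) = vip u u - 2 * vip u v + vip v v.
Proof.
by apply: (formB_sqr (S := vL2) vL2_linear vip_linear) => *; exact: vipC.
Qed.

Lemma gip_linear (a : R) u v z : X u -> X v -> X z ->
  gip (a *: u + v) z = a * gip u z + gip v z.
Proof.
move=> Xu Xv Xz; rewrite /Defs.gip mulr_sumr -big_split/=; apply: eq_bigr => i _.
rewrite mulr_sumr -big_split/=; apply: eq_bigr => j _.
have Lu := H10_L2_wD j (Xu i); have Lv := H10_L2_wD j (Xv i); have Lz := H10_L2_wD j (Xz i).
have Luv := H10_L2_wD j (X_linear oOmega a Xu Xv i).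
rewrite -(ipZl mOmega a Lu Lz) -(ipDl mOmega (L2Z mOmega a Lu) Lv Lz).
apply: (eqae_ip oOmega Luv (L2D mOmega (L2Z mOmega a Lu) Lv) Lz Lz); last exact: eqae_refl.
exact: (wD_linear_H10 oOmega a j (Xu i) (Xv i)).
Qed.

Lemma gipC u v : gip u v = gip v u.
Proof. by apply: eq_bigr => i _; apply: eq_bigr => j _; exact: ipC. Qed.

Lemma gip_ge0 u : 0 <= gip u u.
Proof. by apply: sumr_ge0 => i _; exact: gradsq_ge0. Qed.

Lemma gradnorm_ge0 u : 0 <= gradnorm u.
Proof. exact: sqrtr_ge0. Qed.

Lemma gradnorm_sqr u : gradnorm u ^+ 2 = gip u u.
Proof. exact: sqr_sqrtr (gip_ge0 u). Qed.

Lemma gipB u v z : X u -> X v -> X z -> gip (u - v) z = gip u z - gip v z.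
Proof. exact: (formB (S := X) gip_linear). Qed.

Lemma gip_young t u v : 0 < t -> X u -> X v -> `|gip u v| <= t * gip u u + (4 * t)^-1 * gip v v.
Proof.
by apply: (form_young (S := X) (X_linear oOmega) gip_linear) => *; [exact: gipC|exact: gip_ge0].
Qed.

Lemma gipB_sqr u v : X u -> X v -> gip (u - v) (u - v) = gip u u - 2 * gip u v + gip v v.
Proof.
by apply: (formB_sqr (S := X) (X_linear oOmega) gip_linear) => *; exact: gipC.
Qed.

Lemma gradnormZ a u : X u -> gradnorm (a *: u) = `|a| * gradnorm u.
Proof.
move=> Xu; have X0 : X (u - u) by exact: XB.
have Xa : X (a *: u) by rewrite -[a *: u]addr0 -(subrr u); exact: X_linear.
rewrite /Defs.gradnorm (formZ gip_linear)// gipC (formZ gip_linear)// mulrA -expr2.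
by rewrite sqrtrM ?sqr_ge0// sqrtr_sqr.
Qed.

(** Normalize v. If its gradient norm is 0 this is impossible, and the continuity bound contained in
    [Hm1] gives F v = 0. *)
Lemma Hm1_bounded (F : field -> R) (K : R) : Hm1 Omega F -> (Hm1norm Omega F <= K%:E)%E ->
  forall v, X v -> `|F v| <= K * gradnorm v.
Proof.
move=> [FL [M FM]] FK v Xv.
have [v0|v0] := eqVneq (gradnorm v) 0; first by have := FM v Xv; rewrite v0 !mulr0.
have {}v0 : 0 < gradnorm v by rewrite lt_neqAle eq_sym v0 gradnorm_ge0.
have X0 : X 0 by rewrite -(subrr v); exact: XB.
have F0 : F 0 = 0.
  have := FL 1 0 0 X0 X0; rewrite scaler0 addr0 mul1r => /eqP.
  by rewrite -subr_eq0 opprD addrA subrr add0r oppr_eq0 => /eqP.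
pose a := (gradnorm v)^-1.
have Xa : X (a *: v) by rewrite -[_ *: _]addr0; exact: X_linear.
have Fa : F (a *: v) = a * F v by have := FL a v 0 Xv X0; rewrite F0 !addr0.
have : (`|F (a *: v)|%:E <= K%:E)%E.
  apply: le_trans FK; apply: ereal_sup_ubound; exists (a *: v) => //; split => //.
  by rewrite gradnormZ// gtr0_norm ?invr_gt0// mulVf ?gt_eqF.
rewrite lee_fin Fa normrM gtr0_norm ?invr_gt0// mulrC ler_pdivrMr//.
Qed.

Lemma L2_sum (I : eqType) (s : seq I) (F : I -> 'rV[R]_d -> R) :
  (forall i, L2 (F i)) -> L2 (fun x => \sum_(i <- s) F i x).
Proof.
move=> LF; elim: s => [|i s IHs].
  by under eq_fun do rewrite big_nil; exact: L2_0.
by under eq_fun do rewrite big_cons; exact: (L2D mOmega (LF i) IHs).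
Qed.

Lemma eqae_sum (I : eqType) (s : seq I) (F G : I -> 'rV[R]_d -> R) :
  (forall i, eqae Omega (F i) (G i)) ->
  eqae Omega (fun x => \sum_(i <- s) F i x) (fun x => \sum_(i <- s) G i x).
Proof.
move=> FG; elim: s => [|i s IHs].
  by under eq_fun do rewrite big_nil; under [X in eqae _ _ X]eq_fun do rewrite big_nil; exact: eqae_refl.
apply: filterS2 (FG i) IHs => x Fx sx Ox; rewrite !big_cons.
by rewrite Fx// sx.
Qed.

Lemma div_L2 u : X u -> L2 (div u).
Proof. by move=> Xu; apply: L2_sum => i; exact: (H10_L2_wD i (Xu i)). Qed.

Lemma divB u v : X u -> X v -> eqae Omega (div (u - v)) (div u - div v).
Proof.
move=> Xu Xv.
have h : eqae Omega (div (u - v)) (fun x => \sum_i (- 1 *: wD [:: i] (v i) + wD [:: i] (u i)) x).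
  apply: eqae_sum => i; have -> : (u - v) i = -1 *: v i + u i by rewrite addrC -scaleN1r.
  exact: (wD_linear_H10 oOmega _ i (Xv i) (Xu i)).
apply: eqae_trans h _; apply: aeW => x _.
transitivity (\sum_i (wD [:: i] (u i) x - wD [:: i] (v i) x)).
  by apply: eq_bigr => i _; rewrite addrC -[- wD _ _ _]mulN1r.
by rewrite sumrB.
Qed.

Lemma ip_div_ge0 u v : X u -> X v -> eqae Omega (div v) 0 -> 0 <= ip (div u) (div (u - v)).
Proof.
move=> Xu Xv v0; have Xuv := XB oOmega Xu Xv.
rewrite (eqae_ip oOmega (div_L2 Xu) (div_L2 Xu) (div_L2 Xuv) (div_L2 Xu) (eqae_refl _ _)).
  exact: ip_ge0.
apply: eqae_trans (divB Xu Xv) _; apply: filterS v0 => x v0 Ox.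
by have := v0 Ox; rewrite -[(div u - div v) x]/(div u x - div v x) => ->; exact: subr0.
Qed.

End vector_fields.

(** * Bounds at every time *)

Section time_bounds.
Variable R : realType.
Local Notation mu := (@lebesgue_measure R).

Lemma lt_pinfty_real_bound (x : \bar R) : (x < +oo)%E -> exists2 K : R, 0 <= K & (x <= K%:E)%E.
Proof.
case: x => [r| |]// _; last by exists 0 => //; exact: leNye.
by exists (Num.max 0 r); rewrite ?le_max ?lexx// lee_fin le_max lexx orbT.
Qed.

Lemma Linf_bound (Y : zmodType) (N : Y -> R) (h : R -> Y) :
  (Linf_norm (fun y => (N y)%:E) h < +oo)%E ->
  exists2 K : R, 0 <= K & {ae mu, forall t, 0 < t -> N (h t) <= K}.
Proof.
move=> /lt_pinfty_real_bound[K K0 /ess_supP hK]; exists K => //.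
apply: filterS hK => t; rewrite /patch /= => ht t0.
by move: ht; rewrite mem_set /= ?lee_fin// in_itv/= t0.
Qed.

(** Otherwise the interval ]t, t + e[ would lie in a null set. Looking to the right of [t] includes
    the case t = 0. *)
Lemma ae_pos_exists_near (P : R -> Prop) (t e : R) : {ae mu, forall s, 0 < s -> P s} ->
  0 <= t -> 0 < e -> exists s, [/\ t < s, s < t + e & P s].
Proof.
move=> aeP t0 e0; apply: contrapT => nP.
have [N [mN N0 PN]] := aeP.
have : (mu `]t, (t + e)%R[ <= mu N)%E.
  apply: le_measure; rewrite ?inE//.
  move=> s /=; rewrite in_itv/= => /andP[ts se]; apply: PN => /= Ps.
  by apply: nP; exists s; split => //; apply: Ps; exact: le_lt_trans t0 ts.
rewrite N0 lebesgue_measure_itv/= lte_fin ltrDl e0 -EFinD lee_fin.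
by rewrite addrAC subrr add0r leNgt e0.
Qed.

Variables (d : nat) (Omega : set 'rV[R]_d).
Hypothesis oOmega : open Omega.
Local Notation L2 := (L2 Omega).
Local Notation ip := (ip Omega).
Local Notation L2norm := (L2norm Omega).
Local Notation wD := (wD Omega).
Local Notation field := ('I_d -> 'rV[R]_d -> R).
Implicit Types (u v z w : field).
Let mOmega : measurable Omega := open_measurable_rV oOmega.

Lemma ler_addeps (x y C : R) : 0 <= C -> (forall e, 0 < e -> x <= y + e * C) -> x <= y.
Proof.
move=> C0 h; apply/ler_addgt0Pr => e e0.
have C1 : 0 < C + 1 by rewrite ltr_wpDl.
apply: le_trans (h (e / (C + 1)) (divr_gt0 e0 C1)) _.
rewrite lerD2l mulrAC ler_pdivrMr// ler_pM2l//.
by rewrite lerDl.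
Qed.

Lemma L2norm_le_vL2norm u i : L2norm (u i) <= vL2norm Omega u.
Proof. by rewrite ler_wsqrtr// ip_le_vip. Qed.

Lemma sobolev_norm_le_vsobolev_norm k u i :
  sobolev_norm Omega k (u i) <= vsobolev_norm Omega k u.
Proof.
rewrite -[leLHS]ger0_norm ?sqrtr_ge0// -sqrtr_sqr ler_wsqrtr//.
by rewrite (bigD1 i)//= lerDl; apply: sumr_ge0 => j _; exact: sqr_ge0.
Qed.

Lemma sqr_le_mul (x K : R) : x ^+ 2 <= K * x -> 0 <= K -> x <= K.
Proof.
move=> h K0; have [x0|x0] := leP x 0; first exact: le_trans x0 K0.
by rewrite -(ler_pM2r x0) -expr2.
Qed.

(** For p within e of g, |g|^2 = (g, p) - (g, p - g) <= K (|g| + e) + |g| e; letting e tend to 0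
    gives |g|^2 <= K |g|. *)
Lemma L2norm_le_test_dense (g : 'rV[R]_d -> R) (K : R) (P : set ('rV[R]_d -> R)) :
  L2 g -> 0 <= K -> (forall p, P p -> L2 p /\ `|ip g p| <= K * L2norm p) ->
  (forall e, 0 < e -> exists2 p, P p & L2norm (p - g) <= e) -> L2norm g <= K.
Proof.
move=> Lg K0 gP dP; apply: sqr_le_mul => //.
have g0 := L2norm_ge0 Omega g.
apply: (@ler_addeps _ _ (K + L2norm g)); first exact: addr_ge0.
move=> e e0; have [p Pp pg] := dP e e0; have [Lp gp] := gP p Pp.
have Lgp := L2B mOmega Lp Lg.
have pn : L2norm p <= L2norm g + e.
  have := L2normD mOmega Lgp Lg; rewrite subrK => /le_trans; apply.
  by rewrite addrC lerD2l.
have h1 := le_trans gp (ler_wpM2l K0 pn).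
have h2 := le_trans (ip_le_norm mOmega Lg Lgp) (ler_wpM2l g0 pg).
have -> : L2norm g ^+ 2 = ip g p - ip g (p - g).
  by rewrite L2norm_sqr (ipBr mOmega Lp Lg Lg) opprB addrC subrK.
move: h1 h2; rewrite !ler_norml => /andP[_ h1] /andP[h2 _].
have -> : K * L2norm g + e * (K + L2norm g) = K * (L2norm g + e) + L2norm g * e by ring.
by apply: lerD h1 _; rewrite lerNl.
Qed.

Lemma uniform_X_bound (w : R -> field) k : (forall t, 0 <= t -> X Omega (w t)) ->
  L2_continuous Omega w ->
  (Linf_norm (fun u => (vsobolev_norm Omega k.+1 u)%:E) w < +oo)%E ->
  exists2 M, 0 <= M & forall t, 0 <= t ->
    vip Omega (w t) (w t) <= M /\ gip Omega (w t) (w t) <= M.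
Proof.
move=> Xw cw /Linf_bound[K K0 aeK].
have approx t e : 0 <= t -> 0 < e -> exists s, [/\ 0 <= s,
    vsobolev_norm Omega k.+1 (w s) <= K & vL2norm Omega (w s - w t) <= e].
  move=> t0 e0; have [_ /cvgrPdist_le/(_ e e0)] := cw t t0.
  rewrite near_withinE => /nbhs_ballP[dl /= dl0 hdl].
  have [s [ts se Ks]] := ae_pos_exists_near aeK t0 dl0.
  have s0 : 0 <= s := le_trans t0 (ltW ts).
  exists s; split => //.
  have := hdl s _ s0; rewrite sub0r normrN ger0_norm ?sqrtr_ge0//; apply.
  by rewrite /ball /= distrC ger0_norm ?subr_ge0 ?(ltW ts)// ltrBlDl.
have wL2 t i : 0 <= t -> L2 (w t i) by move=> /Xw/(_ i)/H10_L2.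
have nw t i : 0 <= t -> L2norm (w t i) <= K.
  move=> t0; apply: (@ler_addeps _ _ 1) => // e e0; rewrite mulr1.
  have [s [s0 Ks se]] := approx t e t0 e0.
  have Ls := wL2 s i s0; have Lt := wL2 t i t0; have Lst := L2B mOmega Ls Lt.
  have := L2normB mOmega Ls Lst; rewrite subKr => /le_trans; apply; apply: lerD.
    apply: le_trans (sobolev_norm_ge_L2 oOmega k.+1 Ls) _.
    exact: le_trans (sobolev_norm_le_vsobolev_norm k.+1 (w s) i) Ks.
  exact: le_trans (L2norm_le_vL2norm (w s - w t) i) se.
have nDw t i j : 0 <= t -> L2norm (wD [:: j] (w t i)) <= K.
  move=> t0; have Hw := Xw t t0 i.
  apply: (@L2norm_le_test_dense _ K [set p | test_fun Omega p]) => //.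
  - exact: H10_L2_wD.
  (* The gradients at times s and t need not be close. Once the derivative is moved onto [p], only
     the L^2 distance of w(s) and w(t) matters, and the arbitrary e offsets the norm of D_j p. *)
  - move=> p tp; have Lp := test_fun_L2 mOmega tp; split => //.
    have Lq := test_fun_L2 mOmega (test_fun_pder [:: j] tp).
    apply: (@ler_addeps _ _ (L2norm (pder [:: j] p))); first exact: L2norm_ge0.
    move=> e e0; have [s [s0 Ks se]] := approx t e t0 e0.
    have Ls := wL2 s i s0; have Lt := wL2 t i t0; have Lst := L2B mOmega Ls Lt.
    have wder r : 0 <= r -> `|ip (wD [:: j] (w r i)) p| = `|ip (w r i) (pder [:: j] p)|.
      move=> r0; have [_ ->//] := H10_weak_der j (Xw r r0 i).
      by rewrite expr1 mulN1r normrN.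
    have h1 : `|ip (w s i) (pder [:: j] p)| <= K * L2norm p.
      rewrite -wder//; apply: le_trans (ip_le_norm mOmega (H10_L2_wD j (Xw s s0 i)) Lp) _.
      apply: ler_wpM2r; first exact: L2norm_ge0.
      apply: le_trans (sobolev_norm_ge_wD Omega k (w s i) j) _.
      exact: le_trans (sobolev_norm_le_vsobolev_norm k.+1 (w s) i) Ks.
    have h2 : `|ip (w s i - w t i) (pder [:: j] p)| <= e * L2norm (pder [:: j] p).
      apply: le_trans (ip_le_norm mOmega Lst Lq) _.
      apply: ler_wpM2r; first exact: L2norm_ge0.
      exact: le_trans (L2norm_le_vL2norm (w s - w t) i) se.
    rewrite wder//; apply: le_trans (lerD h1 h2); apply: le_trans (ler_normB _ _).
    by rewrite (ipBl mOmega Ls Lt Lq) subKr.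
  (* Derivatives of the H^1_0 approximants of w(t) are themselves test functions, and they approach
     D_j w(t). *)
  - move=> e e0; have [p [tp _ /(_ j)/cvgrPdist_le/(_ e e0)[n _ pe] _]] := H10_approx oOmega Hw.
    exists (pder [:: j] (p n)); first exact: test_fun_pder.
    by have := pe n (leqnn n); rewrite sub0r normrN ger0_norm ?L2norm_ge0.
have K2 : 0 <= K ^+ 2 := sqr_ge0 K.
have le_sqr h : L2norm h <= K -> ip h h <= K ^+ 2.
  by move=> hK; rewrite -L2norm_sqr lerXn2r ?nnegrE ?L2norm_ge0.
exists (K ^+ 2 *+ d + K ^+ 2 *+ d *+ d); first by rewrite addr_ge0 ?mulrn_wge0.
move=> t t0; split.
  apply: (@le_trans _ _ (\sum_(i < d) K ^+ 2)).
    by apply: ler_sum => i _; apply: le_sqr; exact: nw.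
  by rewrite sumr_const card_ord lerDl !mulrn_wge0.
apply: (@le_trans _ _ (\sum_(i < d) \sum_(j < d) K ^+ 2)).
  by apply: ler_sum => i _; apply: ler_sum => j _; apply: le_sqr; exact: nDw.
by rewrite !sumr_const card_ord lerDr !mulrn_wge0.
Qed.

End time_bounds.

(** * The energy argument *)

Section energy_inequalities.
Variable R : realType.
Implicit Types (nu r mu M F S a b G D x y z : R).

Lemma young_sqr (k x y z : R) : 0 < k -> x <= y * z -> x <= k * z ^+ 2 + y ^+ 2 / (4 * k).
Proof.
move=> k0 /le_trans; apply; rewrite -subr_ge0.
have -> : k * z ^+ 2 + y ^+ 2 / (4 * k) - y * z = (4 * k)^-1 * (2 * k * z - y) ^+ 2.
  by field; rewrite gt_eqF.
by rewrite mulr_ge0 ?sqr_ge0// invr_ge0 mulr_ge0// ltW.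
Qed.

(* a = |u^n|^2, b = |u^(n+1)|^2, G = |grad u^(n+1)|^2, Ge = |grad e^(n+1)|^2,
   r = 1 / dt, z = |IH e^(n+1) - e^(n+1)|^2, ww = |w^(n+1)|^2, gw = |grad w^(n+1)|^2,
   and D is the penalty term. *)
Lemma stability_step nu r mu M F S a b G gn m D y x z Ge g gw ww Fv :
  0 < nu -> 0 < r -> 1 <= mu -> 0 <= M -> 0 <= G ->
  r * (b - m) + nu * G + D + mu * (y + (b - x)) = Fv ->
  0 <= D -> ww <= M -> gw <= M ->
  `|m| <= 2^-1 * a + (4 * 2^-1)^-1 * b ->
  `|y| <= 1 * z + (4 * 1)^-1 * b -> mu * z <= nu / 2 * Ge ->
  Ge = G - 2 * g + gw -> `|g| <= 4^-1 * G + (4 * 4^-1)^-1 * gw ->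
  `|x| <= 1 * ww + (4 * 1)^-1 * b ->
  Fv <= F * gn -> gn ^+ 2 = G ->
  2 * (M + 3 / 2 * nu * M + F ^+ 2 / nu) <= S -> a <= S -> b <= S.
Proof.
move=> nu0 r0 mu1 M0 G0 E D0 wM gM mE yE zE GeE gE xE FE gnE KS aS.
have mu0 : 0 < mu by rewrite (lt_le_trans ltr01).
have n4 : 0 < nu / 4 by rewrite divr_gt0.
have {FE} := young_sqr n4 FE; rewrite gnE.
have -> : F ^+ 2 / (4 * (nu / 4)) = F ^+ 2 / nu by field; rewrite gt_eqF.
have Fn0 : 0 <= F ^+ 2 / nu by rewrite divr_ge0 ?sqr_ge0// ltW.
move: (F ^+ 2 / nu) Fn0 KS => P P0 KS FE.
have c1 : (4 * 2^-1)^-1 = 2^-1 :> R by field.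
have c2 : (4 * 4^-1)^-1 = 1 :> R by field.
have c3 : (4 * 1)^-1 = 4^-1 :> R by field.
rewrite c1 in mE; rewrite c2 in gE; rewrite c3 in yE xE.
have h1 : r * m <= r * (2^-1 * a + 2^-1 * b).
  by rewrite ler_pM2l//; exact: le_trans (ler_norm _) mE.
have h2 : mu * - y <= mu * (1 * z + 4^-1 * b).
  by rewrite ler_pM2l//; apply: le_trans yE; rewrite -normrN ler_norm.
have h3 : mu * x <= mu * (M + 4^-1 * b).
  rewrite ler_pM2l//; apply: le_trans (ler_norm _) (le_trans xE _).
  by rewrite mul1r lerD2r.
have h4 : - g <= 4^-1 * G + M.
  rewrite mul1r in gE; apply: le_trans (ler_norm _) _; rewrite normrN; apply: le_trans gE _.
  by rewrite lerD2l.
(* The viscous budget nu G is spent exactly: nu/4 on the force and nu/2 times 3/2 on the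
   interpolation error. *)
have h5 : nu * Ge <= nu * (3 / 2 * G + 3 * M) by rewrite ler_pM2l// GeE; lra.
(* As mu >= 1, constants without the factor mu may be charged to it. This leaves (r + mu) b <= r a +
   2 mu (M + 3/2 nu M + P), a weighted mean of two quantities that are at most S. *)
have h6 : 0 <= (mu - 1) * (3 / 2 * nu * M + P).
  by rewrite mulr_ge0 ?subr_ge0// addr_ge0// mulr_ge0// mulr_ge0// ltW.
have h7 : r * a <= r * S by rewrite ler_pM2l.
have h8 : mu * (2 * (M + 3 / 2 * nu * M + P)) <= mu * S by rewrite ler_pM2l.
have rm0 : 0 < r + mu by rewrite addr_gt0.
by rewrite -(ler_pM2l rm0); lra.
Qed.

(** Origin of the terms: 4 M from the difference quotient of w; nu/8 M from trading grad u^n for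
    grad e^n; the C term from convection, with |e^(n+1)|^2 <= 3/2 S + 3 M; 2 nu M from the viscous
    term of w; the last from the force, Young's weight being nu/8. *)
Definition error_constant nu M F S C : R :=
  4 * M + nu / 8 * M + C * (5 / 2 * S + 3 * M) + 2 * nu * M + 2 * (F ^+ 2 / nu).

Lemma error_constant_ge0 nu M F S C : 0 < nu -> 0 <= M -> 0 <= S -> 0 <= C ->
  0 <= error_constant nu M F S C.
Proof.
move=> nu0 M0 S0 C0; have nM : 0 <= nu * M by rewrite mulr_ge0// ltW.
have Fn : 0 <= F ^+ 2 / nu by rewrite divr_ge0 ?sqr_ge0// ltW.
have CS : 0 <= C * (5 / 2 * S + 3 * M) by apply: mulr_ge0 => //; lra.
by rewrite /error_constant; lra.
Qed.

(* a = |e^n|^2, b = |e^(n+1)|^2, Ga and G are the squared norms of their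
   gradients, s = |u^n|^2, s' = |u^(n+1)|^2, gu = |grad u^n|^2, r = 1 / dt,
   z = |IH e^(n+1) - e^(n+1)|^2, bt = btilde u^n w^(n+1) e^(n+1) and D is the penalty
   term.  Young's weight 2 r / mu for p and p' leaves only 2 M of the time
   difference of w, because r^2 <= mu. *)
Lemma energy_step nu r mu M F S C a b s s' x Ga G gn m D y z g gw gu gv p p' ww ww' bt Fv
  (K := error_constant nu M F S C) :
  0 < nu -> 1 <= r -> r ^+ 2 <= mu -> 0 <= M -> 0 <= C -> 0 <= G -> 0 <= b ->
  r * ((b + p') - (m + p)) + bt + nu * (G + g) + D + mu * (y + b) = Fv ->
  0 <= D -> ww <= M -> ww' <= M -> gw <= M -> gv <= M -> s <= S -> s' <= S ->
  `|m| <= 2^-1 * a + (4 * 2^-1)^-1 * b ->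
  `|p| <= 2 * r / mu * ww + (4 * (2 * r / mu))^-1 * b ->
  `|p'| <= 2 * r / mu * ww' + (4 * (2 * r / mu))^-1 * b ->
  `|y| <= 2^-1 * z + (4 * 2^-1)^-1 * b -> mu * z <= nu / 2 * G ->
  `|bt| <= nu / 16 * (gu + G) + C * (s + b) ->
  Ga = gu - 2 * x + gv -> `|x| <= 4^-1 * gu + (4 * 4^-1)^-1 * gv ->
  b <= 3 / 2 * s' + 3 * ww' ->
  `|g| <= 8^-1 * G + (4 * 8^-1)^-1 * gw ->
  Fv <= F * gn -> gn ^+ 2 = G ->
  r / 2 * a + nu / 8 * Ga <= 4 * K ->
  r / 2 * b + nu / 8 * G <= 4 * K /\ mu * b <= 40 * K.
Proof.
move=> nu0 r1 rmu M0 C0 G0 b0 E D0 wM wM' gM gvM sS sS' mE pE pE' yE zE btE GaE xE bE gE FE gnE.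
have r0 : 0 < r := lt_le_trans ltr01 r1.
have rmu' : r <= mu by apply: le_trans rmu; rewrite expr2 ler_peMl// ltW.
have mu0 : 0 < mu := lt_le_trans r0 rmu'.
have n8 : 0 < nu / 8 by rewrite divr_gt0.
have {FE} := young_sqr n8 FE; rewrite gnE.
have -> : F ^+ 2 / (4 * (nu / 8)) = 2 * (F ^+ 2 / nu) by field; rewrite gt_eqF.
rewrite /K /error_constant; have Fn0 : 0 <= F ^+ 2 / nu by rewrite divr_ge0 ?sqr_ge0// ltW.
move: (F ^+ 2 / nu) Fn0 => P P0 FE EK.
have c1 : (4 * 2^-1)^-1 = 2^-1 :> R by field.
have c2 : (4 * 4^-1)^-1 = 1 :> R by field.
have c3 : (4 * 8^-1)^-1 = 2 :> R by field.
have c4 : (4 * (2 * r / mu))^-1 = mu / (8 * r) by field; rewrite !gt_eqF.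
rewrite c1 in mE yE; rewrite c2 in xE; rewrite c3 in gE; rewrite c4 in pE pE'.
have h1 : r * m <= r * (2^-1 * a + 2^-1 * b).
  by rewrite ler_pM2l//; exact: le_trans (ler_norm _) mE.
have rp (q v : R) : v <= M -> `|q| <= 2 * r / mu * v + mu / (8 * r) * b ->
    r * `|q| <= 2 * M + mu / 8 * b.
  move=> vM qE; have k0 : 0 <= 2 * r / mu by rewrite divr_ge0 ?mulr_ge0// ltW.
  have := ler_wpM2l (ltW r0) (le_trans qE (lerD (ler_wpM2l k0 vM) (lexx _))).
  move=> /le_trans; apply.
  have -> : r * (2 * r / mu * M + mu / (8 * r) * b) = 2 * M * (r ^+ 2 / mu) + mu / 8 * b.
    by field; rewrite !gt_eqF.
  rewrite lerD2r -[leRHS]mulr1 ler_wpM2l ?mulr_ge0//.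
  by rewrite ler_pdivrMr// mul1r.
have h2 : r * p <= 2 * M + mu / 8 * b.
  by apply: le_trans (rp _ _ wM pE); rewrite ler_pM2l// ler_norm.
have h2' : r * - p' <= 2 * M + mu / 8 * b.
  by apply: le_trans (rp _ _ wM' pE'); rewrite ler_pM2l// -normrN ler_norm.
have h3 : mu * - y <= mu * (2^-1 * z + 2^-1 * b).
  by rewrite ler_pM2l//; apply: le_trans yE; rewrite -normrN ler_norm.
have h4 : nu * - g <= nu * (8^-1 * G + 2 * M).
  rewrite ler_pM2l//; apply: (@le_trans _ _ (8^-1 * G + 2 * gw)).
    by apply: le_trans gE; rewrite -normrN ler_norm.
  by rewrite lerD2l ler_pM2l.
have h5 : nu * gu <= nu * (2 * Ga + 2 * M).
  rewrite ler_pM2l//; have := le_trans (ler_norm _) xE; rewrite mul1r; lra.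
(* Here b has the possibly large factor C and cannot be absorbed by mu b; the stability bound is
   used instead. *)
have h6 : C * (s + b) <= C * (5 / 2 * S + 3 * M) by rewrite ler_wpM2l//; lra.
have h7 : - bt <= nu / 16 * (gu + G) + C * (5 / 2 * S + 3 * M).
  apply: le_trans (lerD (lexx _) h6); apply: le_trans btE.
  by rewrite -normrN ler_norm.
have h8 : 0 <= (mu - r) * b by rewrite mulr_ge0// subr_ge0.
have h9 : 0 <= nu * G by rewrite mulr_ge0// ltW.
have h10 : 0 <= mu * b by rewrite mulr_ge0// ltW.
have h11 : 0 <= r * b by rewrite mulr_ge0// ltW.
(* Of nu G, the force takes 1/8, convection 1/16, grad w^(n+1) 1/8 and the interpolation error 1/4;
   of mu b, the interpolation error takes 1/2 and the difference quotient of w 1/4. Since r <= mu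
   and 5/32 <= 7/16, the left-hand side is at least 5/4 (r/2 b + nu/8 G) + mu b / 8. *)
have key : r / 2 * b + 7 / 16 * (nu * G) + mu * b / 4 <= r / 2 * a + nu / 8 * Ga +
  (4 * M + nu / 8 * M + C * (5 / 2 * S + 3 * M) + 2 * nu * M + 2 * P).
  lra.
move: EK key; move: (4 * M + _ + _ + _ + _) (r / 2 * a + _) => K' E0 EK key.
split; lra.
Qed.

Lemma polar_sqr_le (b s x ww : R) : b = s - 2 * x + ww -> `|x| <= 4^-1 * s + (4 * 4^-1)^-1 * ww ->
  b <= 3 / 2 * s + 3 * ww.
Proof.
have -> : (4 * 4^-1)^-1 = 1 :> R by field.
by move=> -> ; rewrite mul1r ler_norml => /andP[h _]; lra.
Qed.

End energy_inequalities.

(** * Stability and convergence of the scheme *)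

Section convergence.
Variables (R : realType) (d : nat) (Omega : set 'rV[R]_d).
Hypotheses (hd : d = 2%N \/ d = 3%N) (oOmega : open Omega).
Local Notation field := ('I_d -> 'rV[R]_d -> R).
Local Notation X := (X Omega).
Local Notation vL2 := (vL2 Omega).
Local Notation vip := (vip Omega).
Local Notation gip := (gip Omega).
Local Notation vL2norm := (vL2norm Omega).
Local Notation gradnorm := (gradnorm Omega).
Local Notation div := (div Omega).
Local Notation btilde := (btilde Omega).
Implicit Types (u v z w : field).

Variables (nu M F : R) (f : R -> field -> R) (w : R -> field).
Hypotheses (nu0 : 0 < nu) (M0 : 0 <= M).
Hypothesis Xw : forall t, 0 <= t -> X (w t).
Hypothesis wM : forall t, 0 <= t -> vip (w t) (w t) <= M /\ gip (w t) (w t) <= M.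
Hypothesis div_w : forall t, 0 <= t -> eqae Omega (div (w t)) 0.
Hypothesis fF : forall t, 0 < t -> forall v, X v -> `|f t v| <= F * gradnorm v.

Variables (dt eps mu CI H : R) (IH : field -> field) (u : nat -> field).
Hypotheses (eps0 : 0 < eps) (dt0 : 0 < dt) (dt1 : dt <= 1) (dtmu : dt ^- 2 <= mu).
Hypotheses (CI0 : 0 < CI) (muH : mu * H ^+ 2 <= nu / (2 * CI ^+ 2)).
Hypothesis IH_L2 : forall v, X v -> vL2 (IH v).
Hypothesis IH_le : forall v, X v -> vL2norm (IH v - v) <= CI * H * gradnorm v.
Hypothesis cda : cda_penalty Omega nu dt eps mu IH f (w 0) w u.

Let wn n := w (n%:R * dt).
Let e n := u n - wn n.

Let t0 n : 0 <= n%:R * dt. Proof. by rewrite mulr_ge0// ltW. Qed.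
Let tS0 n : 0 < n.+1%:R * dt. Proof. by rewrite mulr_gt0. Qed.
Let Xwn n : X (wn n). Proof. exact: Xw. Qed.
Let Xun n : X (u n).
Proof. by case: n => [|n]; [rewrite (cda_init cda); exact: Xw|exact: cda_X cda n]. Qed.
Let Xen n : X (e n). Proof. exact: XB. Qed.

Let r1 : 1 <= dt^-1. Proof. by rewrite invf_ge1. Qed.
Let rmu : dt^-1 ^+ 2 <= mu. Proof. by rewrite exprVn. Qed.
Let mu1 : 1 <= mu. Proof. by apply: le_trans rmu; rewrite exprn_ege1. Qed.

(** The smallness of mu H^2 in the form the energy estimates consume: the interpolation error costs
    at most half of the viscosity. *)
Let IH_gip v : X v -> mu * vip (IH v - v) (IH v - v) <= nu / 2 * gip v v.
Proof.
move=> Xv; have mu0 : 0 <= mu := le_trans ler01 mu1.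
have h : vip (IH v - v) (IH v - v) <= (CI * H) ^+ 2 * gip v v.
  rewrite -vL2norm_sqr -gradnorm_sqr -exprMn.
  have := IH_le Xv; have := vL2norm_ge0 Omega (IH v - v).
  move: (vL2norm _) (CI * H * _) => x y x0 xy.
  by rewrite lerXn2r// nnegrE// (le_trans x0).
apply: le_trans (ler_wpM2l mu0 h) _; rewrite mulrA; apply: ler_wpM2r; first exact: gip_ge0.
have CI2 : 0 < CI ^+ 2 by rewrite exprn_gt0.
have := ler_wpM2l (ltW CI2) muH; rewrite exprMn.
have -> : CI ^+ 2 * (nu / (2 * CI ^+ 2)) = nu / 2 by field; rewrite gt_eqF.
by rewrite mulrCA.
Qed.

Let penalty_ge0 n : 0 <= eps^-1 * ip Omega (div (u n)) (div (e n)).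
Proof.
by apply: mulr_ge0; [rewrite invr_ge0 ltW|apply: ip_div_ge0 => //; exact: div_w].
Qed.

(** Writing IH e as (IH e - e) + e isolates mu (e, v), the coercive part of the nudging. *)
Let step n v : X v ->
  dt^-1 * (vip (u n.+1) v - vip (u n) v) + btilde (u n) (u n.+1) v + nu * gip (u n.+1) v
  + eps^-1 * ip Omega (div (u n.+1)) (div v)
  + mu * (vip (IH (e n.+1) - e n.+1) v + vip (e n.+1) v) = f (n.+1%:R * dt) v.
Proof.
move=> Xv; rewrite -(cda_step cda n Xv).
have Lv := X_vL2 Xv; have Le := X_vL2 (Xen n.+1); have LIe := IH_L2 (Xen n.+1).
by rewrite (vipB oOmega (X_vL2 (Xun _)) (X_vL2 (Xun _)) Lv) (vipB oOmega LIe Le Lv) subrK.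
Qed.

(** The first M covers u^0 = w(0); the rest is the threshold above which the nudging pulls |u^n|^2
    down. *)
Definition stability_constant : R := M + 2 * (M + 3 / 2 * nu * M + F ^+ 2 / nu).
Local Notation S := stability_constant.

Lemma cda_stability n : vip (u n) (u n) <= S.
Proof.
have F0 : 0 <= F ^+ 2 / nu by rewrite divr_ge0 ?sqr_ge0// ltW.
have MM : 0 <= 3 / 2 * nu * M by rewrite !mulr_ge0// ltW.
elim: n => [|n IHn].
  rewrite (cda_init cda); apply: le_trans (proj1 (wM (lexx 0))) _.
  by rewrite /S lerDl mulr_ge0// !addr_ge0.
have Xu' := Xun n.+1; have Xw' := Xwn n.+1; have Xe' := Xen n.+1.
have Lu := X_vL2 (Xun n); have Lu' := X_vL2 Xu'; have Lw' := X_vL2 Xw'; have Le' := X_vL2 Xe'.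
have LI := vL2B oOmega (IH_L2 Xe') Le'.
have [wM' gM'] := wM (t0 n.+1).
have D0 : 0 <= eps^-1 * ip Omega (div (u n.+1)) (div (u n.+1)).
  by apply: mulr_ge0; [rewrite invr_ge0 ltW|exact: ip_ge0].
have E := step n Xu'.
rewrite (btilde_skew hd oOmega (Xun n) Xu') addr0 (vipB oOmega Lu' Lw' Lu') in E.
apply: (@stability_step R nu (dt^-1) mu M F S _ _ (gip (u n.+1) (u n.+1)) (gradnorm (u n.+1))
  (vip (u n) (u n.+1)) _ _ _ _ (gip (e n.+1) (e n.+1)) (gip (u n.+1) (wn n.+1))
  (gip (wn n.+1) (wn n.+1)) (vip (wn n.+1) (wn n.+1)) _ nu0 _ mu1 M0 (gip_ge0 _ _) E D0 wM' gM').
- by rewrite invr_gt0.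
- exact: vip_young.
- exact: vip_young.
- exact: IH_gip.
- exact: gipB_sqr.
- exact: gip_young.
- exact: vip_young.
- exact: le_trans (ler_norm _) (fF (tS0 n) Xu').
- exact: gradnorm_sqr.
- by rewrite /S lerDr.
- exact: IHn.
Qed.

Variable C : R.
Hypothesis C0 : 0 <= C.
Hypothesis btilde_C : forall a z c : field, X a -> X z -> X c ->
  vip z z <= M -> gip z z <= M ->
  `|btilde a z c| <= nu / 16 * (gip a a + gip c c) + C * (vip a a + vip c c).
Local Notation K := (error_constant nu M F S C).

Lemma cda_energy n : dt^-1 / 2 * vip (e n) (e n) + nu / 8 * gip (e n) (e n) <= 4 * K ->
  dt^-1 / 2 * vip (e n.+1) (e n.+1) + nu / 8 * gip (e n.+1) (e n.+1) <= 4 * K /\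
  mu * vip (e n.+1) (e n.+1) <= 40 * K.
Proof.
have Xu := Xun n; have Xz := Xwn n; have Xe := Xen n.
have Xu' := Xun n.+1; have Xw' := Xwn n.+1; have Xe' := Xen n.+1.
have Lu := X_vL2 Xu; have Lw := X_vL2 Xz; have Le := X_vL2 Xe.
have Lu' := X_vL2 Xu'; have Lw' := X_vL2 Xw'; have Le' := X_vL2 Xe'.
have LI := vL2B oOmega (IH_L2 Xe') Le'.
have [vwM gwM] : vip (wn n) (wn n) <= M /\ gip (wn n) (wn n) <= M := wM (t0 n).
have [vwM' gwM'] : vip (wn n.+1) (wn n.+1) <= M /\ gip (wn n.+1) (wn n.+1) <= M := wM (t0 n.+1).
have k0 : 0 < 2 * dt^-1 / mu.
  by rewrite divr_gt0 ?mulr_gt0 ?invr_gt0// (lt_le_trans ltr01 mu1).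
have E := step n Xe'.
have vE a z v : vL2 a -> vL2 z -> vL2 v -> vip a v = vip (a - z) v + vip z v.
  by move=> La Lz Lv; rewrite (vipB oOmega La Lz Lv) subrK.
(* Only the middle argument is split, so the e^(n+1) part vanishes by skew-symmetry whatever the
   divergence of u^n. *)
have btE : btilde (u n) (u n.+1) (e n.+1) = btilde (u n) (wn n.+1) (e n.+1).
  have -> : u n.+1 = wn n.+1 + e n.+1 by rewrite /e addrC subrK.
  rewrite (btildeDm hd oOmega Xu Xw' Xe' Xe') (btilde_skew hd oOmega Xu Xe').
  exact: addr0.
have gE : gip (u n.+1) (e n.+1) = gip (e n.+1) (e n.+1) + gip (wn n.+1) (e n.+1).
  by rewrite [gip (e _) _](gipB oOmega Xu' Xw' Xe') subrK.
rewrite btE gE (vE _ _ _ Lu' Lw' Le') (vE _ _ _ Lu Lw Le') -!/(e _) in E.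
have h1 := vip_young oOmega (_ : 0 < 2^-1) Le Le'.
have h2 := vip_young oOmega k0 Lw Le'.
have h3 := vip_young oOmega k0 Lw' Le'.
have h4 := vip_young oOmega (_ : 0 < 2^-1) LI Le'.
have h5 := IH_gip Xe'.
have h6 := btilde_C Xu Xw' Xe' vwM' gwM'.
(* Together with [h8], this trades grad u^n, produced by the convecting field, for grad e^n, which
   the hypothesis on step n controls, and grad w^n. *)
have h7 := gipB_sqr oOmega Xu Xz.
have h8 := gip_young oOmega (_ : 0 < 4^-1) Xu Xz.
have h9 := polar_sqr_le (vipB_sqr oOmega Lu' Lw') (vip_young oOmega (_ : 0 < 4^-1) Lu' Lw').
have h10 := gip_young oOmega (_ : 0 < 8^-1) Xe' Xw'; rewrite gipC in h10.
have h11 := le_trans (ler_norm _) (fF (tS0 n) Xe').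
have p2 : 0 < 2^-1 :> R by []. have p4 : 0 < 4^-1 :> R by []. have p8 : 0 < 8^-1 :> R by [].
exact: (energy_step nu0 r1 rmu M0 C0 (gip_ge0 _ _) (vip_ge0 _ _) E (penalty_ge0 n.+1) vwM vwM' gwM' gwM
  (cda_stability n) (cda_stability n.+1) (h1 p2) h2 h3 (h4 p2) h5 h6 h7 (h8 p4) (h9 p4)
  (h10 p8) h11 (gradnorm_sqr Omega (e n.+1))).
Qed.

Lemma cda_error n : (0 < n)%N -> vL2norm (e n) <= Num.sqrt (40 * K) * dt.
Proof.
have S0 : 0 <= S := le_trans (vip_ge0 _ _) (cda_stability 0).
have K0 : 0 <= K := error_constant_ge0 F nu0 M0 S0 C0.
have e0 : e 0%N = wn 0 - wn 0 by rewrite /e (cda_init cda) /wn mul0r.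
have E0 : dt^-1 / 2 * vip (e 0%N) (e 0%N) + nu / 8 * gip (e 0%N) (e 0%N) <= 4 * K.
  rewrite e0 (vipB oOmega (X_vL2 (Xwn 0)) (X_vL2 (Xwn 0)) (X_vL2 (XB oOmega (Xwn 0) (Xwn 0)))).
  rewrite (gipB oOmega (Xwn 0) (Xwn 0) (XB oOmega (Xwn 0) (Xwn 0))) !subrr !mulr0 addr0.
  exact: (mulr_ge0 (ler0n _ 4) K0).
have En m : dt^-1 / 2 * vip (e m) (e m) + nu / 8 * gip (e m) (e m) <= 4 * K.
  by elim: m => [//|m /cda_energy[]].
case: n => // n _; have [_ h] := cda_energy (En n).
have mu0 : 0 < mu := lt_le_trans ltr01 mu1.
have dt2 : vip (e n.+1) (e n.+1) <= 40 * K * dt ^+ 2.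
  apply: (@le_trans _ _ (40 * K * mu^-1)); first by rewrite ler_pdivlMr// mulrC.
  apply: ler_wpM2l; first exact: mulr_ge0.
  by rewrite -[leRHS]invrK lef_pV2 ?posrE ?invr_gt0 ?exprn_gt0//; exact: dtmu.
rewrite -[dt]gtr0_norm// -sqrtr_sqr -sqrtrM ?mulr_ge0//.
exact: ler_wsqrtr.
Qed.

End convergence.

Theorem theorem4p2 (R : realType) (d : nat) (hd : d = 2%N \/ d = 3%N)
  (Omega : set 'rV[R]_d) (hOmega : lipschitz_domain Omega)
  (CP : R) (hCP : poincare_constant Omega CP)
  (nu : R) (hnu : 0 < nu)
  (f : R -> ('I_d -> 'rV[R]_d -> R) -> R) (hf : forcing Omega f)
  (w0 : 'I_d -> 'rV[R]_d -> R)
  (w wt wtt : R -> 'I_d -> 'rV[R]_d -> R) (q : R -> 'rV[R]_d -> R)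
  (hsol : nse_solution Omega nu f w0 w wt q)
  (hwtt : has_time_derivative Omega wt wtt)
  (hw_reg : Linf (vsobolev Omega 3)
    (fun u => (vsobolev_norm Omega 3 u)%:E) w)
  (hwt_reg : Linf (vsobolev Omega 1)
    (fun u => (vsobolev_norm Omega 1 u)%:E) wt)
  (hwtt_reg : Linf (vsobolev Omega 1)
    (fun u => (vsobolev_norm Omega 1 u)%:E) wtt)
  (hq_reg : Linf (sobolev Omega 1) (fun p => (sobolev_norm Omega 1 p)%:E) q)
  (Cw Cq : \bar R) (hCw : Cw = C_w Omega w wt wtt) (hCq : Cq = C_q Omega q) :
  exists2 C0 : R, 0 < C0 &
  exists C : R,
  forall (k : nat) (sigma CI H : R)
    (IH : ('I_d -> 'rV[R]_d -> R) -> ('I_d -> 'rV[R]_d -> R))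
    (dt eps mu : R) (u : nat -> 'I_d -> 'rV[R]_d -> R),
  0 < CI -> 0 < H -> interpolant Omega k sigma H CI IH ->
  0 < eps ->
  0 < dt -> dt <= 1 ->
  dt ^- 2 <= mu ->
  ((C0 * nu^-1)%:E * Cw ^+ 2 - (CP ^- 2 * (nu / 2))%:E < mu%:E)%E ->
  mu * H ^+ 2 <= nu / (2 * CI ^+ 2) ->
  cda_penalty Omega nu dt eps mu IH f w0 w u ->
  forall n : nat, (0 < n)%N ->
    vL2norm Omega (u n - w (n%:R * dt)) <= C * dt.

Proof.
have [oOmega _ _ _] := hOmega; exists 1 => //.
have Xw := nse_X hsol; have cw := proj1 (nse_time_derivative hsol).
have [_ _ wK] := hw_reg; have [[_ _ fK] fb] := hf.
have [M M0 wM] := uniform_X_bound oOmega Xw cw wK.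
have [F F0 FK] := lt_pinfty_real_bound fK.
have fF t : 0 < t -> forall v, X Omega v -> `|f t v| <= F * gradnorm Omega v.
  by move=> /fb[Hf fn]; apply: Hm1_bounded => //; exact: le_trans fn FK.
have nu16 : 0 < nu / 16 by rewrite divr_gt0.
have [C C0 btC] := btilde_le hd oOmega nu16 M0.
(* Built from nu, M, F and C only, hence fixed before the mesh, dt, eps, mu and the discrete
   solution are introduced. *)
exists (Num.sqrt (40 * error_constant nu M F (stability_constant nu M F) C)).
move=> k sigma CI H IH dt eps mu u CI0 H0 [N [T [_ IHL2 _ IHle _]]] eps0 dt0 dt1 dtmu _ muH cda n n0.
rewrite -(nse_init hsol) in cda.
exact: (cda_error hd oOmega hnu M0 Xw wM (nse_div hsol) fF eps0 dt0 dt1 dtmu CI0 muH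
  (fun v Xv => proj1 (IHL2 v Xv)) IHle cda C0 btC n0).
Qed.
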